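(* Let $\mathbb{F}$ be a field of characteristic $0$, let $A$ be the free associative interchange algebra, and let $\{a,b\}_\circ=a\circ b+b\circ a$, $\{a,b\}_\bullet=a\bullet b+b\bullet a$. Every multilinear identity in degree 6 satisfied by these two Jordan products in $A$ is a consequence of: (i) commutativity and the linearized Jordan identity $\{a,\{b,\{a,a\}\}\}\equiv\{\{a,b\},\{a,a\}\}$ for each Jordan product; (ii) the linearization of $\{\{aa\}_\circ\{aa\}_\circ\}_\bullet-\{\{aa\}_\bullet\{aa\}_\bullet\}_\circ\equiv0$; (iii) the linearizations of $\{\{ab\}_\circ\{a\{aa\}_\circ\}_\circ\}_\bullet-\{\{aa\}_\bullet\{b\{aa\}_\circ\}_\bullet\}_\circ\equiv0$ and $\{\{aa\}_\circ\{b\{aa\}_\bullet\}_\circ\}_\bullet-\{\{ab\}_\bullet\{a\{aa\}_\bullet\}_\bullet\}_\circ\equiv0$; (iv) the linearizations of the following 14 identities (each set $\equiv 0$): (1) $\{\{aa\}_\circ\{a\{a\{aa\}_\bullet\}_\circ\}_\bullet\}_\bullet-\{\{a\{aa\}_\circ\}_\bullet\{a\{aa\}_\bullet\}_\circ\}_\bullet$; (2) $\{\{aa\}_\bullet\{a\{a\{aa\}_\circ\}_\bullet\}_\circ\}_\circ-\{\{a\{aa\}_\circ\}_\bullet\{a\{aa\}_\bullet\}_\circ\}_\circ$; (3) $\{\{aa\}_\circ\{b\{a\{aa\}_\bullet\}_\circ\}_\bullet\}_\bullet-\{\{b\{aa\}_\circ\}_\bullet\{a\{aa\}_\bullet\}_\circ\}_\bullet$;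 (4) $\{\{aa\}_\bullet\{b\{a\{aa\}_\circ\}_\bullet\}_\circ\}_\circ-\{\{a\{aa\}_\circ\}_\bullet\{b\{aa\}_\bullet\}_\circ\}_\circ$; (5) $\{\{a\{aa\}_\circ\}_\circ\{b\{aa\}_\bullet\}_\circ\}_\bullet-\{\{b\{aa\}_\circ\}_\bullet\{a\{aa\}_\bullet\}_\bullet\}_\circ$; (6) $\{\{aa\}_\bullet\{a\{b\{aa\}_\circ\}_\bullet\}_\bullet\}_\circ-\{\{aa\}_\bullet\{b\{a\{aa\}_\circ\}_\bullet\}_\bullet\}_\circ+\{\{a\{aa\}_\circ\}_\circ\{a\{ab\}_\bullet\}_\circ\}_\bullet-2\{\{a\{aa\}_\circ\}_\bullet\{a\{ab\}_\bullet\}_\bullet\}_\circ+\{\{a\{aa\}_\circ\}_\bullet\{b\{aa\}_\bullet\}_\bullet\}_\circ$; (7) $2\{\{aa\}_\bullet\{a\{b\{aa\}_\bullet\}_\circ\}_\bullet\}_\circ+2\{\{aa\}_\bullet\{b\{a\{aa\}_\bullet\}_\circ\}_\bullet\}_\circ-4\{\{ab\}_\bullet\{a\{a\{aa\}_\bullet\}_\circ\}_\bullet\}_\circ-2\{\{a\{ab\}_\circ\}_\circ\{a\{aa\}_\bullet\}_\circ\}_\bullet+3\{\{b\{aa\}_\circ\}_\circ\{a\{aa\}_\bullet\}_\circ\}_\bullet-2\{\{a\{aa\}_\circ\}_\bullet\{b\{aa\}_\bullet\}_\bullet\}_\circ+\{\{b\{aa\}_\circ\}_\bullet\{a\{aa\}_\bullet\}_\bullet\}_\circ$;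 (8) $2\{\{aa\}_\circ\{\{ab\}_\circ\{ab\}_\circ\}_\bullet\}_\bullet-\{\{a\{aa\}_\bullet\}_\bullet\{a\{bb\}_\bullet\}_\bullet\}_\circ-2\{\{a\{ab\}_\bullet\}_\bullet\{b\{aa\}_\bullet\}_\bullet\}_\circ+\{\{b\{aa\}_\bullet\}_\bullet\{b\{aa\}_\bullet\}_\bullet\}_\circ$; (9) $\{\{bb\}_\bullet\{\{aa\}_\circ\{aa\}_\bullet\}_\bullet\}_\circ+2\{\{a\{ab\}_\circ\}_\circ\{b\{aa\}_\bullet\}_\circ\}_\bullet-\{\{b\{aa\}_\circ\}_\circ\{b\{aa\}_\bullet\}_\circ\}_\bullet-2\{\{b\{ab\}_\circ\}_\bullet\{a\{aa\}_\bullet\}_\bullet\}_\circ$; (10) $2\{\{aa\}_\bullet\{\{ab\}_\bullet\{ab\}_\bullet\}_\circ\}_\circ-\{\{a\{aa\}_\circ\}_\circ\{a\{bb\}_\circ\}_\circ\}_\bullet-2\{\{a\{ab\}_\circ\}_\circ\{b\{aa\}_\circ\}_\circ\}_\bullet+\{\{b\{aa\}_\circ\}_\circ\{b\{aa\}_\circ\}_\circ\}_\bullet$; (11) $2\{\{aa\}_\bullet\{a\{b\{ab\}_\circ\}_\bullet\}_\bullet\}_\circ-2\{\{aa\}_\bullet\{b\{a\{ab\}_\circ\}_\bullet\}_\bullet\}_\circ+2\{\{aa\}_\bullet\{b\{b\{aa\}_\bullet\}_\circ\}_\bullet\}_\circ-2\{\{bb\}_\bullet\{a\{a\{aa\}_\bullet\}_\circ\}_\bullet\}_\circ-2\{\{aa\}_\bullet\{\{ab\}_\circ\{ab\}_\bullet\}_\bullet\}_\circ+\{\{bb\}_\bullet\{\{aa\}_\circ\{aa\}_\bullet\}_\bullet\}_\circ-\{\{a\{aa\}_\circ\}_\bullet\{a\{bb\}_\bullet\}_\bullet\}_\circ+2\{\{a\{aa\}_\circ\}_\bullet\{b\{ab\}_\bullet\}_\bullet\}_\circ$;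 (12) $\sum_{\sigma\in S_2}\epsilon(\sigma)\big[\{\{aa\}_\circ\{b^\sigma\{c^\sigma\{aa\}_\bullet\}_\circ\}_\circ\}_\bullet+\{\{aa\}_\circ\{b^\sigma\{a\{ac^\sigma\}_\bullet\}_\circ\}_\circ\}_\bullet+\{\{aa\}_\bullet\{b^\sigma\{c^\sigma\{aa\}_\circ\}_\bullet\}_\bullet\}_\circ+\{\{aa\}_\bullet\{b^\sigma\{a\{ac^\sigma\}_\circ\}_\bullet\}_\bullet\}_\circ-\{\{aa\}_\bullet\{a\{b^\sigma\{ac^\sigma\}_\circ\}_\bullet\}_\bullet\}_\circ-\{\{aa\}_\bullet\{a\{b^\sigma\{ac^\sigma\}_\bullet\}_\circ\}_\bullet\}_\circ-2\{\{b^\sigma\{ac^\sigma\}_\circ\}_\circ\{a\{aa\}_\bullet\}_\circ\}_\bullet+2\{\{a\{ab^\sigma\}_\circ\}_\circ\{a\{ac^\sigma\}_\bullet\}_\circ\}_\bullet-2\{\{a\{ab^\sigma\}_\circ\}_\bullet\{a\{ac^\sigma\}_\bullet\}_\bullet\}_\circ-2\{\{a\{aa\}_\circ\}_\bullet\{b^\sigma\{ac^\sigma\}_\bullet\}_\bullet\}_\circ\big]$, where $\sigma$ runs over the permutations of $\{b,c\}$ and $\epsilon(\sigma)$ is the sign; (13) $2\{\{ab\}_\bullet\{\{bb\}_\circ\{aa\}_\bullet\}_\bullet\}_\circ-2\{\{a\{bb\}_\circ\}_\circ\{b\{aa\}_\bullet\}_\circ\}_\bullet-\{\{b\{bb\}_\circ\}_\circ\{a\{aa\}_\bullet\}_\circ\}_\bullet+\{\{b\{bb\}_\circ\}_\bullet\{a\{aa\}_\bullet\}_\bullet\}_\circ$;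 (14) $\{\{bb\}_\bullet\{a\{b\{aa\}_\circ\}_\bullet\}_\bullet\}_\circ-\{\{bb\}_\bullet\{b\{a\{aa\}_\circ\}_\bullet\}_\bullet\}_\circ-2\{\{ab\}_\bullet\{b\{b\{aa\}_\bullet\}_\circ\}_\bullet\}_\circ+\{\{bb\}_\bullet\{a\{b\{aa\}_\bullet\}_\circ\}_\bullet\}_\circ+\{\{bb\}_\bullet\{b\{a\{aa\}_\bullet\}_\circ\}_\bullet\}_\circ-\{\{ab\}_\bullet\{\{bb\}_\circ\{aa\}_\bullet\}_\bullet\}_\circ-\{\{bb\}_\bullet\{\{aa\}_\circ\{ab\}_\bullet\}_\bullet\}_\circ-\{\{bb\}_\bullet\{\{ab\}_\circ\{aa\}_\bullet\}_\bullet\}_\circ+\{\{a\{bb\}_\circ\}_\bullet\{b\{aa\}_\bullet\}_\bullet\}_\circ+2\{\{b\{ab\}_\circ\}_\bullet\{b\{aa\}_\bullet\}_\bullet\}_\circ$.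
   Context: An associative interchange algebra is a vector space with two associative bilinear operations $\circ,\bullet$ satisfying $(a\circ b)\bullet(c\circ d)\equiv(a\bullet c)\circ(b\bullet d)$. Inside braces, juxtaposition separates the two arguments: $\{xy\}_\circ=\{x,y\}_\circ$. An identity is a consequence of a set $S$ if it lies in the smallest subspace of the free nonassociative algebra on two commutative operations containing $S$ and closed under substitution of polynomials for variables and multiplication by polynomials. The linearization of a homogeneous identity is its complete multilinearization, equivalent to it in characteristic 0. *)

(* Defs.v *)
From Stdlib Require List.
From HB Require Import structures.
From mathcomp Require Import all_boot all_order all_algebra.
Set Implicit Arguments. Unset Strict Implicit. Unset Printing Implicit Defensive.
Import Order.TTheory GRing.Theory Num.Theory.
Local Open Scope ring_scope.

(* Polynomial expressions in two binary operations  o (circ) and  * (bullet) *)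
(* over the variables x_0, x_1, x_2, ...  An expression denotes an element   *)
(* of the free nonassociative (non-commutative) algebra F{X; o, *}; two       *)
(* expressions denote the same element iff they have the same coefficient    *)
(* function  coef : term -> F  on nonassociative monomials.                  *)

Inductive poly (F : Type) : Type :=
| Var of nat
| Zero
| Add of poly F & poly F
| Scale of F & poly F
| MulC of poly F & poly F
| MulB of poly F & poly F.

Arguments Var {F} _.
Arguments Zero {F}.
Arguments Add {F} _ _.
Arguments Scale {F} _ _.
Arguments MulC {F} _ _.
Arguments MulB {F} _ _.

Inductive term : Type :=
| TV of nat
| TC of term & term
| TB of term & term.

Fixpoint coef (F : pzRingType) (p : poly F) (t : term) {struct p} : F :=
  match p with
  | Var i => match t with TV j => if i == j then 1 else 0 | _ => 0 end
  | Zero => 0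
  | Add p q => coef p t + coef q t
  | Scale k p => k * coef p t
  | MulC p q => match t with TC u v => coef p u * coef q v | _ => 0 end
  | MulB p q => match t with TB u v => coef p u * coef q v | _ => 0 end
  end.

Fixpoint occ (i : nat) (t : term) : nat :=
  match t with
  | TV j => (i == j)
  | TC u v => occ i u + occ i v
  | TB u v => occ i u + occ i v
  end.

Fixpoint subst (F : Type) (s : nat -> poly F) (p : poly F) : poly F :=
  match p with
  | Var i => s i
  | Zero => Zero
  | Add p q => Add (subst s p) (subst s q)
  | Scale k p => Scale k (subst s p)
  | MulC p q => MulC (subst s p) (subst s q)
  | MulB p q => MulB (subst s p) (subst s q)
  end.

(* "consequences" of a set S: the smallest subspace of the free algebra
   containing S, closed under substitution of polynomials for variables and
   under multiplication (on either side, by either operation) by arbitrary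
   polynomials.  Elements of the free algebra are represented by expressions
   up to equality of coefficient functions (rule cq_ext). *)
Inductive conseq (F : pzRingType) (S : poly F -> Prop) : poly F -> Prop :=
| cq_gen p : S p -> conseq S p
| cq_zero : conseq S Zero
| cq_add p q : conseq S p -> conseq S q -> conseq S (Add p q)
| cq_scale k p : conseq S p -> conseq S (Scale k p)
| cq_subst (s : nat -> poly F) p : conseq S p -> conseq S (subst s p)
| cq_mulCl q p : conseq S p -> conseq S (MulC q p)
| cq_mulCr q p : conseq S p -> conseq S (MulC p q)
| cq_mulBl q p : conseq S p -> conseq S (MulB q p)
| cq_mulBr q p : conseq S p -> conseq S (MulB p q)
| cq_ext p q : conseq S p -> (forall t, coef p t = coef q t) -> conseq S q.

Section Gens.
Variable F : pzRingType.

Definition lc (l : seq (int * poly F)) : poly F :=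
  foldr (fun kp acc => Add (Scale (kp.1)%:~R kp.2) acc) Zero l.
Definition psub (p q : poly F) : poly F := lc [:: (1%Z, p); ((-1)%Z, q)].

(* A = F{X; o, *} / T, where T is the T-ideal generated by associativity of
   both operations and the interchange law (A is the relatively free algebra
   of the variety of associative interchange algebras, on countably many
   generators x_0, x_1, ...). *)
Definition x0 : poly F := Var 0.
Definition x1 : poly F := Var 1.
Definition x2 : poly F := Var 2.
Definition x3 : poly F := Var 3.

Definition AIA_laws (p : poly F) : Prop :=
  p = psub (MulC (MulC x0 x1) x2) (MulC x0 (MulC x1 x2)) \/
  p = psub (MulB (MulB x0 x1) x2) (MulB x0 (MulB x1 x2)) \/
  p = psub (MulB (MulC x0 x1) (MulC x2 x3)) (MulC (MulB x0 x2) (MulB x1 x3)).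

Definition zero_in_A (p : poly F) : Prop := conseq AIA_laws p.

(* Evaluate an expression with the operations o, * read as the Jordan
   products {x,y}_o = x o y + y o x and {x,y}_* = x * y + y * x of A. *)
Fixpoint jordan (p : poly F) : poly F :=
  match p with
  | Var i => Var i
  | Zero => Zero
  | Add p q => Add (jordan p) (jordan q)
  | Scale k p => Scale k (jordan p)
  | MulC p q => Add (MulC (jordan p) (jordan q)) (MulC (jordan q) (jordan p))
  | MulB p q => Add (MulB (jordan p) (jordan q)) (MulB (jordan q) (jordan p))
  end.

Definition satisfied_jordan_AIA (f : poly F) : Prop :=
  forall s : nat -> poly F, zero_in_A (subst s (jordan f)).

Definition multilinear6 (f : poly F) : Prop :=
  exists vs : seq nat, [/\ uniq vs, size vs = 6%N &
    forall t, coef f t != 0 -> forall i, occ i t = (if i \in vs then 1%N else 0%N)].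

(* degree of x_i in a homogeneous expression (read off its first monomial) *)
Fixpoint hdeg (i : nat) (p : poly F) : nat :=
  match p with
  | Var j => (i == j)
  | Zero => 0
  | Add p _ => hdeg i p
  | Scale _ p => hdeg i p
  | MulC p q => hdeg i p + hdeg i q
  | MulB p q => hdeg i p + hdeg i q
  end.

Definition psum (l : seq (poly F)) : poly F := foldr Add Zero l.

(* Complete linearization of an identity g homogeneous in a = x_0, b = x_1,
   c = x_2 of degrees da, db, dc: substitute a := y_1 + ... + y_da,
   b := z_1 + ... + z_db, c := w_1 + ... + w_dc (fresh variables
   x_0 .. x_(da+db+dc-1)) and keep the part multilinear in all new
   variables. Returned as a coefficient function. *)
Definition lin (g : poly F) : term -> F :=
  let da := hdeg 0 g in let db := hdeg 1 g in let dc := hdeg 2 g in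
  let n := (da + db + dc)%N in
  let s := fun i => match i with
                    | 0 => psum [seq Var k | k <- iota 0 da]
                    | 1 => psum [seq Var k | k <- iota da db]
                    | 2 => psum [seq Var k | k <- iota (da + db) dc]
                    | _ => Var i end in
  fun t => if all (fun j => occ j t == 1%N) (iota 0 n)
           then coef (subst s g) t else 0.

Definition a : poly F := Var 0.
Definition b : poly F := Var 1.
Definition c : poly F := Var 2.
Definition co (x y : poly F) : poly F := MulC x y.
Definition bu (x y : poly F) : poly F := MulB x y.

Definition commC := psub (co a b) (co b a).
Definition commB := psub (bu a b) (bu b a).
Definition jordanC := psub (co a (co b (co a a))) (co (co a b) (co a a)).
Definition jordanB := psub (bu a (bu b (bu a a))) (bu (bu a b) (bu a a)).
Definition id_ii := psub (bu (co a a) (co a a)) (co (bu a a) (bu a a)).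
Definition id_iii1 := psub (bu (co a b) (co a (co a a))) (co (bu a a) (bu b (co a a))).
Definition id_iii2 := psub (bu (co a a) (co b (bu a a))) (co (bu a b) (bu a (bu a a))).
Definition g1 := psub (bu (co a a) (bu a (co a (bu a a)))) (bu (bu a (co a a)) (co a (bu a a))).
Definition g2 := psub (co (bu a a) (co a (bu a (co a a)))) (co (bu a (co a a)) (co a (bu a a))).
Definition g3 := psub (bu (co a a) (bu b (co a (bu a a)))) (bu (bu b (co a a)) (co a (bu a a))).
Definition g4 := psub (co (bu a a) (co b (bu a (co a a)))) (co (bu a (co a a)) (co b (bu a a))).
Definition g5 := psub (bu (co a (co a a)) (co b (bu a a))) (co (bu b (co a a)) (bu a (bu a a))).
Definition g6 := lc [::
  (1%Z, co (bu a a) (bu a (bu b (co a a))));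
  ((-1)%Z, co (bu a a) (bu b (bu a (co a a))));
  (1%Z, bu (co a (co a a)) (co a (bu a b)));
  ((-2)%Z, co (bu a (co a a)) (bu a (bu a b)));
  (1%Z, co (bu a (co a a)) (bu b (bu a a)))].
Definition g7 := lc [::
  (2%Z, co (bu a a) (bu a (co b (bu a a))));
  (2%Z, co (bu a a) (bu b (co a (bu a a))));
  ((-4)%Z, co (bu a b) (bu a (co a (bu a a))));
  ((-2)%Z, bu (co a (co a b)) (co a (bu a a)));
  (3%Z, bu (co b (co a a)) (co a (bu a a)));
  ((-2)%Z, co (bu a (co a a)) (bu b (bu a a)));
  (1%Z, co (bu b (co a a)) (bu a (bu a a)))].
Definition g8 := lc [::
  (2%Z, bu (co a a) (bu (co a b) (co a b)));
  ((-1)%Z, co (bu a (bu a a)) (bu a (bu b b)));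
  ((-2)%Z, co (bu a (bu a b)) (bu b (bu a a)));
  (1%Z, co (bu b (bu a a)) (bu b (bu a a)))].
Definition g9 := lc [::
  (1%Z, co (bu b b) (bu (co a a) (bu a a)));
  (2%Z, bu (co a (co a b)) (co b (bu a a)));
  ((-1)%Z, bu (co b (co a a)) (co b (bu a a)));
  ((-2)%Z, co (bu b (co a b)) (bu a (bu a a)))].
Definition g10 := lc [::
  (2%Z, co (bu a a) (co (bu a b) (bu a b)));
  ((-1)%Z, bu (co a (co a a)) (co a (co b b)));
  ((-2)%Z, bu (co a (co a b)) (co b (co a a)));
  (1%Z, bu (co b (co a a)) (co b (co a a)))].
Definition g11 := lc [::
  (2%Z, co (bu a a) (bu a (bu b (co a b))));
  ((-2)%Z, co (bu a a) (bu b (bu a (co a b))));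
  (2%Z, co (bu a a) (bu b (co b (bu a a))));
  ((-2)%Z, co (bu b b) (bu a (co a (bu a a))));
  ((-2)%Z, co (bu a a) (bu (co a b) (bu a b)));
  (1%Z, co (bu b b) (bu (co a a) (bu a a)));
  ((-1)%Z, co (bu a (co a a)) (bu a (bu b b)));
  (2%Z, co (bu a (co a a)) (bu b (bu a b)))].
(* the bracketed summand of (12), as a function of (b^sigma, c^sigma) *)
Definition E12 (y z : poly F) := lc [::
  (1%Z, bu (co a a) (co y (co z (bu a a))));
  (1%Z, bu (co a a) (co y (co a (bu a z))));
  (1%Z, co (bu a a) (bu y (bu z (co a a))));
  (1%Z, co (bu a a) (bu y (bu a (co a z))));
  ((-1)%Z, co (bu a a) (bu a (bu y (co a z))));
  ((-1)%Z, co (bu a a) (bu a (co y (bu a z))));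
  ((-2)%Z, bu (co y (co a z)) (co a (bu a a)));
  (2%Z, bu (co a (co a y)) (co a (bu a z)));
  ((-2)%Z, co (bu a (co a y)) (bu a (bu a z)));
  ((-2)%Z, co (bu a (co a a)) (bu y (bu a z)))].
Definition g12 := psub (E12 b c) (E12 c b).
Definition g13 := lc [::
  (2%Z, co (bu a b) (bu (co b b) (bu a a)));
  ((-2)%Z, bu (co a (co b b)) (co b (bu a a)));
  ((-1)%Z, bu (co b (co b b)) (co a (bu a a)));
  (1%Z, co (bu b (co b b)) (bu a (bu a a)))].
Definition g14 := lc [::
  (1%Z, co (bu b b) (bu a (bu b (co a a))));
  ((-1)%Z, co (bu b b) (bu b (bu a (co a a))));
  ((-2)%Z, co (bu a b) (bu b (co b (bu a a))));
  (1%Z, co (bu b b) (bu a (co b (bu a a))));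
  (1%Z, co (bu b b) (bu b (co a (bu a a))));
  ((-1)%Z, co (bu a b) (bu (co b b) (bu a a)));
  ((-1)%Z, co (bu b b) (bu (co a a) (bu a b)));
  ((-1)%Z, co (bu b b) (bu (co a b) (bu a a)));
  (1%Z, co (bu a (co b b)) (bu b (bu a a)));
  (2%Z, co (bu b (co a b)) (bu b (bu a a)))].

Definition identities : seq (poly F) :=
  [:: commC; commB; jordanC; jordanB; id_ii; id_iii1; id_iii2;
      g1; g2; g3; g4; g5; g6; g7; g8; g9; g10; g11; g12; g13; g14].

Definition gens (p : poly F) : Prop :=
  exists2 g, List.In g identities & forall t, coef p t = lin g t.

End Gens.

(* Main.v *)
(* Two nonassociative monomials are equal in the free associative interchange algebra iff they are
   linked by associativity and interchange steps, so an element vanishes there iff every function on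
   monomials that is constant along the steps pairs to 0 with it. Applied to the Jordan expansion
   of f, the indicators of the step classes give linear equations for the coefficients of f, viewed
   on multilinear monomials of degree 6 up to commutativity. These monomials fall into blocks such
   that each equation lives in one block, and up to renaming of variables there are 43 blocks. In
   each of them, consequences of the identities in echelon form remove the pivot coefficients of f,
   and the equations restricted to the remaining monomials have only the zero solution. Clearing
   the blocks one after the other leaves a polynomial whose Jordan expansion is 0, that is, a
   consequence of commutativity alone. *)
From Stdlib Require Import ZArith FMapPositive.
Require Import Defs.
From HB Require Import structures.
From mathcomp Require Import all_boot all_order all_algebra.
From mathcomp Require Import zify ssrZ ring.
Import GRing.Theory.
Set Implicit Arguments. Unset Strict Implicit. Unset Printing Implicit Defensive.
Local Open Scope ring_scope.


(** In six variables there are 945 * 32 = 30240 multilinear monomials up to commutativity. Renaming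
    keeps the linear algebra small: a block is solved once in the variables 0 to 5 and transported
    along injective maps of variables. No quotient by commutativity is formed; the coordinate of [f]
    at the class of [t] is [J f t], the coefficient of [t] in the Jordan expansion. The class
    equations must survive the subtraction of consequences, so every consequence in use has to
    vanish in the free algebra, and the certificate checks this as well. Elimination is
    fraction-free over the integers, and full rank means a nonzero integer pivot at every number;
    characteristic 0 makes these pivots invertible, and also the 2 needed for symmetrization.
    Searches, tables, numberings and fuel are never proved adequate: what they return is tested, or
    is sound whatever they return, so a wrong table could only make the certificate evaluate to
    false. *)

(** * Monomials, leaves and renaming *)

Fixpoint term_eqb (t u : term) : bool :=
  match t, u with
  | TV i, TV j => eqn i j
  | TC a b, TC c d => term_eqb a c && term_eqb b d
  | TB a b, TB c d => term_eqb a c && term_eqb b d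
  | _, _ => false
  end.

Lemma term_eqP : Equality.axiom term_eqb.
Proof.
elim=> [i|a IHa b IHb|a IHa b IHb] [j|c d|c d] /=; try by constructor.
- by apply: (iffP eqnP) => [->|[]].
- by apply: (iffP andP) => [[/IHa-> /IHb->]|[<- <-]] //; split; [apply/IHa|apply/IHb].
- by apply: (iffP andP) => [[/IHa-> /IHb->]|[<- <-]] //; split; [apply/IHa|apply/IHb].
Qed.

HB.instance Definition _ := hasDecEq.Build term term_eqP.

Fixpoint leaves (t : term) : seq nat :=
  match t with TV i => [:: i] | TC u v | TB u v => leaves u ++ leaves v end.

Fixpoint ren (s : nat -> nat) (t : term) : term :=
  match t with
  | TV i => TV (s i)
  | TC u v => TC (ren s u) (ren s v)
  | TB u v => TB (ren s u) (ren s v)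
  end.

Lemma leaves_ren s t : leaves (ren s t) = map s (leaves t).
Proof. by elim: t => //= u -> v ->; rewrite map_cat. Qed.

Lemma ren_comp s s' t : ren s (ren s' t) = ren (s \o s') t.
Proof. by elim: t => //= u -> v ->. Qed.

Lemma ren_inj s : injective s -> injective (ren s).
Proof.
move=> s_inj; elim=> [i|u IHu v IHv|u IHu v IHv] [j|u' v'|u' v'] //= [].
- by move/s_inj->.
- by move/IHu-> => /IHv->.
- by move/IHu-> => /IHv->.
Qed.

Lemma occ_count i t : occ i t = count_mem i (leaves t).
Proof.
elim: t => /= [j|u -> v ->|u -> v ->]; rewrite ?count_cat //.
by rewrite addn0 eq_sym.
Qed.

(** * Linear functionals on the free nonassociative algebra *)

Section Pairing.
Variable F : fieldType.
Notation poly := (Defs.poly F).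
Implicit Types (p q : poly) (chi : term -> F).

(* [pr p chi] is the sum of [coef p t * chi t] over all monomials [t]. *)
Fixpoint pr p chi : F :=
  match p with
  | Var i => chi (TV i)
  | Zero => 0
  | Add p q => pr p chi + pr q chi
  | Scale k p => k * pr p chi
  | MulC p q => pr p (fun u => pr q (fun v => chi (TC u v)))
  | MulB p q => pr p (fun u => pr q (fun v => chi (TB u v)))
  end.

Lemma eq_pr p chi chi' : chi =1 chi' -> pr p chi = pr p chi'.
Proof.
elim: p chi chi' => [i||p IHp q IHq|k p IHp|p IHp q IHq|p IHp q IHq] chi chi' e //=.
- by rewrite (IHp _ _ e) (IHq _ _ e).
- by rewrite (IHp _ _ e).
- by apply: IHp => u; apply: IHq.
- by apply: IHp => u; apply: IHq.
Qed.

Lemma prD p chi chi' : pr p (fun t => chi t + chi' t) = pr p chi + pr p chi'.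
Proof.
elim: p chi chi' => [i||p IHp q IHq|k p IHp|p IHp q IHq|p IHp q IHq] chi chi' //=.
- by rewrite addr0.
- by rewrite IHp IHq addrACA.
- by rewrite IHp mulrDr.
- by rewrite -IHp; apply: eq_pr => u; rewrite IHq.
- by rewrite -IHp; apply: eq_pr => u; rewrite IHq.
Qed.

Lemma prZ p k chi : pr p (fun t => k * chi t) = k * pr p chi.
Proof.
elim: p chi => [i||p IHp q IHq|k' p IHp|p IHp q IHq|p IHp q IHq] chi //=.
- by rewrite mulr0.
- by rewrite IHp IHq mulrDr.
- by rewrite IHp mulrCA.
- by rewrite -IHp; apply: eq_pr => u; rewrite IHq.
- by rewrite -IHp; apply: eq_pr => u; rewrite IHq.
Qed.

Lemma pr0 p : pr p (fun=> 0) = 0.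
Proof.
rewrite -[RHS](mul0r (pr p (fun=> 1))) -prZ.
by apply: eq_pr => t; rewrite mul0r.
Qed.

Lemma pr_sum (I : Type) (s : seq I) p (chi : I -> term -> F) :
  pr p (fun t => \sum_(i <- s) chi i t) = \sum_(i <- s) pr p (chi i).
Proof.
elim: s => [|i s IHs].
  by rewrite big_nil -[RHS](pr0 p); apply: eq_pr => t; rewrite big_nil.
by rewrite big_cons -IHs -prD; apply: eq_pr => t; rewrite big_cons.
Qed.

(** Fubini for finite sums. On a product, [pr] puts the sum over the left factor outside, so an
    argument about that factor must first bring its sum inside. *)
Lemma pr_swap p q (g : term -> term -> F) :
  pr p (fun u => pr q (g u)) = pr q (fun v => pr p (g^~ v)).
Proof.
elim: p g => [i||p IHp p' IHp'|k p IHp|p IHp p' IHp'|p IHp p' IHp'] g //=.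
- by rewrite pr0.
- by rewrite IHp IHp' -prD.
- by rewrite IHp -prZ.
- rewrite -(IHp (fun u v => pr p' (fun u' => g (TC u u') v))).
  by apply: eq_pr => u; rewrite IHp'.
- rewrite -(IHp (fun u v => pr p' (fun u' => g (TB u u') v))).
  by apply: eq_pr => u; rewrite IHp'.
Qed.

Lemma pr_mul p q (c d : term -> F) :
  pr p (fun u => pr q (fun v => c u * d v)) = pr p c * pr q d.
Proof.
rewrite mulrC -prZ; apply: eq_pr => u.
by rewrite prZ mulrC.
Qed.

Lemma coef_pr p t : coef p t = pr p (fun u => (u == t)%:R).
Proof.
elim: p t => [i||p IHp q IHq|k p IHp|p IHp q IHq|p IHp q IHq] t //=.
- by case: t => [j|u v|u v] //; case: eqVneq => [->|ne]; rewrite ?eqxx //;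
    case: eqP => // -[/eqP]; rewrite (negPf ne).
- by rewrite IHp IHq.
- by rewrite IHp.
- case: t => [j|u v|u v]; rewrite ?IHp ?IHq -?pr_mul -?[LHS](pr0 p);
    apply: eq_pr => a; rewrite -?[LHS](pr0 q); apply: eq_pr => b //.
  by rewrite -natrM mulnb.
- case: t => [j|u v|u v]; rewrite ?IHp ?IHq -?pr_mul -?[LHS](pr0 p);
    apply: eq_pr => a; rewrite -?[LHS](pr0 q); apply: eq_pr => b //.
  by rewrite -natrM mulnb.
Qed.

(** Only an upper bound of the support: cancellations and zero scalars are ignored, repetitions are
    kept. *)
Fixpoint supp p : seq term :=
  match p with
  | Var i => [:: TV i]
  | Zero => [::]
  | Add p q => supp p ++ supp q
  | Scale _ p => supp p
  | MulC p q => [seq TC u v | u <- supp p, v <- supp q]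
  | MulB p q => [seq TB u v | u <- supp p, v <- supp q]
  end.

Lemma eq_in_pr p chi chi' : {in supp p, chi =1 chi'} -> pr p chi = pr p chi'.
Proof.
elim: p chi chi' => [i||p IHp q IHq|k p IHp|p IHp q IHq|p IHp q IHq] chi chi' e //=.
- by apply: e; rewrite inE.
- by rewrite (IHp chi chi') ?(IHq chi chi') // => t tp; apply: e; rewrite /= mem_cat tp ?orbT.
- by rewrite (IHp chi chi').
- by apply: IHp => u up; apply: IHq => v vp; apply: e; apply: allpairs_f.
- by apply: IHp => u up; apply: IHq => v vp; apply: e; apply: allpairs_f.
Qed.

Lemma pr_supp p (s : seq term) chi : uniq s -> {subset supp p <= s} ->
  pr p chi = \sum_(t <- s) coef p t * chi t.
Proof.
move=> s_uniq sub.
transitivity (pr p (fun u => \sum_(t <- s) chi t * (u == t)%:R)).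
  apply: eq_in_pr => u /sub us.
  rewrite (bigD1_seq u) //= eqxx mulr1 big1 ?addr0 // => t.
  by rewrite eq_sym => /negPf->; rewrite mulr0.
by rewrite pr_sum; apply: eq_bigr => t _; rewrite prZ -coef_pr mulrC.
Qed.

(** Expressions of the same element may have different syntactic supports, so both sums are taken
    over the union. This makes [pr] compatible with the rule [cq_ext]. *)
Lemma pr_coef p q chi : coef p =1 coef q -> pr p chi = pr q chi.
Proof.
move=> e; set s := undup (supp p ++ supp q).
rewrite !(@pr_supp _ s) ?undup_uniq //; first by apply: eq_bigr => t _; rewrite e.
- by move=> t tq; rewrite mem_undup mem_cat tq orbT.
- by move=> t tp; rewrite mem_undup mem_cat tp.
Qed.

Lemma coef_supp p t : coef p t != 0 -> t \in supp p.
Proof.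
apply: contraNT => tNp; rewrite coef_pr -[X in _ == X](pr0 p).
apply/eqP/eq_in_pr => u up; case: eqP => // ut; by rewrite ut (negPf tNp) in up.
Qed.

Fixpoint tp (t : term) : poly :=
  match t with
  | TV i => Var i
  | TC u v => MulC (tp u) (tp v)
  | TB u v => MulB (tp u) (tp v)
  end.

Lemma pr_tp t chi : pr (tp t) chi = chi t.
Proof. by elim: t chi => //= [u IHu v IHv|u IHu v IHv] chi; rewrite IHu IHv. Qed.

(** Substitution is linear, so a functional is pulled back along it monomial by monomial. *)
Lemma pr_subst s p chi : pr (subst s p) chi = pr p (fun t => pr (subst s (tp t)) chi).
Proof.
elim: p chi => [i||p IHp q IHq|k p IHp|p IHp q IHq|p IHp q IHq] chi //=.
- by rewrite IHp IHq.
- by rewrite IHp.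
- rewrite IHp; apply: eq_pr => u.
  by rewrite -[RHS]pr_swap; apply: eq_pr => v; rewrite IHq.
- rewrite IHp; apply: eq_pr => u.
  by rewrite -[RHS]pr_swap; apply: eq_pr => v; rewrite IHq.
Qed.

Lemma pr_jordan p chi : pr (jordan p) chi = pr p (fun t => pr (jordan (tp t)) chi).
Proof.
elim: p chi => [i||p IHp q IHq|k p IHp|p IHp q IHq|p IHp q IHq] chi //=.
- by rewrite IHp IHq.
- by rewrite IHp.
- rewrite [X in _ + X]pr_swap !IHp -prD; apply: eq_pr => t.
  have H g : pr (jordan (tp t)) (fun u => pr (jordan q) (g u)) =
      pr q (fun t' => pr (jordan (tp t)) (fun u => pr (jordan (tp t')) (g u))).
    by rewrite -[RHS]pr_swap; apply: eq_pr => u; rewrite IHq.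
  rewrite !H -prD; apply: eq_pr => t'; congr (_ + _).
  by rewrite pr_swap.
- rewrite [X in _ + X]pr_swap !IHp -prD; apply: eq_pr => t.
  have H g : pr (jordan (tp t)) (fun u => pr (jordan q) (g u)) =
      pr q (fun t' => pr (jordan (tp t)) (fun u => pr (jordan (tp t')) (g u))).
    by rewrite -[RHS]pr_swap; apply: eq_pr => u; rewrite IHq.
  rewrite !H -prD; apply: eq_pr => t'; congr (_ + _).
  by rewrite pr_swap.
Qed.

End Pairing.

(** * Invariants of associativity and interchange *)

Inductive step : term -> term -> Prop :=
| step_assocC x y z : step (TC (TC x y) z) (TC x (TC y z))
| step_assocB x y z : step (TB (TB x y) z) (TB x (TB y z))
| step_inter x y z w : step (TB (TC x y) (TC z w)) (TC (TB x z) (TB y w))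
| step_Cl x x' y : step x x' -> step (TC x y) (TC x' y)
| step_Cr x y y' : step y y' -> step (TC x y) (TC x y')
| step_Bl x x' y : step x x' -> step (TB x y) (TB x' y)
| step_Br x y y' : step y y' -> step (TB x y) (TB x y').

Lemma step_ren s t t' : step t t' -> step (ren s t) (ren s t').
Proof. by elim=> *; constructor. Qed.

Section Invariants.
Variable F : fieldType.
Notation poly := (Defs.poly F).
Implicit Types (p q : poly) (chi : term -> F).

(** These functionals form the dual of the free associative interchange algebra: the linear forms
    that kill its relations. *)
Definition inv chi := forall t t', step t t' -> chi t = chi t'.

Definition null p := forall chi, inv chi -> pr p chi = 0.

(** Both sides of a law contain each variable once; replacing the variables by polynomials and
    expanding gives pairs of monomials related by the same law. *)
Lemma inv_subst s chi : inv chi -> inv (fun t => pr (subst s (tp F t)) chi).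
Proof.
move=> chiP t t' tt'; elim: tt' chi chiP => /=.
- move=> x y z chi chiP; apply: eq_pr => u; apply: eq_pr => v; apply: eq_pr => w.
  exact/chiP/step_assocC.
- move=> x y z chi chiP; apply: eq_pr => u; apply: eq_pr => v; apply: eq_pr => w.
  exact/chiP/step_assocB.
(* Interchange exchanges the two middle arguments, hence the swap of the corresponding sums. *)
- move=> x y z w chi chiP; apply: eq_pr => u; rewrite pr_swap.
  apply: eq_pr => v; apply: eq_pr => u'; apply: eq_pr => v'.
  exact/chiP/step_inter.
- move=> x x' y _ IH chi chiP.
  rewrite pr_swap [RHS]pr_swap; apply: eq_pr => u; apply: IH => v v' vv'.
  exact/chiP/step_Cl.
- move=> x y y' _ IH chi chiP; apply: eq_pr => u; apply: IH => v v' vv'.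
  exact/chiP/step_Cr.
- move=> x x' y _ IH chi chiP.
  rewrite pr_swap [RHS]pr_swap; apply: eq_pr => u; apply: IH => v v' vv'.
  exact/chiP/step_Bl.
- move=> x y y' _ IH chi chiP; apply: eq_pr => u; apply: IH => v v' vv'.
  exact/chiP/step_Br.
Qed.

Lemma null_mulC p q : null p \/ null q -> null (MulC p q).
Proof.
case=> H chi chiP /=.
- rewrite pr_swap -[RHS](pr0 q); apply: eq_pr => u; apply: H => v v' vv'.
  exact/chiP/step_Cl.
- rewrite -[RHS](pr0 p); apply: eq_pr => u; apply: H => v v' vv'.
  exact/chiP/step_Cr.
Qed.

Lemma null_mulB p q : null p \/ null q -> null (MulB p q).
Proof.
case=> H chi chiP /=.
- rewrite pr_swap -[RHS](pr0 q); apply: eq_pr => u; apply: H => v v' vv'.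
  exact/chiP/step_Bl.
- rewrite -[RHS](pr0 p); apply: eq_pr => u; apply: H => v v' vv'.
  exact/chiP/step_Br.
Qed.

Lemma null_add p q : null p -> null q -> null (Add p q).
Proof. by move=> Hp Hq chi chiP /=; rewrite Hp ?Hq ?addr0. Qed.

Lemma null_subst s p : null p -> null (subst s p).
Proof. by move=> Hp chi chiP; rewrite pr_subst Hp //; apply: inv_subst. Qed.

(** Soundness of [conseq]: a law is a difference of two monomials joined by one step, and every
    closure rule preserves being killed by all invariant functionals. *)
Lemma null_zero_in_A p : zero_in_A p -> null p.
Proof.
elim=> {p}.
- move=> p pS chi chiP.
  have sub0 x y : x = y -> (1%Z)%:~R * x + ((-1)%Z%:~R * y + 0) = 0 :> F.
    by move=> ->; rewrite addr0 mulN1r mul1r subrr.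
  case: pS => [->|[->|->]] /=; apply: sub0; apply: chiP; by constructor.
- by [].
- by move=> p q _ Hp _ Hq; apply: null_add.
- by move=> k p _ Hp chi chiP /=; rewrite Hp ?mulr0.
- by move=> s p _; apply: null_subst.
- by move=> q p _ Hp; apply: null_mulC; right.
- by move=> q p _ Hp; apply: null_mulC; left.
- by move=> q p _ Hp; apply: null_mulB; right.
- by move=> q p _ Hp; apply: null_mulB; left.
- by move=> p q _ Hp e chi chiP; rewrite -(pr_coef _ e) Hp.
Qed.

Definition jnull p := null (jordan p).

Lemma jordan_subst s p : jordan (subst s p) = subst (fun i => jordan (s i)) (jordan p).
Proof. by elim: p => //= [p -> q ->|k p ->|p -> q ->|p -> q ->]. Qed.

Lemma jnull_ext p q : jnull p -> coef p =1 coef q -> jnull q.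
Proof. by move=> Hp e chi chiP; rewrite pr_jordan -(pr_coef _ e) -pr_jordan Hp. Qed.

(** [jordan] commutes with substitution and turns a product into a sum of two products, each of
    which is null as soon as one factor is. *)
Lemma jnull_conseq (S : poly -> Prop) p :
  (forall q, S q -> jnull q) -> conseq S p -> jnull p.
Proof.
move=> HS; elim=> {p} //=.
- by move=> p q _ Hp _ Hq; apply: null_add.
- by move=> k p _ Hp chi chiP /=; rewrite Hp ?mulr0.
- by move=> s p _ Hp; rewrite /jnull jordan_subst; apply: null_subst.
- by move=> q p _ Hp; apply: null_add; apply: null_mulC; auto.
- by move=> q p _ Hp; apply: null_add; apply: null_mulC; auto.
- by move=> q p _ Hp; apply: null_add; apply: null_mulB; auto.
- by move=> q p _ Hp; apply: null_add; apply: null_mulB; auto.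
- by move=> p q _ Hp e; apply: jnull_ext Hp e.
Qed.

Lemma subst_Var p : subst (@Var F) p = p.
Proof. by elim: p => //= [p -> q ->|k p ->|p -> q ->|p -> q ->]. Qed.

Lemma jnull_satisfied f : satisfied_jordan_AIA f -> jnull f.
Proof. by move=> /(_ (@Var F)); rewrite subst_Var; apply: null_zero_in_A. Qed.

(** The coordinate of [p] at the commutative class of [t]: swapping factors inside [t] does not
    change it ([jeq_swapC], [jeq_swapB]). *)
Definition J p t := coef (jordan p) t.

Lemma J_pr p t : J p t = pr p (fun u => J (tp F u) t).
Proof.
rewrite /J coef_pr pr_jordan; apply: eq_pr => u.
by rewrite coef_pr.
Qed.

Definition jeq t t' := forall p, J p t = J p t'.

Lemma jeq_C u v u' v' : jeq u u' -> jeq v v' -> jeq (TC u v) (TC u' v').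
Proof.
move=> Hu Hv; rewrite /jeq /J.
elim=> //= [p -> q ->|k p ->|p IHp q IHq] //.
by rewrite -!/(J _ _) !Hu !Hv.
Qed.

Lemma jeq_B u v u' v' : jeq u u' -> jeq v v' -> jeq (TB u v) (TB u' v').
Proof.
move=> Hu Hv; rewrite /jeq /J.
elim=> //= [p -> q ->|k p ->|p IHp q IHq] //.
by rewrite -!/(J _ _) !Hu !Hv.
Qed.

Lemma jeq_swapC u v : jeq (TC u v) (TC v u).
Proof.
rewrite /jeq /J; elim=> //= [p -> q ->|k p ->|p IHp q IHq] //.
by rewrite addrC; congr (_ + _); rewrite mulrC.
Qed.

Lemma jeq_swapB u v : jeq (TB u v) (TB v u).
Proof.
rewrite /jeq /J; elim=> //= [p -> q ->|k p ->|p IHp q IHq] //.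
by rewrite addrC; congr (_ + _); rewrite mulrC.
Qed.

Lemma jeq_trans t u v : jeq t u -> jeq u v -> jeq t v.
Proof. by move=> tu uv p; rewrite tu. Qed.

Lemma addM_neq0 (x y z w : F) : x * y + z * w != 0 ->
  (x != 0 /\ y != 0) \/ (z != 0 /\ w != 0).
Proof.
have [|xy _] := eqVneq (x * y) 0.
  by move=> ->; rewrite add0r mulf_eq0 negb_or => /andP[]; right.
by left; apply/andP; rewrite -negb_or -mulf_eq0.
Qed.

(** Expanding [m] only swaps factors, so at each product one of the two orders leads from [m] to
    [t]. *)
Lemma J_tp_neq0 m t : J (tp F m) t != 0 -> jeq m t.
Proof.
elim: m t => [i|u IHu v IHv|u IHu v IHv] [j|x y|x y];
  rewrite /J /= ?addr0 ?eqxx // -/(J _ _).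
- by case: (eqVneq i j) => [->|_] //; rewrite eqxx.
- case/addM_neq0=> -[H1 H2]; first by apply: jeq_C; [apply: IHu|apply: IHv].
  by apply: jeq_trans (jeq_swapC _ _) _; apply: jeq_C; [apply: IHv|apply: IHu].
- case/addM_neq0=> -[H1 H2]; first by apply: jeq_B; [apply: IHu|apply: IHv].
  by apply: jeq_trans (jeq_swapB _ _) _; apply: jeq_B; [apply: IHv|apply: IHu].
Qed.

Lemma J_tp_ren s m t : injective s -> J (tp F (ren s m)) (ren s t) = J (tp F m) t.
Proof.
move=> s_inj; elim: m t => [i|u IHu v IHv|u IHu v IHv] [j|x y|x y];
  rewrite /J /= -?/(J _ _) ?IHu ?IHv //.
by rewrite (inj_eq s_inj).
Qed.

Lemma J_tp_leaves m t : J (tp F m) t != 0 -> perm_eq (leaves m) (leaves t).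
Proof.
elim: m t => [i|u IHu v IHv|u IHu v IHv] [j|x y|x y];
  rewrite /J /= ?addr0 ?eqxx // -/(J _ _).
- by case: (eqVneq i j) => [->|_] //; rewrite eqxx.
- case/addM_neq0=> -[H1 H2]; first by apply: perm_cat; [apply: IHu|apply: IHv].
  by rewrite perm_catC; apply: perm_cat; [apply: IHv|apply: IHu].
- case/addM_neq0=> -[H1 H2]; first by apply: perm_cat; [apply: IHu|apply: IHv].
  by rewrite perm_catC; apply: perm_cat; [apply: IHv|apply: IHu].
Qed.

End Invariants.

(** * Congruence modulo consequences, and symmetrization *)

Section Consequences.
Variables (F : fieldType) (S : Defs.poly F -> Prop).
Hypothesis two_neq0 : 2%:R != 0 :> F.
Notation poly := (Defs.poly F).
Implicit Types (p q : poly) (chi : term -> F).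

Definition sub p q : poly := Add p (Scale (-1) q).

Lemma coef_sub p q t : coef (sub p q) t = coef p t - coef q t.
Proof. by rewrite /= mulN1r. Qed.

Lemma J_sub p q t : J (sub p q) t = J p t - J q t.
Proof. by rewrite /J /= mulN1r. Qed.

Definition cong p q := conseq S (sub p q).

Lemma cong_ext p p' : coef p =1 coef p' -> cong p p'.
Proof.
move=> e; apply: cq_ext (cq_zero S) _ => t.
by rewrite coef_sub e subrr.
Qed.

Lemma cong_trans q p r : cong p q -> cong q r -> cong p r.
Proof.
move=> pq qr; apply: cq_ext (cq_add pq qr) _ => t /=.
by rewrite !mulN1r addrA addrNK.
Qed.

Lemma cong_add p p' q q' : cong p p' -> cong q q' -> cong (Add p q) (Add p' q').
Proof.
move=> pp qq; apply: cq_ext (cq_add pp qq) _ => t /=.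
by rewrite !mulN1r opprD addrACA.
Qed.

Lemma cong_scale k p p' : cong p p' -> cong (Scale k p) (Scale k p').
Proof.
move=> pp; apply: cq_ext (cq_scale k pp) _ => t /=.
by rewrite !mulN1r mulrBr.
Qed.

Lemma cong_mulC p p' q q' : cong p p' -> cong q q' -> cong (MulC p q) (MulC p' q').
Proof.
move=> pp qq; apply: (@cong_trans (MulC p' q)).
  apply: cq_ext (cq_mulCr q pp) _ => -[i|u v|u v] /=; rewrite ?mulr0 ?addr0 //.
  by rewrite !mulN1r mulrBl.
apply: cq_ext (cq_mulCl p' qq) _ => -[i|u v|u v] /=; rewrite ?mulr0 ?addr0 //.
by rewrite !mulN1r mulrBr.
Qed.

Lemma cong_mulB p p' q q' : cong p p' -> cong q q' -> cong (MulB p q) (MulB p' q').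
Proof.
move=> pp qq; apply: (@cong_trans (MulB p' q)).
  apply: cq_ext (cq_mulBr q pp) _ => -[i|u v|u v] /=; rewrite ?mulr0 ?addr0 //.
  by rewrite !mulN1r mulrBl.
apply: cq_ext (cq_mulBl p' qq) _ => -[i|u v|u v] /=; rewrite ?mulr0 ?addr0 //.
by rewrite !mulN1r mulrBr.
Qed.

Lemma conseq_cong p q : cong p q -> conseq S q -> conseq S p.
Proof.
move=> pq Hq; apply: cq_ext (cq_add pq Hq) _ => t /=.
by rewrite mulN1r addrNK.
Qed.

Hypothesis commC_S : conseq S (sub (MulC (Var 0) (Var 1)) (MulC (Var 1) (Var 0))).
Hypothesis commB_S : conseq S (sub (MulB (Var 0) (Var 1)) (MulB (Var 1) (Var 0))).

Lemma cong_commC p q : cong (MulC p q) (MulC q p).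
Proof. exact: (cq_subst (fun i => if i == 0%N then p else q) commC_S). Qed.

Lemma cong_commB p q : cong (MulB p q) (MulB q p).
Proof. exact: (cq_subst (fun i => if i == 0%N then p else q) commB_S). Qed.

(* On each monomial, [avg p] and [jordan p] differ by a power of 2. *)
Fixpoint avg p : poly :=
  match p with
  | Var i => Var i
  | Zero => Zero
  | Add p q => Add (avg p) (avg q)
  | Scale k p => Scale k (avg p)
  | MulC p q => Scale 2^-1 (Add (MulC (avg p) (avg q)) (MulC (avg q) (avg p)))
  | MulB p q => Scale 2^-1 (Add (MulB (avg p) (avg q)) (MulB (avg q) (avg p)))
  end.

(** The difference of the two sides is (p - q) / 2. *)
Lemma cong_half p q : cong p q -> cong p (Scale 2^-1 (Add p q)).
Proof.
by move=> pq; apply: cq_ext (cq_scale 2^-1 pq) _ => t /=; field.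
Qed.

Lemma cong_avg p : cong p (avg p).
Proof.
elim: p => [i||p IHp q IHq|k p IHp|p IHp q IHq|p IHp q IHq] /=.
- exact: cong_ext.
- exact: cong_ext.
- exact: cong_add.
- exact: cong_scale.
- by apply: cong_trans (cong_mulC IHp IHq) _; apply/cong_half/cong_commC.
- by apply: cong_trans (cong_mulB IHp IHq) _; apply/cong_half/cong_commB.
Qed.

Fixpoint halves (t : term) : F :=
  match t with TV _ => 1 | TC u v | TB u v => 2^-1 * halves u * halves v end.

Lemma coef_avg p t : coef (avg p) t = halves t * J p t.
Proof.
rewrite /J.
elim: p t => [i||p IHp q IHq|k p IHp|p IHp q IHq|p IHp q IHq] t /=.
- by case: t => [j|u v|u v] /=; rewrite ?mul1r ?mulr0.
- by rewrite mulr0.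
- by rewrite IHp IHq mulrDr.
- by rewrite IHp mulrCA.
- case: t => [j|u v|u v] /=; rewrite ?addr0 ?mulr0 //.
  by rewrite !IHp !IHq; ring.
- case: t => [j|u v|u v] /=; rewrite ?addr0 ?mulr0 //.
  by rewrite !IHp !IHq; ring.
Qed.

(** [p] is congruent to its symmetrization [avg p], whose coefficients are values of [J p]
    multiplied by powers of 1/2, hence zero. *)
Lemma conseq_J0 p : (forall t, J p t = 0) -> conseq S p.
Proof.
move=> Jp; apply: conseq_cong (cong_avg p) _.
by apply: cq_ext (cq_zero S) _ => t; rewrite coef_avg Jp mulr0.
Qed.

Lemma conseq_J p q : J p =1 J q -> conseq S p -> conseq S q.
Proof.
move=> e; apply: conseq_cong; apply: conseq_J0 => t.
by rewrite J_sub e subrr.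
Qed.

End Consequences.

(** * Executable monomials, vectors and checks *)

Module PM := PositiveMap.

Fixpoint ccan (t : term) : term * nat :=
  match t with
  | TV i => (t, i)
  | TC u v => let: (a, i) := ccan u in let: (b, j) := ccan v in
      if Nat.leb i j then (TC a b, i) else (TC b a, j)
  | TB u v => let: (a, i) := ccan u in let: (b, j) := ccan v in
      if Nat.leb i j then (TB a b, i) else (TB b a, j)
  end.

(* Normal form under commutativity: the subterm with the smaller least variable comes first. *)
Definition ccanon t := (ccan t).1.

(** A prefix-free code written in front of the bits [r]: [xO] opens a variable in unary, [xI]
    followed by [xO] or [xI] opens one of the two products. It turns monomials into keys of
    [PositiveMap]. *)
Fixpoint enc (t : term) (r : positive) : positive :=
  match t with
  | TV i => xO (iter i xI (xO r))
  | TC u v => xI (xO (enc u (enc v r)))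
  | TB u v => xI (xI (enc u (enc v r)))
  end.

Definition code t := enc t xH.

Fixpoint decv (p : positive) (n : nat) : option (nat * positive) :=
  match p with xI q => decv q n.+1 | xO q => Some (n, q) | xH => None end.

Fixpoint dec (fuel : nat) (p : positive) : option (term * positive) :=
  if fuel is f.+1 then
    match p with
    | xO q => if decv q 0 is Some (n, r) then Some (TV n, r) else None
    | xI (xO q) =>
        if dec f q is Some (u, r) then
          if dec f r is Some (v, r') then Some (TC u v, r') else None
        else None
    | xI (xI q) =>
        if dec f q is Some (u, r) then
          if dec f r is Some (v, r') then Some (TB u v, r') else None
        else None
    | _ => None
    end
  else None.

Definition decode p := if dec (Pos.size_nat p) p is Some (t, _) then t else TV 0.

(* Sparse integer vectors, sorted by decreasing index. *)
Definition vec := seq (positive * Z).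

Definition scalev (x : Z) (v : vec) : vec := [seq (e.1, Z.mul x e.2) | e <- v].

Fixpoint lcmb (x y : Z) (v : vec) : vec -> vec :=
  fix aux (w : vec) : vec :=
    match v, w with
    | [::], _ => scalev y w
    | _, [::] => scalev x v
    | (i, c) :: v', (j, d) :: w' =>
        match Pos.compare i j with
        | Gt => (i, Z.mul x c) :: lcmb x y v' w
        | Lt => (j, Z.mul y d) :: aux w'
        | Eq => let e := Z.add (Z.mul x c) (Z.mul y d) in
                if Z.eqb e Z0 then lcmb x y v' w' else (i, e) :: lcmb x y v' w'
        end
    end.

Definition mergev := lcmb (Zpos 1) (Zpos 1).

Fixpoint pairs (ls : seq vec) : seq vec :=
  match ls with a :: b :: r => mergev a b :: pairs r | _ => ls end.

Fixpoint mergeall (n : nat) (ls : seq vec) : vec :=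
  match n, ls with
  | _, [::] => [::]
  | _, [:: v] => v
  | n'.+1, _ => mergeall n' (pairs ls)
  | 0, _ => foldr mergev [::] ls
  end.

(** Bottom-up merge sort that also adds the coefficients of equal indices. Twenty rounds of pairing
    suffice for 2^20 entries; beyond that [mergeall] ends with a fold, so the represented sum is the
    same in any case. *)
Definition sortv (v : vec) : vec := mergeall 20 [seq [:: e] | e <- v].

Definition comb := seq (Z * term).

Definition ren_comb (s : nat -> nat) (l : comb) : comb := [seq (e.1, ren s e.2) | e <- l].

Definition nrm (l : comb) : vec := sortv [seq (code (ccanon e.2), e.1) | e <- l].

Definition denrm (v : vec) : comb := [seq (e.2, decode e.1) | e <- v].

Definition content (v : vec) : Z := foldr (fun e g => Z.gcd e.2 g) Z0 v.

(** Linearizing a monomial with repeated variables produces the same normal form several times;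
    dividing by the content removes the common factor. *)
Definition primitive (v : vec) : vec :=
  let g := content v in
  if Z.eqb g Z0 then [::] else [seq (e.1, Z.div e.2 g) | e <- v].

Fixpoint rlb (t : term) (n : nat) : term * nat :=
  match t with
  | TV _ => (TV n, n.+1)
  | TC u v => let: (a, i) := rlb u n in let: (b, j) := rlb v i in (TC a b, j)
  | TB u v => let: (a, i) := rlb u n in let: (b, j) := rlb v i in (TB a b, j)
  end.

Definition shape t := (rlb t 0).1.

(** All monomials with leaves [base], [base + 1], ... from left to right; every monomial with [n]
    leaves is a relabelling of one of them, provided the fuel is at least [n]. *)
Fixpoint shapes (fuel base n : nat) : seq term :=
  if fuel is f.+1 then
    if n is 1 then [:: TV base] else
    flatten [seq
      [seq TC u v | u <- shapes f base k, v <- shapes f (base + k) (n - k)] ++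
      [seq TB u v | u <- shapes f base k, v <- shapes f (base + k) (n - k)]
      | k <- iota 1 n.-1]
  else [::].

Definition in_range (lo d j : nat) : bool := Nat.leb lo j && Nat.ltb j (lo + d).

(* Variable [i] of an identity of multidegree [(da, db, dc)] becomes one of the new variables [j]. *)
Definition is_copy (da db dc i j : nat) : bool :=
  match i with
  | 0 => in_range 0 da j
  | 1 => in_range da db j
  | 2 => in_range (da + db) dc j
  | _ => Nat.eqb i j
  end.

Fixpoint all2b (r : nat -> nat -> bool) (s w : seq nat) : bool :=
  match s, w with
  | [::], [::] => true
  | i :: s', j :: w' => r i j && all2b r s' w'
  | _, _ => false
  end.

Record ident := Ident { dega : nat; degb : nat; degc : nat; body : comb }.

Definition deg g := (dega g + degb g + degc g)%N.

(** List counterpart of [lin]: the multilinear part of the substituted identity consists of the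
    fillings of the leaves by the new variables in which each leaf receives a copy of its old
    variable. *)
Definition linz (g : ident) : comb :=
  let ws := permutations (iota 0 (deg g)) in
  flatten [seq [seq (e.1, ren (nth 0%N w) (shape e.2))
               | w <- ws & all2b (is_copy (dega g) (degb g) (degc g)) (leaves e.2) w]
          | e <- body g].

Definition template (g : ident) : comb := denrm (primitive (nrm (linz g))).

Fixpoint tsub (i : nat) (u : term) (t : term) : term :=
  match t with
  | TV j => if Nat.eqb i j then u else t
  | TC x y => TC (tsub i u x) (tsub i u y)
  | TB x y => TB (tsub i u x) (tsub i u y)
  end.

(** The standard consequences one degree higher: the new variable [n] multiplies one variable of the
    identity or the identity as a whole. Multiplication from the other side differs only by
    commutativity. *)
Definition lifts1 (op : term -> term -> term) (n : nat) (l : comb) : seq comb :=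
  [seq [seq (e.1, tsub i (op (TV i) (TV n)) e.2) | e <- l] | i <- iota 0 n]
  ++ [:: [seq (e.1, op e.2 (TV n)) | e <- l]].

Definition lifts (n : nat) (l : comb) : seq comb := lifts1 TC n l ++ lifts1 TB n l.

Fixpoint nbrs (t : term) : seq term :=
  match t with
  | TV _ => [::]
  | TC l r =>
      (if l is TC x y then [:: TC x (TC y r)] else [::]) ++
      (if r is TC x y then [:: TC (TC l x) y] else [::]) ++
      (match l, r with TB x y, TB z w => [:: TB (TC x z) (TC y w)] | _, _ => [::] end) ++
      [seq TC x r | x <- nbrs l] ++ [seq TC l x | x <- nbrs r]
  | TB l r =>
      (if l is TB x y then [:: TB x (TB y r)] else [::]) ++
      (if r is TB x y then [:: TB (TB l x) y] else [::]) ++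
      (match l, r with TC x y, TC z w => [:: TC (TB x z) (TB y w)] | _, _ => [::] end) ++
      [seq TB x r | x <- nbrs l] ++ [seq TB l x | x <- nbrs r]
  end.

Definition memt (t : term) (s : seq term) := has (term_eqb t) s.

(** Worklist search with bounded fuel. Only membership of the results in the class of the start is
    proved; completeness is tested by [closedA]. *)
Fixpoint search (fuel : nat) (todo seen : seq term) : seq term :=
  match fuel, todo with
  | f.+1, t :: todo' =>
      let st := foldl (fun st x => if memt x st.2 then st else (x :: st.1, x :: st.2))
                  (todo', seen) (nbrs t) in
      search f st.1 st.2
  | _, _ => seen
  end.

Definition orbitA t := search 100 [:: t] [:: t].

Definition closedA (L : seq term) : bool := all (fun t => all (memt^~ L) (nbrs t)) L.

Definition inv_word (w : seq nat) : nat -> nat := nth 0%N [seq index i w | i <- iota 0 (size w)].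

(** The renaming that straightens the leaves of [e] is applied to [rep] too, so the table sends a
    shape to a representative in the same variables. The test stands in for a proof that [s] inverts
    [leaves e]. *)
Definition add_shape (rep : term) (tab : PM.t term) (e : term) : PM.t term :=
  let s := inv_word (leaves e) in
  if term_eqb (ren s e) (shape e) then PM.add (code (shape e)) (ren s rep) tab else tab.

Definition add_class (st : PM.t term * seq (seq term)) (t : term) :=
  if PM.find (code t) st.1 is Some _ then st else
  let L := orbitA t in (foldl (add_shape t) st.1 L, L :: st.2).

Definition classes (tab : PM.t term) (n : nat) := foldl add_class (tab, [::]) (shapes n 0 n).

(** Soundness only asks that the result equals [t] in the free algebra; two results for one class
    could only make [vanishes] fail. *)
Definition canonA (tab : PM.t term) (t : term) : term :=
  if PM.find (code (shape t)) tab is Some c then ren (nth 0%N (leaves t)) c else t.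

Fixpoint flips (t : term) : seq term :=
  match t with
  | TV _ => [:: t]
  | TC u v => let fu := flips u in let fv := flips v in
      [seq TC a b | a <- fu, b <- fv] ++ [seq TC a b | a <- fv, b <- fu]
  | TB u v => let fu := flips u in let fv := flips v in
      [seq TB a b | a <- fu, b <- fv] ++ [seq TB a b | a <- fv, b <- fu]
  end.

Definition vanishes (tab : PM.t term) (l : comb) : bool :=
  nilp (sortv (flatten [seq [seq (code (canonA tab m), e.1) | m <- flips e.2] | e <- l])).

Definition number (A : Type) (l : seq A) : PM.t A :=
  (foldl (fun st x => (Pos.succ st.1, PM.add st.1 x st.2)) (xH, PM.empty A) l).2.

(** Factorial base: successive digits of [r] choose among the elements that are left. *)
Fixpoint unrank (l : seq nat) (n : nat) (r : N) : seq nat :=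
  if n is n'.+1 then
    let: (q, d) := N.div_eucl r (N.of_nat n) in
    let x := nth 0%N l (N.to_nat d) in x :: unrank (rem x l) n' q
  else [::].

(** The default value [i] extends a permutation of 0 to 5 by the identity, which keeps it
    injective. *)
Definition word_fun (w : seq nat) (i : nat) := nth i w i.

Definition perm6 (w : seq nat) := [&& uniq w, size w == 6%N & all (fun i => Nat.ltb i 6) w].

(* The item [512 r + d + 1] stands for the permutation of rank [r] and the [d + 1]-st template or class. *)
Definition item (it : positive) : seq nat * positive :=
  let: (q, d) := N.div_eucl (Pos.pred_N it) 512 in
  (unrank (iota 0 6) 6 q, N.succ_pos d).

(** A malformed item gives the zero combination, which is a consequence of anything. *)
Definition row_of (tm : PM.t comb) (it : positive) : comb :=
  let: (w, j) := item it in
  if perm6 w then if PM.find j tm is Some l then ren_comb (word_fun w) l else [::] else [::].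

Definition fun_of (cl : PM.t (seq term)) (it : positive) : seq term :=
  let: (w, j) := item it in
  if perm6 w then if PM.find j cl is Some L then map (ren (word_fun w)) L else [::] else [::].

Record numbering := Numbering { ixN : positive; ixT : PM.t term; ixC : PM.t positive }.

Definition numbering0 := Numbering xH (PM.empty _) (PM.empty _).

(* [ixN] is the first unused number. *)
Definition add_index (ix : numbering) (t : term) : numbering :=
  let c := ccanon t in
  if PM.find (code c) (ixC ix) is Some _ then ix else
  Numbering (Pos.succ (ixN ix)) (PM.add (ixN ix) c (ixT ix)) (PM.add (code c) (ixN ix) (ixC ix)).

Definition mono (ix : numbering) (i : positive) : term := odflt (TV 0) (PM.find i (ixT ix)).

(** The stored monomial is compared with the one looked up, so no invariant relating the two maps of
    a numbering has to be maintained. *)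
Definition lookup (ix : numbering) (t : term) : option positive :=
  let c := ccanon t in
  if PM.find (code c) (ixC ix) is Some i then
    if Pos.ltb i (ixN ix) && term_eqb (mono ix i) c then Some i else None
  else None.

Fixpoint entries (ix : numbering) (l : comb) : option vec :=
  if l is (k, m) :: l' then
    match lookup ix m, entries ix l' with
    | Some i, Some v => Some ((i, k) :: v)
    | _, _ => None
    end
  else Some [::].

(** If some monomial has no number the result is the zero vector, valid both as a consequence and as
    an equation. *)
Definition vec_of ix l : vec := if entries ix l is Some v then sortv v else [::].

(** Fraction-free elimination: both vectors are multiplied by the cofactors of the gcd of their
    leading coefficients. *)
Definition cancel_head (v p : vec) : vec :=
  match v, p with
  | (_, a) :: _, (_, b) :: _ =>
      let g := Z.gcd a b in lcmb (Z.div b g) (Z.opp (Z.div a g)) v p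
  | _, _ => v
  end.

(** If the fuel runs out, the vector returned is still a combination of the given ones, and
    soundness rests on that alone. *)
Fixpoint reduce (fuel : nat) (piv : PM.t vec) (v : vec) : vec :=
  match fuel, v with
  | f.+1, (i, _) :: _ => if PM.find i piv is Some p then reduce f piv (cancel_head v p) else v
  | _, _ => v
  end.

Definition add_pivot (piv : PM.t vec) (v : vec) : PM.t vec :=
  let v' := reduce 2000 piv v in if v' is (i, _) :: _ then PM.add i v' piv else piv.

Definition echelon (vs : seq vec) : PM.t vec := foldl add_pivot (PM.empty _) vs.

Fixpoint below (i : positive) (v : vec) : bool :=
  if v is (j, _) :: v' then Pos.ltb j i && below j v' else true.

Definition pivot_ok (piv : PM.t vec) (i : positive) : bool :=
  if PM.find i piv is Some ((j, c) :: v) then [&& Pos.eqb i j, ~~ Z.eqb c Z0 & below j v]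
  else false.

Fixpoint all_from (P : positive -> bool) (i : positive) (n : nat) : bool :=
  if n is n'.+1 then P i && all_from P (Pos.succ i) n' else true.

(* [P i] for [a <= i < b] *)
Definition all_between (P : positive -> bool) (a b : positive) : bool :=
  all_from P a (Pos.to_nat b - Pos.to_nat a).

Definition ones (L : seq term) : comb := [seq (Zpos 1, t) | t <- L].

(* The monomials that are not pivots of the consequences come first, so that both eliminations of
   [solved] meet almost only new leading monomials. *)
Definition arrange (rows : seq comb) (funs : seq (seq term)) : numbering * positive :=
  let ts := flatten [seq [seq e.2 | e <- l] | l <- rows] in
  let ix := foldl add_index numbering0 ts in
  let piv := echelon [seq vec_of ix l | l <- rows] in
  let is_piv t := if lookup ix t is Some i then PM.mem i piv else false in
  let ix1 := foldl (fun ix t => if is_piv t then ix else add_index ix t) numbering0 (flatten funs) in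
  (foldl (fun ix t => if is_piv t then add_index ix t else ix) ix1 ts, ixN ix1).

(** Consequences must have pivots at all numbers from [n] on, functionals at all numbers below [n].
    From the functionals exactly the entries in the first range are dropped, where the cleared
    polynomial is already zero. *)
Definition solved (ix : numbering) (n : positive) (rows : seq comb) (funs : seq (seq term)) : bool :=
  let keep (e : positive * Z) := Pos.ltb e.1 n || Pos.leb (ixN ix) e.1 in
  all_between (pivot_ok (echelon [seq vec_of ix l | l <- rows])) n (ixN ix) &&
  all_between (pivot_ok (echelon [seq filter keep (vec_of ix (ones L)) | L <- funs])) xH n.

Definition solve tm cl (d : seq positive * seq positive) : option numbering :=
  let rows := map (row_of tm) d.1 in
  let funs := map (fun_of cl) d.2 in
  let: (ix, n) := arrange rows funs in
  if solved ix n rows funs then Some ix else None.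

Definition skeleton t := code (ren (fun=> 0%N) t).

(** A normal form of the underlying unlabelled tree under commutativity: factors are ordered by the
    code of their skeletons, and a tie leaves the skeleton unchanged. *)
Fixpoint usort (t : term) : term :=
  match t with
  | TV _ => t
  | TC u v => let a := usort u in let b := usort v in
      if Pos.leb (skeleton a) (skeleton b) then TC a b else TC b a
  | TB u v => let a := usort u in let b := usort v in
      if Pos.leb (skeleton a) (skeleton b) then TB a b else TB b a
  end.

Definition add_cover (st : PM.t (nat * positive) * nat) (ix : numbering) :=
  (PM.fold (fun i m cov => PM.add (skeleton (usort m)) (st.2, i) cov) (ixT ix) st.1, st.2.+1).

(** Sorting aligns the leaves of [t] with those of a stored monomial of the same skeleton. Reading
    them in parallel gives the candidate renaming [q], which is then verified up to
    commutativity. *)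
Definition covered (cov : PM.t (nat * positive)) (ixs : seq numbering) (t : term) : bool :=
  let u := usort t in
  if PM.find (skeleton u) cov is Some (k, i) then
    let ix := nth numbering0 ixs k in
    let m := mono ix i in
    let w := leaves (usort m) in
    let q := [seq nth 0%N (leaves u) (index j w) | j <- iota 0 6] in
    [&& Nat.ltb k (size ixs), Pos.ltb i (ixN ix), perm6 q
      & term_eqb (ccanon (ren (word_fun q) m)) (ccanon t)]
  else false.

(** * The identities with integer coefficients and their multidegrees *)

Section Identities.
Local Notation A := (TV 0).
Local Notation B := (TV 1).
Local Notation C := (TV 2).

Definition z_commC := Ident 1 1 0 [:: (Zpos 1, TC A B); (Zneg 1, TC B A)].
Definition z_commB := Ident 1 1 0 [:: (Zpos 1, TB A B); (Zneg 1, TB B A)].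
Definition z_jordanC := Ident 3 1 0 [::
  (Zpos 1, TC A (TC B (TC A A)));
  (Zneg 1, TC (TC A B) (TC A A))].
Definition z_jordanB := Ident 3 1 0 [::
  (Zpos 1, TB A (TB B (TB A A)));
  (Zneg 1, TB (TB A B) (TB A A))].
Definition z_ii := Ident 4 0 0 [::
  (Zpos 1, TB (TC A A) (TC A A));
  (Zneg 1, TC (TB A A) (TB A A))].
Definition z_iii1 := Ident 4 1 0 [::
  (Zpos 1, TB (TC A B) (TC A (TC A A)));
  (Zneg 1, TC (TB A A) (TB B (TC A A)))].
Definition z_iii2 := Ident 4 1 0 [::
  (Zpos 1, TB (TC A A) (TC B (TB A A)));
  (Zneg 1, TC (TB A B) (TB A (TB A A)))].
Definition z_g3 := Ident 5 1 0 [::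
  (Zpos 1, TB (TC A A) (TB B (TC A (TB A A))));
  (Zneg 1, TB (TB B (TC A A)) (TC A (TB A A)))].
Definition z_g4 := Ident 5 1 0 [::
  (Zpos 1, TC (TB A A) (TC B (TB A (TC A A))));
  (Zneg 1, TC (TB A (TC A A)) (TC B (TB A A)))].
Definition z_g5 := Ident 5 1 0 [::
  (Zpos 1, TB (TC A (TC A A)) (TC B (TB A A)));
  (Zneg 1, TC (TB B (TC A A)) (TB A (TB A A)))].
Definition z_g6 := Ident 5 1 0 [::
  (Zpos 1, TC (TB A A) (TB A (TB B (TC A A))));
  (Zneg 1, TC (TB A A) (TB B (TB A (TC A A))));
  (Zpos 1, TB (TC A (TC A A)) (TC A (TB A B)));
  (Zneg 2, TC (TB A (TC A A)) (TB A (TB A B)));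
  (Zpos 1, TC (TB A (TC A A)) (TB B (TB A A)))].
Definition z_g7 := Ident 5 1 0 [::
  (Zpos 2, TC (TB A A) (TB A (TC B (TB A A))));
  (Zpos 2, TC (TB A A) (TB B (TC A (TB A A))));
  (Zneg 4, TC (TB A B) (TB A (TC A (TB A A))));
  (Zneg 2, TB (TC A (TC A B)) (TC A (TB A A)));
  (Zpos 3, TB (TC B (TC A A)) (TC A (TB A A)));
  (Zneg 2, TC (TB A (TC A A)) (TB B (TB A A)));
  (Zpos 1, TC (TB B (TC A A)) (TB A (TB A A)))].
Definition z_g8 := Ident 4 2 0 [::
  (Zpos 2, TB (TC A A) (TB (TC A B) (TC A B)));
  (Zneg 1, TC (TB A (TB A A)) (TB A (TB B B)));
  (Zneg 2, TC (TB A (TB A B)) (TB B (TB A A)));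
  (Zpos 1, TC (TB B (TB A A)) (TB B (TB A A)))].
Definition z_g9 := Ident 4 2 0 [::
  (Zpos 1, TC (TB B B) (TB (TC A A) (TB A A)));
  (Zpos 2, TB (TC A (TC A B)) (TC B (TB A A)));
  (Zneg 1, TB (TC B (TC A A)) (TC B (TB A A)));
  (Zneg 2, TC (TB B (TC A B)) (TB A (TB A A)))].
Definition z_g10 := Ident 4 2 0 [::
  (Zpos 2, TC (TB A A) (TC (TB A B) (TB A B)));
  (Zneg 1, TB (TC A (TC A A)) (TC A (TC B B)));
  (Zneg 2, TB (TC A (TC A B)) (TC B (TC A A)));
  (Zpos 1, TB (TC B (TC A A)) (TC B (TC A A)))].
Definition z_g11 := Ident 4 2 0 [::
  (Zpos 2, TC (TB A A) (TB A (TB B (TC A B))));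
  (Zneg 2, TC (TB A A) (TB B (TB A (TC A B))));
  (Zpos 2, TC (TB A A) (TB B (TC B (TB A A))));
  (Zneg 2, TC (TB B B) (TB A (TC A (TB A A))));
  (Zneg 2, TC (TB A A) (TB (TC A B) (TB A B)));
  (Zpos 1, TC (TB B B) (TB (TC A A) (TB A A)));
  (Zneg 1, TC (TB A (TC A A)) (TB A (TB B B)));
  (Zpos 2, TC (TB A (TC A A)) (TB B (TB A B)))].
Definition z_E12 (y z : term) : comb := [::
  (Zpos 1, TB (TC A A) (TC y (TC z (TB A A))));
  (Zpos 1, TB (TC A A) (TC y (TC A (TB A z))));
  (Zpos 1, TC (TB A A) (TB y (TB z (TC A A))));
  (Zpos 1, TC (TB A A) (TB y (TB A (TC A z))));
  (Zneg 1, TC (TB A A) (TB A (TB y (TC A z))));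
  (Zneg 1, TC (TB A A) (TB A (TC y (TB A z))));
  (Zneg 2, TB (TC y (TC A z)) (TC A (TB A A)));
  (Zpos 2, TB (TC A (TC A y)) (TC A (TB A z)));
  (Zneg 2, TC (TB A (TC A y)) (TB A (TB A z)));
  (Zneg 2, TC (TB A (TC A A)) (TB y (TB A z)))].
Definition z_g12 := Ident 4 1 1 (z_E12 B C ++ [seq (Z.opp e.1, e.2) | e <- z_E12 C B]).
Definition z_g13 := Ident 3 3 0 [::
  (Zpos 2, TC (TB A B) (TB (TC B B) (TB A A)));
  (Zneg 2, TB (TC A (TC B B)) (TC B (TB A A)));
  (Zneg 1, TB (TC B (TC B B)) (TC A (TB A A)));
  (Zpos 1, TC (TB B (TC B B)) (TB A (TB A A)))].
Definition z_g14 := Ident 3 3 0 [::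
  (Zpos 1, TC (TB B B) (TB A (TB B (TC A A))));
  (Zneg 1, TC (TB B B) (TB B (TB A (TC A A))));
  (Zneg 2, TC (TB A B) (TB B (TC B (TB A A))));
  (Zpos 1, TC (TB B B) (TB A (TC B (TB A A))));
  (Zpos 1, TC (TB B B) (TB B (TC A (TB A A))));
  (Zneg 1, TC (TB A B) (TB (TC B B) (TB A A)));
  (Zneg 1, TC (TB B B) (TB (TC A A) (TB A B)));
  (Zneg 1, TC (TB B B) (TB (TC A B) (TB A A)));
  (Zpos 1, TC (TB A (TC B B)) (TB B (TB A A)));
  (Zpos 2, TC (TB B (TC A B)) (TB B (TB A A)))].

End Identities.

Definition ids4 := [:: z_jordanC; z_jordanB; z_ii].
Definition ids5 := [:: z_iii1; z_iii2].
Definition ids6 :=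
  [:: z_g3; z_g4; z_g5; z_g6; z_g7; z_g8; z_g9; z_g10; z_g11; z_g12; z_g13; z_g14].

Definition raise (n : nat) (ls : seq comb) : seq comb := flatten (map (lifts n) ls).

(** The order of this list fixes the template numbers that the items of [data] refer to. *)
Definition templates (b4 b5 b6 : seq comb) : seq comb := raise 5 (raise 4 b4 ++ b5) ++ b6.


(* For each orbit of blocks of monomials under renaming: independent consequences, then independent
   class functionals, in an order that makes the elimination nearly triangular. Nothing about the
   choice is assumed: [certificate] recomputes it all. *)
Definition data : seq (seq positive * seq positive) := [::
([:: 1; 15361; 18433; 18984; 215042; 218116; 245762; 34308; 76801; 37416; 218118; 215046; 279558; 199684; 282630;
92161; 264198; 36865; 245766; 187394; 222250; 202754; 218666; 61441; 30721; 33793; 199682; 184322; 261122;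
276482; 202756; 34344; 221188; 80437; 98869; 18948; 218114; 215044; 34820; 199686; 248834; 99381; 79873;
95233; 261126; 221190; 221738; 98305; 190466; 37380; 46593; 49192; 123393; 49665; 230913; 233512; 307713;
233985; 108033; 52264; 18950; 15878; 326150; 230916; 298502; 138753; 295430; 52737; 518; 310786; 299050;
233986; 18474; 184833; 200193; 203265; 46082; 122882; 107522; 138242; 49156; 52228; 233988; 202792; 237060;
110645; 113717; 18946; 15876; 200708; 307718; 230918; 3586; 53301; 141825; 111105; 114177; 22018; 516; 201220;
261121; 276481; 221736; 221185; 215041; 218664; 245761; 218113; 141366; 110646; 113718; 325686; 294966;
298038; 53302; 237622; 80897; 96257; 99329; 98856; 153601; 168961; 55297; 55848; 49158; 122886; 46086; 356358;
30724; 64514; 33794; 340998; 301062; 200710; 185350; 262150; 34817; 62465; 31745; 277510; 203782; 222214;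
199722; 49194; 123398; 46598; 49670; 282666; 294954; 324102; 293382; 238086; 49706; 52266; 138758; 108038;
240682; 298026; 323590; 292870; 199734; 203318; 138294; 52278; 110598; 107574; 141318; 123910; 47110; 46122;
111158; 114742; 50182; 202806; 200198; 203270; 202794; 49206; 138246; 52230; 184838; 52790; 114230; 185862;
113670; 184374; 52742; 356406; 240694; 344070; 92164; 219652; 359430; 337921; 353281; 239617; 67586; 36866;
362502; 278534; 264234; 160822; 219137; 215080; 246785; 216065; 354310; 240646; 301098; 282678; 157697;
173057; 117761; 338950; 176182; 294918; 237610; 359478; 325638; 301110; 223238; 278022; 297990; 279606;
237574; 262662; 241206; 263174; 35329; 62977; 32257; 96769; 81409; 99841; 153602; 240132; 322561; 291841;
236545; 92162; 76802; 168962; 36868; 237096; 55300; 160309; 178741; 39938; 76804; 220164; 153606; 70658;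
118325; 175105; 178177; 76806; 36870; 37418; 159745; 129026; 221700; 110632; 139777; 109057; 53761; 49205;
206850; 37889; 77825; 233526; 93185; 3074; 172085; 18434; 172086; 16385; 1025; 79874; 95234; 98308; 19457;
34306; 15364; 65026; 191490; 185348; 222212; 246790; 203780; 216068; 122933; 46133; 156725; 116789; 49717;
56373; 307254; 230454; 156726; 116790; 234038; 56374; 184321; 199681; 202753; 233474; 310274; 154625; 169985;
56321; 25602; 10242; 100353; 81921; 97281; 230404; 215556; 249346; 80385; 95745; 98817; 218626; 234497;
308225; 231425; 156674; 116740; 186372; 172034; 264193; 279553; 282625; 62468; 240644; 62470; 50180; 31748;
18472; 513; 15873; 18945; 79912; 78849; 94209; 38913; 203304; 233476; 307202; 154113; 55809; 169473; 230402;
215553; 246273; 218625; 49666; 126466; 157185; 172545; 117249; 9730; 25090; 61956; 338438; 49668; 61958;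
46596; 34310; 231428; 240134; 201732; 80424; 233478; 138241; 107521; 52225; 21506; 6146; 53288; 4; 141877;
114229; 141313; 230406; 215558; 246278; 218630; 99368; 110593; 113665; 307206; 37377; 184836; 77313; 298550;
326198; 299062; 261633; 221224; 92673; 2; 18436; 203268; 322566; 337974; 353334; 294913; 237608; 325633;
297985; 276993; 221697; 78337; 93697; 302646; 190978; 344630; 359990; 142849; 112129; 56885; 159797; 37430;
76854; 36918; 221750; 261174; 221238; 307201; 30722; 61442; 218628; 221226; 206338; 138293; 52277; 175157;
37941; 114216; 142337; 322614; 236598; 160310; 175670; 118326; 38401; 114689; 156673; 172033; 116737; 125954;
234500; 204804; 337922; 353282; 55812; 15413; 18997; 15414; 18998; 233473; 79926; 49154; 98358; 37942; 115201;
56886; 24578; 261162; 247814; 178182; 220166; 222248; 159798; 175158; 359425; 1537; 16897; 19969; 175617;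
37378; 95236; 7170; 22530; 92676; 1028; 344065; 185857; 201217; 204289; 160257; 144386; 124417; 47617; 50689;
129538; 52738; 110596; 108036; 172038; 156678; 116742; 169478; 154118; 237057; 55814; 323073; 308230; 53249;
231430; 203777; 200705; 234502; 139265; 201734; 35841; 32769; 362497; 86018; 63489; 292353; 178689; 185345;
108545; 111617; 291842; 236548; 52740; 216580; 204292; 15366; 18438; 236550; 247302; 222724; 110594; 113668;
237572; 185860; 79878; 175110; 19462; 122881; 95285; 178229; 340993; 53; 107573; 356353; 98310; 238084; 1542;
231940; 37382; 308742; 16900; 221702; 61953; 31233; 34305; 15362; 261638; 33796; 187906; 203266; 46084;
200196; 16388; 61446; 239620; 71170; 40450; 61444; 77316; 217092; 77318; 240129; 338433; 353793; 322562;
16390; 50177; 123905; 47105; 141314; 217094; 20481; 2049; 17409; 101378; 230401; 98306; 113666; 9218; 68098;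
30726; 337926; 31238; 353798; 31750; 216070; 34822; 219142; 16902; 216582; 19974; 265734; 235014; 234026;
283178; 54; 30774; 33846; 239670; 34358]%positive,
[:: 61441; 245761; 162817; 114689; 212993; 105473; 65537; 90113; 1537; 28673; 322561; 6145; 291841; 40961; 71681;
37889; 101377; 86017; 24577; 38401; 93697; 98305; 19457; 353281; 1; 239617; 338433; 23041; 59393; 252417;
154113; 276993; 313345; 117761; 154625; 230401; 344065; 116737; 347137; 362497; 66049; 215553; 270337; 92673;
77313; 323073; 111617; 111105; 255489; 359425; 175105; 166401; 340993; 246273; 65025; 41473; 29185; 90625;
10753; 181761; 243201; 82945; 41985; 192001; 3585; 19969; 8193; 191489; 72705; 32769; 2049; 212481; 112129;
89601; 71169; 68609; 316417; 120833; 297985; 25601; 62977; 209921; 78337; 246785; 178689; 139265; 194049;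
28161; 172033; 356353; 261121; 37377; 40449; 77825; 95233; 79873; 165889; 95745; 292353; 99329; 353793;
316929; 53249; 104449; 80385; 163329; 147969; 98817; 126977; 102913; 234497; 157185; 233985; 49665; 127489;
102401; 160257; 181249; 142337; 4097; 115201; 159745; 208897; 178177; 10241; 194561; 261633; 221697; 175617;
308225; 76801; 279553; 236545; 350209; 240129; 22529; 72193; 337921; 168961; 156673; 31233; 18945; 172545;
68097; 224769; 249857; 34817; 50177; 69633; 264193; 61953; 313857; 227841; 58881; 200705; 93185; 96257;
173057; 44033; 124417; 32257; 105985; 38913; 103425; 15361; 267265; 39937; 224257; 365569; 249345; 141825;
25089; 86529; 258561; 320001; 1025; 80897; 130049; 11265; 138241; 215041; 276481; 3073; 125953; 310273;
218113; 282625; 147457; 285697; 301057; 12289; 15873; 34305; 83457; 104961; 62465; 123905; 145409; 148481;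
197633; 151553; 4609; 99841; 307201; 107521; 64513; 248833; 141313; 129025; 331777; 196609; 319489; 43009;
119809; 310785; 22017; 237057; 132609; 209409; 43521; 120321; 216065; 169985; 311297; 219137; 7169; 206849;
13313; 81409; 207361; 63489; 78849; 94209; 202753; 33793; 21505; 52225; 334849; 169473; 126465; 203265;
144897; 114177; 101889; 117249; 151041; 47105; 157697; 133121; 56321; 16897; 139777; 188929; 35329; 50689;
7681; 53761; 26113; 13825; 66561; 187393; 294913; 328705; 258049; 150529; 304129; 218625; 6657; 129537;
135681; 231425; 188417; 136193; 201217; 96769; 69121; 130561; 44545; 20481; 35841; 23553; 84993; 30721;
153601; 325633; 110593; 67585; 251905; 144385; 221185; 193537; 55297; 73729; 307713; 138753; 52737; 9729;
55809; 185345; 16385; 47617; 145921; 17409; 5121; 81921; 233473; 190465; 36865; 113665; 9217; 254977; 132097;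
230913; 187905; 74241; 108545; 203777; 87041; 185857; 100353; 46081; 204289; 87553; 26625; 88065; 184321;
135169; 288769; 49153; 89089]%positive);
([:: 2055; 17415; 20487; 61486; 39944; 35883; 70664; 76810; 78855; 79918; 35895; 32823; 97335; 61962; 100407;
94215; 81975; 38919; 63543; 9736; 80442; 25096; 76858; 63495; 32775; 35847; 24584; 9224; 86024; 101384; 61450;
79882; 77322; 71176; 81927; 97287; 100359; 10248; 62474; 40456; 25608; 2091; 38955; 76846; 20523; 32811;
80430; 17463; 61498; 79930]%positive,
[:: 18946; 249861; 157197; 23042; 265733; 253445; 262661; 252933; 7682; 154125; 267781; 268805; 338445; 249349;
245765; 265221; 268293; 246789; 154637; 22018; 250373; 22530; 19458; 252421; 157709; 153613; 19970; 160269;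
246277; 247301; 344077; 1538; 16898; 248837; 267269; 264709; 156685; 159757; 6146; 21506; 15874; 3586; 4098;
7170; 4610; 262149; 337933; 6658; 261125; 261637; 15362; 18434; 514; 1026; 341005]%positive);
([:: 2109; 17469; 20541; 61540]%positive,
[:: 4099; 265232; 1027; 261136; 261648; 262160; 3587; 264720; 3; 3075; 515]%positive);
([:: 1603; 16963; 20035; 106; 185923; 201283; 204355; 184426; 2115; 17475; 20547; 61546]%positive,
[:: 4100; 188420; 265233; 326673; 1028; 185348; 261137; 322577; 261649; 323089; 262161; 323601; 65540; 280593;
62468; 276497; 277009; 277521; 3588; 187908; 65028; 264721; 326161; 280081; 4; 184324; 61444; 3076; 187396;
64516; 516; 184836; 61956]%positive);
([::]%positive,
[:: 7; 184327; 519; 184839; 61447; 61959; 264251; 325691; 279611]%positive);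
([::]%positive,
[:: 8; 520; 264252]%positive);
([::]%positive,
[:: 9; 15369; 521; 15881; 245772; 246284; 264253; 267325; 341056]%positive);
([:: 160941; 176301; 179373; 179885; 160942; 176302; 179374; 179886; 345262; 360622; 363694; 364206]%positive,
[:: 307210; 307722; 199690; 200202; 122890; 123402; 138250; 138762; 76810; 92170; 77322; 92682; 356414; 328766;
294974; 282686; 298046; 285758; 245770; 15370; 246282; 15882; 341054; 267326; 10; 184330; 61450; 522; 184842;
61962; 264254; 325694; 279614]%positive);
([:: 7236; 22596; 1094; 185926; 161061; 191556; 206916; 185414; 1606; 161062; 25668; 10308; 62534; 186438; 345382]%positive,
[:: 18988; 34348; 49708; 55852; 282671; 298031; 123406; 77326; 55340; 37420; 294959; 279599; 52780; 22686; 61966;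
138766; 307726; 344111; 359471; 246286; 154126; 301103; 36908; 52268; 25758; 28830; 122894; 76814; 18476;
33836; 49196; 7326; 10398; 61454; 307214; 526; 264239; 14; 184334]%positive);
([:: 345202; 360562; 363634; 364146]%positive,
[:: 307222; 199702; 122902; 138262; 76822; 92182; 245782; 15382; 22; 184342; 61462]%positive);
([::]%positive,
[:: 23; 15383; 245786]%positive);
([::]%positive,
[:: 24]%positive);
([::]%positive,
[:: 25; 184345; 61465]%positive);
([::]%positive,
[:: 28; 184348; 3100; 187420; 61468; 64540; 261160; 322600; 276520]%positive);
([::]%positive,
[:: 29; 3101; 261161]%positive);
([:: 266366; 281726; 284798; 264866]%positive,
[:: 21534; 267297; 6174; 245793; 248865; 251937; 18462; 264225; 30; 15390; 3102]%positive);
([:: 80559; 95919; 98991; 99506; 111791; 114354; 142511; 114863; 157359; 117938; 298730; 295658; 360170; 100015;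
363242; 172719; 344810; 117423; 326378; 81583; 302826; 96943; 299242; 141999; 111279; 114351; 96431; 81071;
157871; 173231; 99503; 117935; 115375; 143023; 160431; 175791; 178863; 82095; 100527; 112303; 97455; 80562;
117426; 114866; 98994; 111282; 118450; 280298; 283882; 302314]%positive,
[:: 307231; 113695; 153631; 248863; 337951; 310303; 233503; 36895; 92191; 79903; 110623; 172063; 322591; 33823;
76831; 245791; 168991; 156703; 49183; 144415; 21535; 18463; 202783; 205855; 261151; 353311; 141343; 218143;
31; 122911; 138271; 276511; 95263; 6175; 39967; 3103; 64543; 190495; 98335; 9247; 24607; 30751; 215071; 46111;
187423; 129055; 82975; 101407; 184351; 61471; 199711; 107551; 291871; 67615; 70687]%positive);
([:: 345442]%positive,
[:: 122915; 276515; 61475; 307235; 261155; 35; 49201; 184355; 18481; 33841; 15395]%positive);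
([:: 264950; 326390; 341750; 344822; 265462; 326902; 341870; 266486; 342262; 265070; 327414; 326510; 344942;
265974; 265090]%positive,
[:: 126623; 3743; 65183; 6815; 68255; 129695; 9887; 71327; 132767; 12959; 74399; 135839; 7327; 68767; 130207;
10399; 71839; 133279; 13471; 74911; 136351; 10911; 72351; 133791; 13983; 75423; 136863; 14495; 75935; 137375;
215085; 46125; 199725; 30765; 264237; 267309; 325677; 328749; 341037; 147501; 132141; 316461; 356397; 331821;
162861; 344109; 144429; 129069; 313389; 294957; 82989; 67629; 251949; 279597; 79917; 304173; 288813; 3117;
187437; 64557; 261165; 353325; 61485; 245805; 276525; 291885; 45; 227373; 242733; 230445; 18477; 202797;
33837; 9261; 193581; 255021; 270381; 12333; 196653; 258093; 135213; 319533; 273453; 334893; 165933; 248877;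
125997; 310317; 218157; 49197; 6189; 190509; 282669; 298029; 285741; 178221; 122925; 307245; 76845; 138285;
92205; 141357; 95277; 36909; 221229]%positive);
([:: 80679; 142119; 157479; 160551; 81191; 142631; 341882; 82215; 157991; 265082; 143143; 326522; 344954; 81703]%positive,
[:: 245806; 184366; 122926; 61486; 267315; 328755; 279598; 337971; 10400; 341038; 95278; 33838; 218158; 282670;
221230; 138291; 10912; 36910; 159790; 55342; 239662; 116782; 301102; 178222; 30771; 92211; 356398; 49198;
291891; 197792; 294958; 233518; 298030; 236590; 76851; 13984; 52270; 264238; 202798; 191648; 7328; 18478;
6816; 191136; 261166; 322606; 15406; 199726; 9888; 194208; 276526; 337966; 30766; 12960; 197280; 46126;
230446; 307246; 276531; 353331; 33843; 270387; 3744; 188064; 65184; 68256; 71328; 74400; 68768; 194720; 71840;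
13472; 74912; 195232; 72352; 198304; 75424; 14496; 198816; 75936; 325678; 98350; 113710; 245811; 307251;
15411; 199731; 18483; 202803; 264243; 325683; 279603; 341043; 76846; 92206; 107566; 79918; 110638; 3123;
64563; 6195; 190515; 21555; 205875; 193587; 208947]%positive);
([:: 264716; 280076; 283148; 283696; 295948; 298544; 326668; 299020; 341516; 302128; 298556; 295484; 359996;
284172; 363068; 356876; 344636; 301580; 326204; 265740; 302652; 281100; 299068; 326156; 295436; 298508;
280588; 265228; 342028; 357388; 283660; 302092; 299532; 327180; 344588; 359948; 363020; 266252; 284684;
296460; 281612; 264752; 301616; 299056; 283184; 295472; 302640; 280124; 283708; 302140]%positive,
[:: 307279; 113743; 153679; 248911; 337999; 310351; 233551; 36943; 92239; 79951; 110671; 172111; 322639; 33871;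
76879; 245839; 169039; 156751; 49231; 144463; 21583; 18511; 202831; 205903; 261199; 353359; 141391; 218191;
79; 122959; 138319; 276559; 95311; 6223; 40015; 3151; 64591; 190543; 98383; 9295; 24655; 30799; 215119; 46159;
187471; 129103; 83023; 101455; 184399; 61519; 199759; 107599; 291919; 67663; 70735]%positive);
([:: 266312; 281672; 284744; 264812]%positive,
[:: 21584; 267347; 6224; 245843; 248915; 251987; 18512; 264275; 80; 15440; 3152]%positive);
([::]%positive,
[:: 81; 3153; 261214]%positive);
([::]%positive,
[:: 82; 184402; 3154; 187474; 61522; 64594; 261215; 322655; 276575]%positive);
([::]%positive,
[:: 85; 184405; 61525]%positive);
([::]%positive,
[:: 86]%positive);
([::]%positive,
[:: 87; 15447; 245850]%positive);
([:: 345268; 360628; 363700; 364212]%positive,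
[:: 307288; 199768; 122968; 138328; 76888; 92248; 245848; 15448; 88; 184408; 61528]%positive);
([:: 345388]%positive,
[:: 122972; 307292; 76892; 18554; 92; 184412; 33914; 61532; 49274; 138332; 153692]%positive);
([:: 160887; 176247; 179319; 179831; 160888; 176248; 179320; 179832; 345208; 360568; 363640; 364152]%positive,
[:: 307300; 307812; 199780; 200292; 122980; 123492; 138340; 138852; 76900; 92260; 77412; 92772; 356499; 328851;
295059; 282771; 298131; 285843; 245860; 15460; 246372; 15972; 341139; 267411; 100; 184420; 61540; 612; 184932;
62052; 264339; 325779; 279699]%positive);
([::]%positive,
[:: 101; 15461; 613; 15973; 245864; 246376; 264340; 267412; 341143]%positive);
([::]%positive,
[:: 102; 614; 264341]%positive);
([::]%positive,
[:: 103; 184423; 615; 184935; 61543; 62055; 264342; 325782; 279702]%positive);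
([:: 1657; 17017; 20089; 160; 185977; 201337; 204409; 184480; 2169; 17529; 20601; 61600]%positive,
[:: 4202; 188522; 265334; 326774; 1130; 185450; 261238; 322678; 261750; 323190; 262262; 323702; 65642; 280694;
62570; 276598; 277110; 277622; 3690; 188010; 65130; 264822; 326262; 280182; 106; 184426; 61546; 3178; 187498;
64618; 618; 184938; 62058]%positive);
([:: 2175; 17535; 20607; 61606]%positive,
[:: 4203; 265335; 1131; 261239; 261751; 262263; 3691; 264823; 107; 3179; 619]%positive);
([:: 186496; 201856; 204930; 245923; 217218; 261795; 251008; 220288; 217220; 261288; 247940; 220292; 20661; 61660;
278660; 264360; 17589; 82101; 100533; 263300; 97461; 223364; 2229; 247936; 217216; 220290; 261283; 201858;
246435; 189568; 204928; 201860; 245928; 36021; 186500; 204932; 32949; 266372; 281732; 264872; 79029; 39093;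
192640; 208000; 186498; 233; 15593; 263296; 246947; 284804]%positive,
[:: 153714; 157810; 249455; 7276; 247407; 15468; 157298; 253039; 253551; 154226; 6764; 7788; 246383; 249967; 4204;
23148; 268911; 267887; 252527; 245871; 341106; 248943; 268399; 246895; 4716; 250479; 156786; 154738; 18540;
22636; 338034; 338546; 21612; 620; 20076; 264303; 252015; 267375; 265839; 160370; 108; 19052; 22124; 19564;
1644; 17004; 261231; 264815; 265327; 262767; 159858; 3180; 261743; 344178; 6252]%positive);
([:: 187; 15547; 18619; 19170; 215228; 218302; 245948; 34494; 76987; 37602; 218304; 215232; 279744; 199870; 282816;
92347; 264384; 37051; 245952; 187580; 222436; 202940; 218852; 61627; 30907; 33979; 199868; 184508; 261308;
276668; 202942; 34530; 221374; 80623; 99055; 19134; 218300; 215230; 35006; 199872; 249020; 99567; 80059;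
95419; 261312; 221376; 221924; 98491; 190652; 37566; 46779; 49378; 123579; 49851; 231099; 233698; 307899;
234171; 108219; 52450; 19136; 16064; 326336; 231102; 298688; 138939; 295616; 52923; 704; 310972; 299236;
234172; 18660; 185019; 200379; 203451; 46268; 123068; 107708; 138428; 49342; 52414; 234174; 202978; 237246;
110831; 113903; 19132; 16062; 200894; 307904; 231104; 3772; 53487; 142011; 111291; 114363; 22204; 702; 201406;
261307; 276667; 221922; 221371; 215227; 218850; 245947; 218299; 141552; 110832; 113904; 325872; 295152;
298224; 53488; 237808; 81083; 96443; 99515; 99042; 153787; 169147; 55483; 56034; 49344; 123072; 46272; 356544;
30910; 64700; 33980; 341184; 301248; 200896; 185536; 262336; 35003; 62651; 31931; 277696; 203968; 222400;
199908; 49380; 123584; 46784; 49856; 282852; 295140; 324288; 293568; 238272; 49892; 52452; 138944; 108224;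
240868; 298212; 323776; 293056; 199920; 203504; 138480; 52464; 110784; 107760; 141504; 124096; 47296; 46308;
111344; 114928; 50368; 202992; 200384; 203456; 202980; 49392; 138432; 52416; 185024; 52976; 114416; 186048;
113856; 184560; 52928; 356592; 240880; 344256; 92350; 219838; 359616; 338107; 353467; 239803; 67772; 37052;
362688; 278720; 264420; 161008; 219323; 215266; 246971; 216251; 354496; 240832; 301284; 282864; 157883;
173243; 117947; 339136; 176368; 295104; 237796; 359664; 325824; 301296; 223424; 278208; 298176; 279792;
237760; 262848; 241392; 263360; 35515; 63163; 32443; 96955; 81595; 100027; 153788; 240318; 322747; 292027;
236731; 92348; 76988; 169148; 37054; 237282; 55486; 160495; 178927; 40124; 76990; 220350; 153792; 70844;
118511; 175291; 178363; 76992; 37056; 37604; 159931; 129212; 221886; 110818; 139963; 109243; 53947; 49391;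
207036; 38075; 78011; 233712; 93371; 3260; 172271; 18620; 172272; 16571; 1211; 80060; 95420; 98494; 19643;
34492; 15550; 65212; 191676; 185534; 222398; 246976; 203966; 216254; 123119; 46319; 156911; 116975; 49903;
56559; 307440; 230640; 156912; 116976; 234224; 56560; 184507; 199867; 202939; 233660; 310460; 154811; 170171;
56507; 25788; 10428; 100539; 82107; 97467; 230590; 215742; 249532; 80571; 95931; 99003; 218812; 234683;
308411; 231611; 156860; 116926; 186558; 172220; 264379; 279739; 282811; 62654; 240830; 62656; 50366; 31934;
18658; 699; 16059; 19131; 80098; 79035; 94395; 39099; 203490; 233662; 307388; 154299; 55995; 169659; 230588;
215739; 246459; 218811; 49852; 126652; 157371; 172731; 117435; 9916; 25276; 62142; 338624; 49854; 62144;
46782; 34496; 231614; 240320; 201918; 80610; 233664; 138427; 107707; 52411; 21692; 6332; 53474; 190; 142063;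
114415; 141499; 230592; 215744; 246464; 218816; 99554; 110779; 113851; 307392; 37563; 185022; 77499; 298736;
326384; 299248; 261819; 221410; 92859; 188; 18622; 203454; 322752; 338160; 353520; 295099; 237794; 325819;
298171; 277179; 221883; 78523; 93883; 302832; 191164; 344816; 360176; 143035; 112315; 57071; 159983; 37616;
77040; 37104; 221936; 261360; 221424; 307387; 30908; 61628; 218814; 221412; 206524; 138479; 52463; 175343;
38127; 114402; 142523; 322800; 236784; 160496; 175856; 118512; 38587; 114875; 156859; 172219; 116923; 126140;
234686; 204990; 338108; 353468; 55998; 15599; 19183; 15600; 19184; 233659; 80112; 49340; 98544; 38128; 115387;
57072; 24764; 261348; 248000; 178368; 220352; 222434; 159984; 175344; 359611; 1723; 17083; 20155; 175803;
37564; 95422; 7356; 22716; 92862; 1214; 344251; 186043; 201403; 204475; 160443; 144572; 124603; 47803; 50875;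
129724; 52924; 110782; 108222; 172224; 156864; 116928; 169664; 154304; 237243; 56000; 323259; 308416; 53435;
231616; 203963; 200891; 234688; 139451; 201920; 36027; 32955; 362683; 86204; 63675; 292539; 178875; 185531;
108731; 111803; 292028; 236734; 52926; 216766; 204478; 15552; 18624; 236736; 247488; 222910; 110780; 113854;
237758; 186046; 80064; 175296; 19648; 123067; 95471; 178415; 341179; 239; 107759; 356539; 98496; 238270; 1728;
232126; 37568; 308928; 17086; 221888; 62139; 31419; 34491; 15548; 261824; 33982; 188092; 203452; 46270;
200382; 16574; 61632; 239806; 71356; 40636; 61630; 77502; 217278; 77504; 240315; 338619; 353979; 322748;
16576; 50363; 124091; 47291; 141500; 217280; 20667; 2235; 17595; 101564; 230587; 98492; 113852; 9404; 68284;
30912; 338112; 31424; 353984; 31936; 216256; 35008; 219328; 17088; 216768; 20160; 265920; 235200; 234212;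
283364; 240; 30960; 34032; 239856; 34544]%positive,
[:: 61549; 245869; 162925; 114797; 213101; 105581; 65645; 90221; 1645; 28781; 322669; 6253; 291949; 41069; 71789;
37997; 101485; 86125; 24685; 38509; 93805; 98413; 19565; 353389; 109; 239725; 338541; 23149; 59501; 252525;
154221; 277101; 313453; 117869; 154733; 230509; 344173; 116845; 347245; 362605; 66157; 215661; 270445; 92781;
77421; 323181; 111725; 111213; 255597; 359533; 175213; 166509; 341101; 246381; 65133; 41581; 29293; 90733;
10861; 181869; 243309; 83053; 42093; 192109; 3693; 20077; 8301; 191597; 72813; 32877; 2157; 212589; 112237;
89709; 71277; 68717; 316525; 120941; 298093; 25709; 63085; 210029; 78445; 246893; 178797; 139373; 194157;
28269; 172141; 356461; 261229; 37485; 40557; 77933; 95341; 79981; 165997; 95853; 292461; 99437; 353901;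
317037; 53357; 104557; 80493; 163437; 148077; 98925; 127085; 103021; 234605; 157293; 234093; 49773; 127597;
102509; 160365; 181357; 142445; 4205; 115309; 159853; 209005; 178285; 10349; 194669; 261741; 221805; 175725;
308333; 76909; 279661; 236653; 350317; 240237; 22637; 72301; 338029; 169069; 156781; 31341; 19053; 172653;
68205; 224877; 249965; 34925; 50285; 69741; 264301; 62061; 313965; 227949; 58989; 200813; 93293; 96365;
173165; 44141; 124525; 32365; 106093; 39021; 103533; 15469; 267373; 40045; 224365; 365677; 249453; 141933;
25197; 86637; 258669; 320109; 1133; 81005; 130157; 11373; 138349; 215149; 276589; 3181; 126061; 310381;
218221; 282733; 147565; 285805; 301165; 12397; 15981; 34413; 83565; 105069; 62573; 124013; 145517; 148589;
197741; 151661; 4717; 99949; 307309; 107629; 64621; 248941; 141421; 129133; 331885; 196717; 319597; 43117;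
119917; 310893; 22125; 237165; 132717; 209517; 43629; 120429; 216173; 170093; 311405; 219245; 7277; 206957;
13421; 81517; 207469; 63597; 78957; 94317; 202861; 33901; 21613; 52333; 334957; 169581; 126573; 203373;
145005; 114285; 101997; 117357; 151149; 47213; 157805; 133229; 56429; 17005; 139885; 189037; 35437; 50797;
7789; 53869; 26221; 13933; 66669; 187501; 295021; 328813; 258157; 150637; 304237; 218733; 6765; 129645;
135789; 231533; 188525; 136301; 201325; 96877; 69229; 130669; 44653; 20589; 35949; 23661; 85101; 30829;
153709; 325741; 110701; 67693; 252013; 144493; 221293; 193645; 55405; 73837; 307821; 138861; 52845; 9837;
55917; 185453; 16493; 47725; 146029; 17517; 5229; 82029; 233581; 190573; 36973; 113773; 9325; 255085; 132205;
231021; 188013; 74349; 108653; 203885; 87149; 185965; 100461; 46189; 204397; 87661; 26733; 88173; 184429;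
135277; 288877; 49261; 89197]%positive);
([:: 7290; 22650; 1148; 185980; 161127; 191610; 206970; 185468; 1660; 161128; 25722; 10362; 62588; 186492; 345448]%positive,
[:: 19071; 34431; 49791; 55935; 359554; 307825; 261745; 55423; 52863; 341122; 362626; 277105; 22706; 298114; 625;
282754; 344194; 215665; 184945; 28850; 37503; 36991; 123505; 52351; 325762; 25778; 122993; 307313; 261233;
276593; 15985; 18559; 33919; 49279; 295042; 13490; 113; 184433; 61553]%positive);
([:: 264956; 326396; 341756; 344828; 265468; 326908; 341876; 266492; 342268; 265076; 327420; 326516; 344948; 265980]%positive,
[:: 215163; 199803; 46203; 30843; 267390; 328830; 264315; 338046; 10416; 356475; 79995; 64635; 248955; 267387;
252027; 138366; 10928; 67707; 175227; 132219; 316539; 147579; 331899; 162939; 30846; 92286; 341115; 126075;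
291966; 197808; 325755; 310395; 328827; 313467; 76926; 14000; 129147; 279675; 187515; 191664; 7344; 3195;
6832; 191152; 276603; 291963; 123; 184443; 9904; 194224; 261243; 353403; 61563; 12976; 197296; 123003; 307323;
230523; 276606; 353406; 33918; 270462; 3760; 188080; 65200; 68272; 71344; 74416; 68784; 194736; 71856; 13488;
74928; 195248; 72368; 198320; 75440; 14512; 198832; 75952; 295035; 83067; 144507; 245886; 307326; 15486;
199806; 18558; 202878; 264318; 325758; 279678; 341118; 76923; 138363; 92283; 141435; 95355; 3198; 64638; 6270;
190590; 21630; 205950; 193662; 209022]%positive);
([:: 265016; 326456; 341816; 344888; 265528; 326968; 341888; 266552; 342328; 265088; 327480; 326528; 344960;
266040; 265089]%positive,
[:: 133809; 3761; 65201; 126641; 6833; 68273; 129713; 9905; 71345; 132785; 12977; 74417; 135857; 7345; 68785;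
130225; 10417; 71857; 133297; 13489; 74929; 136369; 10929; 72369; 14001; 75441; 136881; 14513; 75953; 137393;
58492; 119932; 341116; 239740; 55420; 116860; 356476; 245884; 123004; 184444; 61564; 279676; 282748; 344188;
98428; 36988; 221308; 264316; 95356; 33916; 218236; 202876; 49276; 295036; 298108; 43132; 104572; 236668;
325756; 18556; 261244; 322684; 15484; 199804; 276604; 338044; 30844; 46204; 230524; 307324; 3196; 187516;
64636; 24700; 209020; 224380; 285820; 301180; 178300; 27772; 212092; 227452; 288892; 304252; 181372; 248956;
126076; 233596; 21628; 205948; 267388; 328828; 270460; 331900; 162940; 273532; 76924; 92284; 107644; 79996;
110716; 67708; 252028; 129148; 132220]%positive);
([:: 113; 15473; 18545; 19057; 153841; 98417; 79985; 95345; 38001; 338161; 157937; 110705; 113777; 53361; 141425;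
61681; 107633; 138353; 52337; 52849; 246001; 156913; 341233; 157425; 81649; 92273; 36977; 37489; 76913;
123121; 178289; 159857; 56945; 175217; 307441; 143089; 241; 169073; 153713; 55409; 55921; 184561; 80113;
264433; 141553; 325873; 80625; 142065; 82161; 61553; 33905; 34417; 30833; 138481; 322801; 172145; 156785;
116849; 56433; 142577; 77041; 261361; 122993; 46193; 49265; 49777; 159985; 344305; 160497; 81137; 753; 172657;
157297; 117361; 117873; 185073; 77553; 261873; 138993; 323313; 1265; 185585; 78065; 139505; 63729; 79089;
80497; 98929; 99441; 95857; 123633; 307953; 175729; 160369; 178801; 118385; 140017; 62193; 246513; 141937;
111217; 114289; 114801; 154353; 338673; 154865; 78577; 62705; 247025; 160881; 176241; 179313; 179825; 124145;
308465; 1777; 186097; 63217; 124657; 2289; 242; 123241; 322802; 3314; 184681; 307442; 138601; 310514; 141673;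
6386; 62313; 77042; 188146; 322921; 246633; 142697; 153842; 67826; 126706; 7410; 261481; 138482; 338281;
129266; 160105; 70898; 61739; 141554; 185705; 124265; 187634; 139625; 126194; 80171; 156971; 61801; 184562;
123753; 261362; 338793; 3826; 62825; 80114; 341353; 86258; 2409; 71410; 123179; 153899; 157483; 361; 154473;
154985; 246002; 77161; 308073; 81257; 249074; 80233; 190706; 65266; 157545; 9970; 1385; 157033; 64754; 78185;
191730; 9458; 79209; 10482; 141611; 160043; 161067; 246121; 139113; 323433; 123122; 153961; 873; 185193;
61682; 307561; 338162; 77673; 261993; 249586; 80745; 191218; 308585; 264553; 156914; 325993; 247145; 311026;
142185; 6898; 392; 160555; 160648; 299; 83186; 344425; 144626; 1897; 68338; 160617; 129778; 77192; 142123;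
61832; 138539; 138632; 80683; 123272; 77099; 158057; 186217; 63337; 124777; 78697; 140137; 81769; 143209;
63849; 82281; 153992; 80264; 141704]%positive,
[:: 18601; 70825; 150697; 335017; 181417; 365737; 317097; 86185; 147625; 331945; 258217; 73897; 135337; 89257;
129193; 67753; 132265; 71337; 132777; 83113; 27817; 43177; 350377; 237225; 138409; 221865; 76969; 40105;
234153; 123049; 227497; 288937; 322729; 252585; 252073; 270499; 255145; 255657; 172201; 116905; 191145; 3241;
3753; 188073; 187561; 190633; 175273; 310953; 159913; 313513; 196777; 119977; 341161; 314025; 310441; 98473;
95401; 264361; 202921; 285865; 224425; 126633; 261289; 80041; 101545; 316585; 166057; 104617; 331939; 356521;
359593; 255139; 52393; 107689; 236713; 258211; 205993; 267433; 270505; 243369; 59049; 221353; 92329; 276649;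
282793; 279721; 298153; 292009; 40617; 28841; 233641; 49321; 239785; 24745; 209065; 55465; 362665; 249513;
61609; 65193; 319657; 19113; 25769; 210089; 304297; 242857; 55977; 273577; 203433; 58537; 37033; 212137;
21673; 123043; 184483; 267427; 27811; 86179; 15529; 338089; 141481; 218281; 144547; 89251; 24739; 353443;
209059; 147619; 316579; 319651; 73891; 187555; 70819; 9379; 64675; 126115; 67747; 252067; 295075; 196771;
135331; 286371; 244387; 305827; 284323; 182947; 161443; 345763; 347811; 281251; 342691; 60067; 121507; 350883;
43683; 289443; 105123; 278179; 155299; 96931; 35491; 138915; 200355; 40611; 102051; 243875; 182435; 160931;
222371; 283811; 366755; 280739; 342179; 277667; 339107; 59555; 157859; 218787; 157347; 341667; 215715; 280227;
154275; 304803; 366243; 243363; 181923; 96419; 34979; 34467; 95907; 176803; 176291; 115363; 53923; 238243;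
237731; 299683; 361123; 354979; 293539; 296611; 112291; 241315; 179875; 293027; 357539; 235171; 170659;
299171; 354467; 296099; 234147; 172707; 357027; 231075; 295587; 353955; 292515; 234659; 173219; 46755; 49827;
240291; 178851; 235683; 297123; 355491; 177315; 179363; 111779; 240803; 115875; 112803; 174243; 300195;
171171; 239779; 110755; 107683; 178339; 46243; 175267; 52387; 169123; 233635; 267939; 307875; 329379; 246435;
212643; 22179; 225443; 286883; 262307; 323747; 265379; 326819; 164003; 228515; 167075; 123555; 206499; 264867;
224931; 224419; 285859; 264355; 162979; 101539; 227491; 43171; 138403; 242851; 304291; 276643; 181411; 58531;
119971; 68265; 129705; 320169; 313507; 230569; 169129; 325801; 156841; 6313; 144553; 344233; 162985; 347305;
301225; 178345; 34473; 218793; 49833; 6825; 37545; 74409; 258729; 135849; 10409; 194729; 13481; 129187;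
205987; 328867; 273571; 335011; 166051; 83619; 151203; 305315; 339619; 219811; 158371; 222883; 367267; 238755;
57507; 241827; 307369; 30889; 328873; 12457; 22185; 206505; 9897; 194217; 12969; 191657; 307363; 338083;
18595; 202915; 325795; 279715; 341155; 6307; 83107; 12451; 212131; 365731; 277155; 338595; 145059; 221859;
283299; 160419; 237219; 298659; 175779; 209571; 148131; 332451; 28323; 335523; 228003; 59043; 203939; 81059;
142499; 219299; 358051; 100003; 56995; 118435; 302755; 294051; 51363; 358563; 180387; 22697; 245923; 261283;
322723; 215203; 92323; 153763; 292003; 3235; 80035; 141475; 33955; 95395; 49315; 282787; 344227; 40099;
347299; 288931; 675; 62115; 169635; 203427; 326307; 111267; 360099; 301731; 363171; 166563; 99491; 345251;
360611; 102563; 348323; 302243; 363683; 44195; 289955; 351395; 120995; 232099; 48291; 232611; 109731; 54435;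
25257; 197801; 30883; 230563; 218275; 172195; 114339; 114851]%positive);
([:: 247; 184567; 61687; 246007; 123127; 307447; 77047; 261367; 138487; 322807; 153847; 338167; 80119; 264439;
141559; 325879; 156919; 341239; 159991; 344311; 759; 185079; 62199; 246519; 123639; 307959; 77559; 261879;
138999; 323319; 154359; 338679; 80631; 142071; 157431; 160503; 1271; 185591; 62711; 247031; 124151; 308471;
78071; 139511; 154871; 81143; 142583; 157943; 1783; 186103; 63223; 124663; 78583; 140023; 81655; 143095; 2295;
63735; 79095; 82167; 248; 184568; 61688; 77679; 4856; 246008; 123128; 139119; 189176; 307448; 154479; 189688;
77048; 879; 65784; 62319; 80751; 4344; 261368; 138488; 185199; 127224; 123759; 142191; 188664; 322808; 338799;
251128; 153848; 246639; 311544; 308079; 157551; 250104; 338168; 261999; 312056; 323439; 160623; 250616; 3320;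
187640; 64760; 78191; 7928; 249080; 80761; 190712; 126200; 139631; 192248; 157561; 9464; 310520; 154991;
192760; 142201; 6392; 80120; 1391; 65272; 62831; 81263; 3832; 141560; 185711; 126712; 124271; 142703; 188152;
156920; 247151; 311032; 308591; 158063; 249592; 67832; 78703; 7416; 129272; 140143; 191736; 160633; 70904;
79215; 10488; 83192; 1903; 68344; 142215; 81775; 63343; 6904; 144632; 186223; 129784; 80775; 143215; 124783;
191224; 161145; 86264; 2415; 71416; 265091; 82287; 63855; 9976; 760; 185080; 62200; 77167; 1784; 246520;
80249; 261880; 123640; 138607; 186104; 157049; 338680; 322927; 247544; 61817; 262904; 307960; 153967; 186616;
141689; 323320; 261487; 308984; 338287; 160111; 248056; 377; 263416; 261507; 344431; 123257; 324344; 77560;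
367; 62712; 61807; 80239; 1272; 139000; 184687; 124152; 123247; 141679; 185592; 153977; 339192; 264559;
323832; 246147; 341359; 325999; 262392; 77177; 247032; 184707; 307567; 160121; 154360; 387; 246127; 138617;
157039; 308472; 301; 184621; 61741; 77173; 80173; 373; 61813; 77101; 246061; 123181; 138613; 141613; 184693;
123253; 138541; 307501; 153973; 156973; 246133; 307573; 153901; 261421; 322861; 338293; 160045; 261493;
322933; 338221; 264493; 325933; 341365; 344365; 264565; 326005; 341293; 813; 46476; 80685; 62325; 77685;
62253; 885; 77613; 185133; 31116; 142125; 123765; 139125; 123693; 185205; 139053; 246573; 15756; 157485;
308085; 154485; 308013; 246645; 154413; 261933; 396; 160557; 323445; 338805; 323373; 262005; 338733; 1325;
49548; 81197; 62837; 78197; 50060; 62765; 1397; 78125; 185645; 34188; 142637; 124277; 139637; 34700; 124205;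
185717; 139565; 247085; 18828; 157997; 308597; 154997; 19340; 308525; 247157; 154925; 1837; 184708; 63349;
52620; 81709; 78709; 53132; 63277; 1909; 78637; 160138; 37772; 157066; 56204; 140077; 79149; 186229; 37260;
143149; 124789; 38284; 186157; 140149; 124717; 153994; 82293; 56716; 63789; 2421; 55692; 2349; 63861; 82221;
395; 15755; 31115; 46475; 18827; 34187; 49547; 19339; 34699; 50059; 37771; 53131; 53644; 393; 61833; 77193;
80265; 394; 61834; 123274; 77194; 138634; 80266; 141706]%positive,
[:: 292007; 3239; 248999; 270503; 285863; 288935; 304295; 3751; 188071; 249511; 252583; 274087; 225959; 229031;
229543; 60583; 244903; 167; 187559; 295079; 193703; 255143; 12455; 196775; 264871; 245927; 267943; 255655;
271015; 258727; 258215; 273575; 274599; 261287; 264359; 268455; 253095; 295591; 183460; 306343; 14503; 184487;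
276647; 280231; 256167; 279719; 6311; 298151; 6823; 190631; 282791; 191143; 252071; 9383; 301223; 9895;
224423; 209063; 227495; 212135; 58535; 43175; 242855; 27815; 7335; 191655; 22695; 207015; 10407; 25767;
210087; 225447; 28839; 243879; 213159; 228519; 10919; 302759; 195239; 287399; 283815; 256679; 272039; 283303;
26279; 210599; 222375; 41639; 198311; 290471; 299175; 259751; 275111; 298663; 29351; 244391; 213671; 237735;
44711; 60071; 198823; 290983; 302247; 260263; 275623; 301735; 29863; 241319; 214183; 240807; 45223; 56999;
133796; 149156; 134308; 149668; 260260; 73380; 134820; 88740; 150180; 260772; 33958; 242854; 131236; 49318;
239782; 233638; 236710; 70308; 85668; 234150; 237222; 131748; 147108; 76452; 137892; 52390; 55462; 91812;
49830; 240294; 153252; 52902; 55974; 75940; 137380; 37030; 58534; 152740; 37542; 59046; 160420; 175780;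
178852; 117412; 172708; 114340; 276132; 331428; 40102; 43174; 162980; 136868; 152228; 40614; 43686; 347300;
166052; 350372; 31910; 47270; 231590; 50342; 234662; 32422; 305830; 47782; 302758; 35494; 244390; 50854;
241318; 38566; 38054; 59558; 15527; 199847; 30887; 18599; 233639; 202919; 218279; 33959; 49319; 21671; 205991;
37031; 52391; 24743; 40103; 22183; 237223; 206503; 221863; 194215; 25255; 240295; 209575; 224935; 40615;
55975; 12967; 181924; 197287; 166564; 163492; 5796; 292006; 295078; 292518; 28327; 243367; 212647; 228007;
43687; 59047; 194727; 315556; 161956; 60070; 41126; 44198; 41127; 56487; 13479; 197799; 8868; 44199; 59559;
13991; 6820; 188068; 248998; 252070; 3748; 252580; 68260; 255652; 190630; 193702; 252068; 175268; 359588;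
178340; 71332; 190628; 113828; 295076; 6308; 298148; 233636; 70820; 362660; 187556; 129700; 74404; 6310;
196774; 313508; 159908; 344228; 365732; 3236; 72356; 202918; 224422; 69284; 200870; 84644; 87716; 203430;
224934; 80548; 203942; 146596; 91300; 34470; 243366; 34982; 333988; 349348; 122020; 312484; 128164; 198820;
30886; 304294; 318628; 31398; 334500; 349860; 337572; 352932; 53414; 56486; 337060; 53926; 183972; 56998;
165540; 168612; 14500; 106660; 143524; 243878; 25254; 28326; 151204; 240806; 67236; 11940; 230566; 298150;
231078; 298662; 128676; 312996; 15012; 46246; 301222; 122532; 144036; 46758; 295590; 258214; 3238; 301734;
12454; 9382; 304806; 132772; 132260; 129188; 237734; 212646; 22182; 145060; 299174; 212134; 21670; 328868;
225446; 206502; 209574; 83620; 286886; 205990; 209062; 86180; 302246; 27814; 24742; 147620; 305318; 48294;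
232614; 294054; 51366; 235686; 54438; 19111; 203431; 34471; 37543; 38055; 65188; 9892; 187558; 255142; 248996;
101540; 356516; 301220; 49316; 64676; 293028; 84132; 151716; 71844; 90276; 253604; 268964; 330916; 367780;
190116; 251556; 82596; 193188; 196260; 174756; 177828; 297636; 300708; 269988; 273060; 291492; 343716; 153764;
169124; 353444; 341156; 119972; 338084; 126116; 310948; 12964; 242852; 253092; 268452; 256164; 191652; 188580;
245926; 267430; 111780; 296100; 246438; 267942; 4260; 7332; 311460; 123044; 166; 273574; 157860; 678; 274086;
293030; 194724; 24740; 270502; 184486; 173220; 184998; 271014; 271524; 108708; 207012; 332964; 336036; 348324;
274596; 329892; 161444; 345764; 182948; 367268; 146084; 90788; 19110; 228006; 19622; 228518; 235174; 97956;
315044; 75428; 18598; 227494; 16550; 289958; 232102; 256676; 318116; 321188; 272036; 333476; 336548; 343204;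
306340; 115876; 112804; 177316; 361636; 5284; 8356; 276646; 279718; 277158; 280230; 277670; 254116; 72868;
218278; 221350; 216230; 283814; 277668; 216742; 269476; 88228; 218790; 221862; 219302; 222374; 280740; 219814;
97444; 297124; 300196; 301732; 79524; 171684; 27300; 226980; 288420; 359076; 171172; 226468; 355492; 287908;
82084; 358564; 251044; 195748; 215206; 282790; 215718; 283302; 26788; 92324; 292004; 357028; 357540; 265380;
302244; 354468; 25764; 210084; 262308; 230052; 214692; 30372; 156324; 170660; 363172; 108196; 184996; 92836;
344740; 360100; 169636; 246436; 65700; 127140; 142500; 28836; 213156; 139428; 323748; 339108; 326820; 228516;
140452; 155812; 324772; 125092; 155300; 154276; 307876; 339620; 342692; 143012; 229028; 311972; 138404; 15526;
288934; 16038; 289446; 213668; 293542; 138916; 335524; 354980; 358052; 81572; 225956; 250532; 195236; 199846;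
285862; 200358; 286374; 77476; 278182; 338596; 289444; 292516; 298660; 219812; 216740; 32420; 232100; 281252;
96932; 284324; 222372; 293540; 109220; 93860; 4772; 7844; 261286; 264358; 261798; 264870; 23204; 262310;
17060; 94884; 110244; 279204; 24228; 109732; 294052; 208036; 33444; 217764; 18084; 48804; 231588; 47268;
31908; 48292; 232612; 31396; 231076; 215207; 46247; 230567; 221351; 236711; 55463; 239783; 314020; 316068;
199332; 191140; 194212; 148132; 135844; 320164; 89764; 330404; 189604; 158884; 192676; 346276; 257188; 272548;
165028; 159396; 113316; 254628; 116388; 257700; 319140; 104100; 107172; 306852; 267428; 98468; 316580; 331940;
116900; 89252; 150692; 104612; 181412; 249508; 317092; 86692; 197284; 258724; 314532; 145572; 87204; 189092;
192164; 130724; 207524; 176804; 361124; 164516; 275108; 167588; 66724; 85156; 11428; 211108; 321700; 275620;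
168100; 140964; 208548; 101028; 162468; 362148; 211620; 42660; 119460; 303780; 180900; 365220; 45732; 61092;
245924; 307364; 230564; 107684; 18596; 202916; 264356; 325796; 33956; 218276; 279716; 21668; 205988; 37028;
52388; 9380; 193700; 209060; 270500; 40100; 239780; 12452; 196772; 73892; 135332; 27812; 212132; 273572;
335012; 43172; 304292; 98980; 102052; 250020; 68772; 22692; 10404; 133284; 317604; 240804; 13476; 197796;
74916; 259236; 136356; 320676; 278180; 66212; 127652; 158372; 235172; 173732; 222884; 238244; 10916; 210596;
287396; 13988; 290468; 309412; 79012; 94372; 51364; 235684; 174244; 23716; 100516; 54436; 238756; 42148;
57508; 241828; 118948; 303268; 29860; 214180; 45220; 229540; 60580; 2724; 187044; 64164; 248484; 125604;
202404; 263844; 325284; 233124; 36516; 51876; 236196; 39588; 346788; 15524; 199844; 215204; 141476; 156836;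
172196; 144548; 221348; 224420; 46756; 353956; 141988; 95908; 157348; 295588; 267940; 329380; 271012; 332452;
347812; 274084; 350884; 366244; 185508; 246948; 77988; 216228; 93348; 154788; 342180; 283812; 237732; 299172;
176292; 225444; 179364; 243876; 1700; 247460; 308900; 201380; 20132; 204452; 35492; 38564; 100004; 26276;
41636; 44708; 2212; 17572; 201892; 204964; 220324; 21156; 123556; 200356; 326308; 37540; 52900; 240292; 19108;
218788; 22180; 25252; 38052]%positive);
([:: 179; 15539; 18611; 19123; 153907; 98483; 80051; 95411; 38067; 338227; 158003; 110771; 113843; 53427; 141491;
61747; 107699; 138419; 52403; 52915; 246067; 156979; 341299; 157491; 81715; 92339; 37043; 37555; 76979;
123187; 178355; 159923; 57011; 175283; 307507; 143155; 307; 169139; 153779; 55475; 55987; 184627; 80179;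
264499; 141619; 325939; 80691; 142131; 82227; 61619; 33971; 34483; 30899; 138547; 322867; 172211; 156851;
116915; 56499; 142643; 77107; 261427; 123059; 46259; 49331; 49843; 160051; 344371; 160563; 81203; 819; 172723;
157363; 117427; 117939; 185139; 77619; 261939; 139059; 323379; 1331; 185651; 78131; 139571; 63795; 79155;
80563; 98995; 99507; 95923; 123699; 308019; 175795; 160435; 178867; 118451; 140083; 62259; 246579; 142003;
111283; 114355; 114867; 154419; 338739; 154931; 78643; 62771; 247091; 160947; 176307; 179379; 179891; 124211;
308531; 1843; 186163; 63283; 124723; 2355; 308; 123259; 322868; 3380; 184699; 307508; 138619; 310580; 141691;
6452; 62331; 77108; 188212; 322939; 246651; 142715; 153908; 67892; 126772; 7476; 261499; 138548; 338299;
129332; 160123; 70964; 61793; 141620; 185723; 124283; 187700; 139643; 126260; 80225; 157025; 61819; 184628;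
123771; 261428; 338811; 3892; 62843; 80180; 341371; 86324; 2427; 71476; 123233; 153953; 157537; 379; 154491;
155003; 246068; 77179; 308091; 81275; 249140; 80251; 190772; 65332; 157563; 10036; 1403; 157051; 64820; 78203;
191796; 9524; 79227; 10548; 141665; 160097; 161121; 246139; 139131; 323451; 123188; 153979; 891; 185211;
61748; 307579; 338228; 77691; 262011; 249652; 80763; 191284; 308603; 264571; 156980; 326011; 247163; 311092;
142203; 6964; 390; 160609; 160646; 353; 83252; 344443; 144692; 1915; 68404; 160635; 129844; 77190; 142177;
61830; 138593; 138630; 80737; 123270; 77153; 158075; 186235; 63355; 124795; 78715; 140155; 81787; 143227;
63867; 82299; 153990; 80262; 141702]%positive,
[:: 80055; 147639; 64695; 319671; 242871; 65207; 249527; 221367; 67767; 252599; 33975; 252087; 135351; 249015;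
218295; 320183; 325815; 141495; 175287; 159927; 162999; 347319; 295095; 331959; 328887; 144567; 298167;
113847; 166583; 46263; 230583; 181943; 120503; 292023; 133303; 307383; 123063; 138423; 322743; 98999; 95927;
301239; 314039; 76983; 350391; 166071; 181431; 365751; 279735; 276663; 148663; 87223; 338103; 341175; 153783;
353463; 359607; 102071; 172215; 90295; 110775; 178359; 233655; 313527; 236727; 316599; 129207; 126135; 310967;
317111; 126647; 264375; 95415; 9399; 12471; 196791; 6327; 212151; 27831; 209079; 21687; 101559; 285879;
288951; 104631; 15543; 273591; 89271; 86199; 172727; 150711; 335031; 267447; 83127; 61623; 304311; 30903;
178871; 111287; 227511; 18615; 255671; 255159; 224439; 188087; 43191; 3767; 258231; 276645; 273573; 319653;
274085; 320165; 166565; 212645; 366245; 243365; 228005; 151205; 258725; 335525; 292005; 28325; 89765; 133797;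
213669; 60069; 121509; 152229; 136869; 198309; 321189; 244389; 90789; 29349; 275109; 336549; 72357; 87717;
210597; 195237; 26277; 256677; 318117; 272037; 333477; 225957; 164517; 241317; 56997; 167589; 44709; 98981;
52901; 37541; 114341; 129701; 191141; 283301; 344741; 22181; 206501; 314021; 252581; 310949; 249509; 65189;
80549; 264869; 326309; 123045; 61605; 314533; 268453; 253093; 329893; 222373; 130213; 76965; 261285; 353445;
338085; 184485; 230565; 245925; 234149; 160933; 207013; 237733; 53413; 22693; 84133; 213157; 151717; 228517;
259237; 320677; 274597; 336037; 243877; 182437; 28837; 90277; 3749; 270501; 331941; 255141; 316581; 126117;
279717; 187557; 341157; 264357; 285861; 132261; 347301; 193701; 310437; 325797; 248997; 49317; 95397; 64677;
242853; 89253; 70821; 24741; 27813; 335013; 166053; 43173; 212133; 135333; 239781; 178341; 275621; 321701;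
168101; 214181; 106661; 91301; 244901; 229541; 152741; 137381; 332453; 255653; 148133; 224933; 317093; 209573;
25253; 86693; 210085; 25765; 87205; 271525; 317605; 240805; 256165; 133285; 126629; 188069; 252069; 129189;
313509; 205989; 21669; 83109; 270519; 129719; 258743; 183; 184503; 199863; 261303; 187575; 202935; 156855;
356535; 190647; 206007; 282807; 344247; 24759; 239799; 362679; 58551; 6839; 191159; 145079; 114359; 175799;
194231; 163511; 117431; 105143; 145591; 136375; 107685; 267429; 144549; 328869; 86181; 181413; 271013; 289445;
181925; 145573; 148645; 332965; 149157; 287397; 182949; 290981; 60581; 98487; 55479; 73911; 157367; 68279;
83639; 9911; 132791; 74423; 84151; 74935; 322725; 30885; 46245; 202917; 209061; 40101; 101541; 162981; 73893;
258213; 150693; 227493; 104613; 288933; 350373; 58533; 119973; 145061; 132773; 163493; 135845; 105125; 350885;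
59045; 304805; 225445; 164005; 136357; 167077; 59557; 41637; 103077; 348837; 118437; 75429; 259749; 106149;
290469; 260261; 29861; 337061; 183461; 71351; 86711; 165; 307365; 138405; 92325; 169125; 3237; 141477; 33957;
218277; 156837; 110757; 295077; 6309; 190629; 67749; 221349; 98469; 282789; 159909; 52389; 236709; 9381;
19109; 203429; 141989; 218789; 157349; 172709; 6821; 68261; 9893; 194213; 71333; 286373; 7333; 191653; 68773;
99493; 283813; 10405; 194725; 71845; 102565; 56485; 13477; 197797; 74917; 120997; 14501; 198821; 75941; 18597;
95909; 40613; 345253]%positive)].

(** * Correctness of codes, normal forms and vector sums *)

Lemma decvE n i r : decv (iter n xI (xO r)) i = Some ((n + i)%N, r).
Proof. by elim: n i => //= n IHn i; rewrite IHn addnS. Qed.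

Fixpoint nodes (t : term) : nat :=
  match t with TV _ => 1%N | TC u v | TB u v => (nodes u + nodes v).+1 end.

Lemma dec_enc f t r : (nodes t <= f)%N -> dec f (enc t r) = Some (t, r).
Proof.
elim: t f r => [i|u IHu v IHv|u IHu v IHv] [|f] r //= Hf.
- by rewrite decvE addn0.
- by rewrite IHu ?IHv //; lia.
- by rewrite IHu ?IHv //; lia.
Qed.

(** Every node costs at least one bit, so the length of a code is enough fuel to decode it. *)
Lemma size_enc t r : (nodes t + Pos.size_nat r <= Pos.size_nat (enc t r))%N.
Proof.
elim: t r => /= [i|u IHu v IHv|u IHu v IHv] r.
- by rewrite ltnS; elim: i => //= i; lia.
- by have := IHu (enc v r); have := IHv r; lia.
- by have := IHu (enc v r); have := IHv r; lia.
Qed.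

Lemma codeK : cancel code decode.
Proof. by move=> t; rewrite /decode dec_enc //; have := size_enc t xH; rewrite /code; lia. Qed.

Fixpoint mn (t : term) : nat :=
  match t with TV i => i | TC u v | TB u v => minn (mn u) (mn v) end.

Lemma ccanE t : ccan t = (ccanon t, mn t).
Proof.
rewrite /ccanon.
elim: t => //= u -> v -> /=; by case: Nat.leb_spec => H /=; congr pair; lia.
Qed.

Lemma ccanonC u v : ccanon (TC u v) =
  if (mn u <= mn v)%N then TC (ccanon u) (ccanon v) else TC (ccanon v) (ccanon u).
Proof. by rewrite {1}/ccanon /= !ccanE; case: Nat.leb_spec => H; case: leqP => H' //; lia. Qed.

Lemma ccanonB u v : ccanon (TB u v) =
  if (mn u <= mn v)%N then TB (ccanon u) (ccanon v) else TB (ccanon v) (ccanon u).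
Proof. by rewrite {1}/ccanon /= !ccanE; case: Nat.leb_spec => H; case: leqP => H' //; lia. Qed.

Lemma mn_ccanon t : mn (ccanon t) = mn t.
Proof.
elim: t => // u IHu v IHv; rewrite ?ccanonC ?ccanonB; case: leqP => _ /=;
  by rewrite IHu IHv // minnC.
Qed.

Lemma ccanon_id t : ccanon (ccanon t) = ccanon t.
Proof.
elim: t => // u IHu v IHv; rewrite ?ccanonC ?ccanonB; case: leqP => H /=;
  rewrite ?ccanonC ?ccanonB !mn_ccanon IHu IHv ?H //; case: leqP => //; lia.
Qed.

Lemma perm_ccanon t : perm_eq (leaves (ccanon t)) (leaves t).
Proof.
elim: t => // u IHu v IHv; rewrite ?ccanonC ?ccanonB; case: leqP => _ /=;
  by [apply: perm_cat | rewrite perm_catC; apply: perm_cat].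
Qed.

Lemma mn_leaves t : mn t \in leaves t.
Proof.
elim: t => /= [i|u IHu v IHv|u IHu v IHv]; rewrite ?inE // mem_cat /minn;
  by case: ifP; rewrite ?IHu ?IHv ?orbT.
Qed.

(** In a multilinear product the comparison made by [ccanon] never ends in a tie. *)
Lemma mn_neq u v : uniq (leaves u ++ leaves v) -> mn u != mn v.
Proof.
rewrite cat_uniq => /and3P[_ /hasPn H _]; apply: contra (H _ (mn_leaves v)) => /eqP <-.
exact: mn_leaves.
Qed.

Section Semantics.
Variable F : fieldType.
Implicit Types (p q : Defs.poly F) (g : positive -> F).

(** With distinct variables at most one order of the factors can match at each product, so the
    coefficient is 0 or 1; with repeated variables it could be larger. *)
Lemma J_tp_ccanon m t : uniq (leaves m) -> J (tp F m) t = (ccanon m == ccanon t)%:R.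
Proof.
have E u x : ccanon u = ccanon x -> mn u = mn x.
  by move=> e; rewrite -(mn_ccanon u) e mn_ccanon.
elim: m t => [i|u IHu v IHv|u IHu v IHv] [j|x y|x y] //=;
  rewrite /J /= ?addr0 ?ccanonC ?ccanonB; try by case: leqP => _ //; case: leqP.
- by move=> _; rewrite [TV i == _]/eq_op /= -[eqn i j]/(i == j); case: eqP.
- move=> Huv; have uv := mn_neq Huv; move: Huv.
  rewrite cat_uniq => /and3P[/IHu Hu _ /IHv Hv]; rewrite -!/(J _ _) !Hu !Hv.
  have eqC a b c d : (TC a b == TC c d) = (a == c) && (b == d) by [].
  (* Equal normal forms have equal least variables; with [uv] this excludes that both orders match
     and decides which order [ccanon] has chosen. *)
  have E' a b : (ccanon a == ccanon b) = true -> mn a = mn b by move/eqP/E.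
  have := E' u x; have := E' v y; have := E' v x; have := E' u y.
  case: leqP => Huv; case: leqP => Hxy; rewrite eqC;
    case: (ccanon u == ccanon x); case: (ccanon v == ccanon y);
    case: (ccanon v == ccanon x); case: (ccanon u == ccanon y) => h1 h2 h3 h4;
    rewrite ?(mulr0, mul0r, mulr1, addr0, add0r) //;
    try have := h1 erefl; try have := h2 erefl; try have := h3 erefl; try have := h4 erefl;
    clear - uv Huv Hxy; lia.
- move=> Huv; have uv := mn_neq Huv; move: Huv.
  rewrite cat_uniq => /and3P[/IHu Hu _ /IHv Hv]; rewrite -!/(J _ _) !Hu !Hv.
  have eqB a b c d : (TB a b == TB c d) = (a == c) && (b == d) by [].
  have E' a b : (ccanon a == ccanon b) = true -> mn a = mn b by move/eqP/E.
  have := E' u x; have := E' v y; have := E' v x; have := E' u y.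
  case: leqP => Huv; case: leqP => Hxy; rewrite eqB;
    case: (ccanon u == ccanon x); case: (ccanon v == ccanon y);
    case: (ccanon v == ccanon x); case: (ccanon u == ccanon y) => h1 h2 h3 h4;
    rewrite ?(mulr0, mul0r, mulr1, addr0, add0r) //;
    try have := h1 erefl; try have := h2 erefl; try have := h3 erefl; try have := h4 erefl;
    clear - uv Huv Hxy; lia.
Qed.

(** [ccanon] does not commute with a renaming, since it compares variables, but the commutative
    class does. *)
Lemma jeq_ccanon s t : jeq F (ren s (ccanon t)) (ren s t).
Proof.
elim: t => // u IHu v IHv; rewrite ?ccanonC ?ccanonB; case: leqP => _ /=.
- exact: jeq_C.
- by apply: (jeq_trans (@jeq_swapC F _ _)); apply: jeq_C.
- exact: jeq_B.
- by apply: (jeq_trans (@jeq_swapB F _ _)); apply: jeq_B.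
Qed.

Definition zF (z : Z) : F := (int_of_Z z)%:~R.

Lemma zFD x y : zF (Z.add x y) = zF x + zF y.
Proof. by rewrite -intrD -(raddfD int_of_Z). Qed.

Lemma zFM x y : zF (Z.mul x y) = zF x * zF y.
Proof. by rewrite -intrM -(rmorphM int_of_Z). Qed.

Definition sumv g (v : vec) : F := \sum_(e <- v) zF e.2 * g e.1.

Lemma sumv_cons g e v : sumv g (e :: v) = zF e.2 * g e.1 + sumv g v.
Proof. exact: big_cons. Qed.

Lemma sumv_nil g : sumv g [::] = 0.
Proof. exact: big_nil. Qed.

Lemma sumv_scale g x v : sumv g (scalev x v) = zF x * sumv g v.
Proof.
by rewrite /sumv big_map big_distrr /=; apply: eq_bigr => e _; rewrite zFM mulrA.
Qed.

(** Valid for unsorted vectors too: disorder could only leave like terms uncollected. So no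
    sortedness has to be tracked. *)
Lemma sumv_lcmb g x y v w : sumv g (lcmb x y v w) = zF x * sumv g v + zF y * sumv g w.
Proof.
elim: v w => [|[i c] v IHv] w.
  have -> : lcmb x y [::] w = scalev y w by case: w.
  by rewrite sumv_scale sumv_nil mulr0 add0r.
elim: w => [|[j d] w IHw].
  have -> : lcmb x y ((i, c) :: v) [::] = scalev x ((i, c) :: v) by [].
  by rewrite sumv_scale sumv_nil mulr0 addr0.
rewrite [lcmb _ _ _ _]/=; case: Pos.compare_spec => [->|ij|ij].
- have -> : sumv g (if Z.eqb (Z.add (Z.mul x c) (Z.mul y d)) Z0 then lcmb x y v w
              else (j, Z.add (Z.mul x c) (Z.mul y d)) :: lcmb x y v w) =
      zF (Z.add (Z.mul x c) (Z.mul y d)) * g j + sumv g (lcmb x y v w).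
    case: Z.eqb_spec => [->|_]; last by rewrite sumv_cons.
    by rewrite /zF /= mul0r add0r.
  by rewrite IHv !sumv_cons zFD !zFM /=; ring.
- by rewrite sumv_cons IHw !sumv_cons zFM /=; ring.
- by rewrite sumv_cons IHv !sumv_cons zFM /=; ring.
Qed.

Lemma sumv_merge g v w : sumv g (mergev v w) = sumv g v + sumv g w.
Proof. by rewrite sumv_lcmb !mul1r. Qed.

Lemma sumv_pairs g ls : \sum_(v <- pairs ls) sumv g v = \sum_(v <- ls) sumv g v.
Proof.
have [n] := ubnP (size ls); elim: n ls => // n IHn [|v [|w ls]] //= H.
by rewrite !big_cons IHn; [rewrite sumv_merge addrA | lia].
Qed.

Lemma sumv_mergeall g n ls : sumv g (mergeall n ls) = \sum_(v <- ls) sumv g v.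
Proof.
elim: n ls => [|n IHn] [|v [|w ls]]; rewrite ?big_nil ?sumv_nil ?big_seq1 //=.
  rewrite !sumv_merge !big_cons; congr (_ + (_ + _)).
  elim: ls => [|u ls IH] /=; rewrite ?big_nil ?sumv_nil // big_cons sumv_merge IH //.
by rewrite IHn -[_ :: _]/(pairs [:: v, w & ls]) sumv_pairs.
Qed.

Lemma sumv_sort g v : sumv g (sortv v) = sumv g v.
Proof.
rewrite sumv_mergeall big_map; apply: eq_bigr => e _.
by rewrite sumv_cons sumv_nil addr0.
Qed.

End Semantics.

(** * Neighbours under the laws, and shapes *)

Lemma memtE t s : memt t s = (t \in s).
Proof. by rewrite /memt -has_pred1; apply: eq_has => u; rewrite /= eq_sym. Qed.

Lemma nbrs_ren s t : nbrs (ren s t) = map (ren s) (nbrs t).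
Proof.
elim: t => //= u IHu v IHv; rewrite !map_cat IHu IHv -!map_comp;
  by congr (_ ++ (_ ++ (_ ++ _))); case: u {IHu} => //= *; case: v {IHv}.
Qed.

Lemma step_nbrs t t' : step t t' -> t' \in nbrs t /\ t \in nbrs t'.
Proof.
elim=> /= [x y z|x y z|x y z w|x x' y _ [IH1 IH2]|x y y' _ [IH1 IH2]|x x' y _ [IH1 IH2]|x y y' _ [IH1 IH2]];
  split; rewrite ?inE ?mem_cat ?inE ?eqxx ?orbT //;
  by rewrite (map_f (TC^~ _) _, map_f (TC _) _, map_f (TB^~ _) _, map_f (TB _) _) ?orbT.
Qed.

Lemma nbrs_step t t' : t' \in nbrs t -> step t t' \/ step t' t.
Proof.
elim: t t' => //= u IHu v IHv t'; rewrite !mem_cat => /or4P[].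
- by case: u {IHu} => //= x y; rewrite inE => /eqP ->; left; constructor.
- by case: v {IHv} => //= x y; rewrite inE => /eqP ->; right; constructor.
- by case: u {IHu} => //= x y; case: v {IHv} => //= z w; rewrite inE => /eqP ->; right; constructor.
- by case/orP=> /mapP[x] => [/IHu|/IHv] [] H ->; [left|right|left|right]; constructor.
- by case: u {IHu} => //= x y; rewrite inE => /eqP ->; left; constructor.
- by case: v {IHv} => //= x y; rewrite inE => /eqP ->; right; constructor.
- by case: u {IHu} => //= x y; case: v {IHv} => //= z w; rewrite inE => /eqP ->; left; constructor.
- by case/orP=> /mapP[x] => [/IHu|/IHv] [] H ->; [left|right|left|right]; constructor.
Qed.

Lemma rlbE t n : (rlb t n).2 = (n + size (leaves t))%N.
Proof.
elim: t n => /= [i|u IHu v IHv|u IHu v IHv] n; rewrite ?addn1 // size_cat;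
  move: (IHu n); case: (rlb u n) => a k /= ->;
  by move: (IHv (n + size (leaves u))%N); case: (rlb v _) => b l /= ->; rewrite addnA.
Qed.

Lemma ren_rlb s t n : (forall k, (k < size (leaves t))%N -> s (n + k)%N = nth 0%N (leaves t) k) ->
  ren s (rlb t n).1 = t.
Proof.
elim: t n => /= [i|u IHu v IHv|u IHu v IHv] n H.
- by have := H 0%N; rewrite addn0 => ->.
- have := rlbE u n; have := IHu n; case: (rlb u n) => a k /= {}IHu ->.
  have := IHv (n + size (leaves u))%N; case: (rlb v _) => b l /= {}IHv.
  rewrite IHu ?IHv // => k' Hk'; rewrite ?H ?nth_cat ?Hk' // ?size_cat; try lia.
  by rewrite -addnA H ?nth_cat ?size_cat ?addKn ?ltn_add2l // ltnNge leq_addr.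
- have := rlbE u n; have := IHu n; case: (rlb u n) => a k /= {}IHu ->.
  have := IHv (n + size (leaves u))%N; case: (rlb v _) => b l /= {}IHv.
  rewrite IHu ?IHv // => k' Hk'; rewrite ?H ?nth_cat ?Hk' // ?size_cat; try lia.
  by rewrite -addnA H ?nth_cat ?size_cat ?addKn ?ltn_add2l // ltnNge leq_addr.
Qed.

Lemma ren_shape t : ren (nth 0%N (leaves t)) (shape t) = t.
Proof. exact: ren_rlb. Qed.

(** * Vanishing in the free algebra, and class equations *)

Section Combs.
Variable F : fieldType.
Implicit Types (p q f : Defs.poly F) (chi : term -> F) (l : comb).

Definition zp l : Defs.poly F :=
  foldr (fun e acc => Add (Scale (zF F e.1) (tp F e.2)) acc) Zero l.

Lemma pr_zp l chi : pr (zp l) chi = \sum_(e <- l) zF F e.1 * chi e.2.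
Proof. by elim: l => [|e l IHl] /=; rewrite ?big_nil // big_cons IHl pr_tp. Qed.

Lemma J_zp l t : J (zp l) t = \sum_(e <- l) zF F e.1 * J (tp F e.2) t.
Proof. by rewrite J_pr pr_zp. Qed.

Lemma coef_zp l t : coef (zp l) t = \sum_(e <- l) zF F e.1 * (e.2 == t)%:R.
Proof. by rewrite coef_pr pr_zp. Qed.

Lemma sum_allpairs (h : term -> term -> term) (s r : seq term) chi :
  \sum_(m <- [seq h x y | x <- s, y <- r]) chi m = \sum_(x <- s) \sum_(y <- r) chi (h x y).
Proof. by rewrite big_flatten big_map; apply: eq_bigr => x _; rewrite big_map. Qed.

Lemma pr_jordan_tp t chi : pr (jordan (tp F t)) chi = \sum_(m <- flips t) chi m.
Proof.
elim: t chi => /= [i|u IHu v IHv|u IHu v IHv] chi; first by rewrite big_seq1.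
- rewrite big_cat /= !sum_allpairs !IHu !IHv.
  by congr (_ + _); apply: eq_bigr => m _; rewrite ?IHu ?IHv.
- rewrite big_cat /= !sum_allpairs !IHu !IHv.
  by congr (_ + _); apply: eq_bigr => m _; rewrite ?IHu ?IHv.
Qed.

(** Equality in the free associative interchange algebra, as seen by the invariant functionals. *)
Definition eqv t t' := forall chi, inv chi -> chi t = chi t'.

Lemma eqv_trans u t v : eqv t u -> eqv u v -> eqv t v.
Proof. by move=> tu uv chi H; rewrite tu ?uv. Qed.

Lemma eqv_ren s t t' : eqv t t' -> eqv (ren s t) (ren s t').
Proof.
by move=> H chi Hchi; apply: (H (fun t => chi (ren s t))) => x y xy; apply/Hchi/step_ren.
Qed.

Lemma eqv_nbrs t t' : t' \in nbrs t -> eqv t t'.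
Proof. by move=> /nbrs_step[] H chi Hchi; [|symmetry]; apply: Hchi. Qed.

Lemma eqv_search t n todo seen :
  {in todo, forall x, eqv t x} -> {in seen, forall x, eqv t x} ->
  {in search n todo seen, forall x, eqv t x}.
Proof.
elim: n todo seen => [|n IHn] [|y todo] seen //= Htodo Hseen.
have Hy : {in nbrs y, forall x, eqv t x}.
  by move=> x /eqv_nbrs; apply: eqv_trans; apply: Htodo; rewrite mem_head.
have {}Htodo : {in todo, forall x, eqv t x}.
  by move=> x xt; apply: Htodo; rewrite inE xt orbT.
elim: (nbrs y) todo seen Hy Htodo Hseen => [|z zs IHzs] todo seen Hy Htodo Hseen /=.
  exact: IHn.
have Hz : eqv t z by apply: Hy; rewrite mem_head.
have {}Hy : {in zs, forall x, eqv t x} by move=> x xz; apply: Hy; rewrite inE xz orbT.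
case: ifP => _; apply: IHzs => // x; rewrite inE => /predU1P[->//|].
  exact: Htodo.
exact: Hseen.
Qed.

Definition table_ok (tab : PM.t term) :=
  forall k c, PM.find k tab = Some c -> eqv (decode k) c.

Lemma table_ok0 : table_ok (PM.empty _).
Proof. by move=> k c; rewrite PM.gempty. Qed.

Lemma table_ok_add k c tab : table_ok tab -> eqv (decode k) c -> table_ok (PM.add k c tab).
Proof.
move=> Htab kc k' c'; case: (Pos.eq_dec k k') => [<-|ne].
  by rewrite PM.gss => -[<-].
by rewrite PM.gso; [apply: Htab|move/esym].
Qed.

(** The test in [add_shape] says that the key decodes to [ren s e], and equivalence is stable under
    the renaming [s]. *)
Lemma table_ok_shape rep tab e : table_ok tab -> eqv rep e -> table_ok (add_shape rep tab e).
Proof.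
move=> Htab He; rewrite /add_shape; case: term_eqP => // E.
apply: table_ok_add => //; rewrite codeK -E => chi Hchi.
by apply/esym/(eqv_ren _ He).
Qed.

Lemma table_ok_classes tab n : table_ok tab -> table_ok (classes tab n).1.
Proof.
move=> Htab; rewrite /classes.
have : table_ok (tab, [::] : seq (seq term)).1 by [].
elim: shapes (tab, [::] : seq (seq term)) => //= t ts IHts st Hst; apply: IHts.
rewrite /add_class; case: PM.find => //=.
have : {in orbitA t, forall x, eqv t x}.
  by apply: eqv_search => x; rewrite inE => /eqP->.
elim: (orbitA t) (st.1) Hst => //= e es IHes tab' Htab' H.
apply: IHes => [|x xe]; last by apply: H; rewrite inE xe orbT.
by apply: table_ok_shape => //; apply: H; rewrite mem_head.
Qed.

Lemma eqv_canonA tab t : table_ok tab -> eqv t (canonA tab t).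
Proof.
rewrite /canonA => Htab; case E: PM.find => [c|] //.
by move/Htab: E; rewrite codeK => /(eqv_ren (nth 0%N (leaves t))); rewrite ren_shape.
Qed.

(** The collected sum over representatives is empty, hence zero under any function of the codes, in
    particular under an invariant functional composed with [decode]. *)
Lemma jnull_vanishes tab l : table_ok tab -> vanishes tab l -> jnull (zp l).
Proof.
move=> Htab /nilP Hl chi Hchi; rewrite pr_jordan pr_zp.
have := sumv_sort (fun k => chi (decode k))
   (flatten [seq [seq (code (canonA tab m), e.1) | m <- flips e.2] | e <- l]).
rewrite Hl sumv_nil /sumv big_flatten big_map /= => E; rewrite [RHS]E.
apply: eq_bigr => e _; rewrite pr_jordan_tp big_map big_distrr /=.
by apply: eq_bigr => m _; rewrite codeK (eqv_canonA _ Htab).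
Qed.

(** The indicator of a set of monomials closed under neighbours is invariant, and so is that of its
    image under [s]; pairing it with the Jordan expansion of [f] gives the equation. *)
Lemma class_sum s L f : injective s -> closedA L -> uniq L -> jnull f ->
  \sum_(t <- L) J f (ren s t) = 0.
Proof.
move=> s_inj /allP HL UL Hf.
have closed t t' : t \in L -> t' \in nbrs t -> t' \in L.
  by move=> /HL/allP/[apply]; rewrite memtE.
have Hin : inv (fun t => (t \in map (ren s) L)%:R : F).
  move=> t t' /step_nbrs[H1 H2]; congr (nat_of_bool _)%:R; apply/idP/idP => /mapP[x xL E].
    rewrite E nbrs_ren in H1; case/mapP: H1 => y yx ->.
    exact/map_f/(closed x).
  rewrite E nbrs_ren in H2; case/mapP: H2 => y yx ->.
  exact/map_f/(closed x).
rewrite -[RHS](Hf _ Hin).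
transitivity (pr (jordan f) (fun u => \sum_(t <- L) (u == ren s t)%:R)).
  by rewrite pr_sum; apply: eq_bigr => t _; rewrite /J coef_pr.
apply: eq_pr => u; case: mapP => [[x xL ->]|H].
  rewrite (bigD1_seq x) //= eqxx big1 ?addr0 // => y.
  by rewrite (inj_eq (ren_inj s_inj)) eq_sym => /negPf->.
by rewrite big_seq big1 // => y yL; case: eqP => // E; case: H; exists y.
Qed.

End Combs.

(** * Renamings, pivots and echelon forms *)

Lemma word_fun_inj w : perm6 w -> injective (word_fun w).
Proof.
case/and3P=> Uw /eqP Sw /all_nthP Hw; rewrite /word_fun => i j.
have small k : (k < 6)%N -> (nth k w k < 6)%N.
  by move=> Hk; rewrite -Sw in Hk; have /Nat.ltb_spec0 := Hw k k Hk; lia.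
case: (ltnP i 6) => Hi; case: (ltnP j 6) => Hj.
- rewrite (set_nth_default j i) ?Sw // => /eqP; rewrite nth_uniq ?Sw // => /eqP //.
- by rewrite [RHS]nth_default ?Sw //; have := small i Hi; lia.
- by rewrite [LHS]nth_default ?Sw //; have := small j Hj; lia.
- by rewrite !nth_default ?Sw.
Qed.

Lemma all_fromP (P : positive -> bool) a n i : all_from P a n ->
  (Pos.to_nat a <= Pos.to_nat i < Pos.to_nat a + n)%N -> P i.
Proof.
elim: n a => [|n IHn] a /=; first by lia.
case/andP=> Pa H Hi; case: (Pos.eq_dec a i) => [<- //|ne].
by apply: IHn H _; lia.
Qed.

Lemma all_betweenP (P : positive -> bool) a b i : all_between P a b ->
  (Pos.to_nat a <= Pos.to_nat i < Pos.to_nat b)%N -> P i.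
Proof. by move=> H Hi; apply: all_fromP H _; lia. Qed.

Lemma pivot_okP piv i : pivot_ok piv i ->
  exists c v, [/\ PM.find i piv = Some ((i, c) :: v), c <> Z0 & below i v].
Proof.
rewrite /pivot_ok; case: PM.find => // -[|[j c] v] // /and3P[/Pos.eqb_spec <- /Z.eqb_spec ? ?].
by exists c, v.
Qed.

Section Echelon.
Variable P : vec -> Prop.
Hypothesis P_lcmb : forall x y v w, P v -> P w -> P (lcmb x y v w).

Definition pivots_ok (piv : PM.t vec) := forall i p, PM.find i piv = Some p -> P p.

Lemma P_reduce n piv v : pivots_ok piv -> P v -> P (reduce n piv v).
Proof.
move=> Hpiv; elim: n v => //= n IHn [|[i c] v] // Hv.
case E: PM.find => [p|] //; apply: IHn; rewrite /cancel_head.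
by case: p E => [|[j d] p] // /Hpiv; apply: P_lcmb.
Qed.

(** All that is proved about elimination: it stays inside any property closed under linear
    combinations. Used for consequences and for the equations satisfied by a fixed polynomial. *)
Lemma P_echelon (T : Type) (h : T -> vec) s : (forall x, P (h x)) -> pivots_ok (echelon (map h s)).
Proof.
move=> Ph; rewrite /echelon.
have : pivots_ok (PM.empty _) by move=> i p; rewrite PM.gempty.
elim: s (PM.empty _) => //= x s IHs piv Hpiv; apply: IHs.
rewrite /add_pivot; have := P_reduce 2000 Hpiv (Ph x).
case: reduce => [|[i c] v] // Hv j p; case: (Pos.eq_dec i j) => [<-|ne].
  by rewrite PM.gss => -[<-].
by rewrite PM.gso; [apply: Hpiv|move/esym].
Qed.

End Echelon.

Lemma all_lcmb (Q : pred (positive * Z)) x y v w :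
  (forall i c d, Q (i, c) -> Q (i, d)) -> all Q v -> all Q w -> all Q (lcmb x y v w).
Proof.
move=> HQ.
have Hs z u : all Q u -> all Q (scalev z u).
  by elim: u => //= -[i c] u IH /andP[/= /HQ-> /IH].
elim: v w => [|[i c] v IHv] w Hv Hw.
  by have -> : lcmb x y [::] w = scalev y w; [case: (w)|apply: Hs].
elim: w Hw => [|[j d] w IHw] Hw; first exact: (Hs x).
have [/= /andP[Qi {}Hv] /= /andP[Qj Hw']] := (Hv, Hw).
rewrite [lcmb _ _ _ _]/=; case: Pos.compare_spec => [ij|ij|ij].
- by case: Z.eqb => /=; rewrite IHv // (HQ _ _ _ Qi).
- by rewrite /= (HQ _ _ _ Qj); apply: IHw.
- by rewrite /= (HQ _ _ _ Qi) IHv.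
Qed.

Lemma all_sortv (Q : pred (positive * Z)) v :
  (forall i c d, Q (i, c) -> Q (i, d)) -> all Q v -> all Q (sortv v).
Proof.
move=> HQ Hv; have HM u w : all Q u -> all Q w -> all Q (mergev u w) by apply: all_lcmb.
rewrite /sortv; have : all (all Q) [seq [:: e] | e <- v].
  by rewrite all_map; apply: sub_all Hv => e /= ->.
elim: 20%N {v Hv} (map _ v) => [|n IHn] [|u [|w ls]] //=; rewrite ?andbT //.
  case/and3P=> Hu Hw Hls; rewrite !HM //.
  by elim: ls Hls => //= z ls IH /andP[Hz /IH]; apply: HM.
move=> H; apply: IHn; move: H; rewrite -[_ :: pairs ls]/(pairs [:: u, w & ls]).
rewrite -[[&& _, _ & _]]/(all (all Q) [:: u, w & ls]).
have [k] := ubnP (size [:: u, w & ls]); elim: k [:: u, w & ls] => // k IHk [|a [|b r]] //= Hk.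
by case/and3P=> Ha Hb Hr; rewrite HM //= IHk //; lia.
Qed.

(** * Clearing one block *)

Section Solve.
Variables (F : fieldType) (S : Defs.poly F -> Prop).
Hypothesis charF0 : [pchar F] =i pred0.
Hypothesis commC_S : conseq S (sub (MulC (Var 0) (Var 1)) (MulC (Var 1) (Var 0))).
Hypothesis commB_S : conseq S (sub (MulB (Var 0) (Var 1)) (MulB (Var 1) (Var 0))).
Hypothesis jnull_S : forall p, S p -> jnull p.
Implicit Types (p q f : Defs.poly F).

Lemma zF_neq0 c : c <> Z0 -> zF F c != 0.
Proof.
move=> Hc; have natF (n : nat) : (0 < n)%N -> n%:R != 0 :> F.
  by move=> Hn; have /pcharf0P -> := charF0; rewrite -lt0n.
case: c Hc => // c _; rewrite /zF /=.
  by rewrite -pmulrn natF //; lia.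
by rewrite NegzE mulrNz oppr_eq0 -pmulrn natF.
Qed.

Lemma two_neq0 : 2%:R != 0 :> F.
Proof. exact: (@zF_neq0 (Zpos 2)). Qed.

(** There are as many ways to swap factors from [m] to [t] as from [t] to [m]. *)
Lemma J_tp_sym m t : J (tp F m) t = J (tp F t) m.
Proof.
elim: m t => [i|u IHu v IHv|u IHu v IHv] [j|x y|x y]; rewrite /J /= ?addr0 //.
- by rewrite eq_sym.
- by rewrite -!/(J _ _) !IHu !IHv; congr (_ + _); rewrite mulrC.
- by rewrite -!/(J _ _) !IHu !IHv; congr (_ + _); rewrite mulrC.
Qed.

Variables (s : nat -> nat) (ix : numbering).
Hypothesis s_inj : injective s.

Let M := mono ix.

(** The number [i] can be recovered from its monomial, so distinct valid numbers have distinct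
    monomials. *)
Definition okb i : bool :=
  [&& (if PM.find (code (M i)) (ixC ix) is Some j then Pos.eqb i j else false),
      Pos.ltb i (ixN ix), ccanon (M i) == M i & uniq (leaves (M i))].

Lemma lookup_ok t i : uniq (leaves t) -> lookup ix t = Some i -> okb i /\ M i = ccanon t.
Proof.
rewrite /lookup => Ut; case E: PM.find => [j|] //; case: ifP => // /andP[Hj /term_eqP Mj] [<-].
split=> //; rewrite /okb /M Mj E Pos.eqb_refl Hj ccanon_id eqxx /=.
by rewrite (perm_uniq (perm_ccanon t)).
Qed.

Definition mon i : term := ren s (M i).

(** The monomials of the block are a basis dual to their own coordinates: entries of a vector are
    values of [J]. *)
Lemma J_mon i j : okb i -> okb j -> J (tp F (mon i)) (mon j) = (Pos.eqb i j)%:R.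
Proof.
case/and4P=> Ei _ /eqP Ci Ui /and4P[Ej _ /eqP Cj Uj].
rewrite J_tp_ren // J_tp_ccanon // Ci Cj; congr (nat_of_bool _)%:R.
case: Pos.eqb_spec => [->|ne]; first by rewrite eqxx.
apply/eqP => E; rewrite E in Ei; apply: ne; move: Ei Ej.
by case: PM.find => // k /Pos.eqb_spec -> /Pos.eqb_spec.
Qed.

Lemma entries_ok l v : all (fun e => uniq (leaves e.2)) l -> entries ix l = Some v ->
  all (fun e => okb e.1) v /\
  forall g : term -> F, (forall t, g (ccanon t) = g t) ->
    sumv (fun i => g (M i)) v = \sum_(e <- l) zF F e.1 * g e.2.
Proof.
elim: l v => [|[k m] l IHl] v /=.
  by move=> _ [<-]; split=> // g _; rewrite big_nil sumv_nil.
case/andP=> Um Ul; case E: lookup => [i|] //; case E': entries => [w|] // [<-].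
have [oki Mi] := lookup_ok Um E; have [okw Hw] := IHl _ Ul E'.
split=> [|g Hg]; first by rewrite /= oki.
by rewrite big_cons sumv_cons Hw //= Mi Hg.
Qed.

Lemma vec_of_ok l : all (fun e => uniq (leaves e.2)) l ->
  vec_of ix l = [::] \/
  all (fun e => okb e.1) (vec_of ix l) /\
  forall g : term -> F, (forall t, g (ccanon t) = g t) ->
    sumv (fun i => g (M i)) (vec_of ix l) = \sum_(e <- l) zF F e.1 * g e.2.
Proof.
move=> Ul; rewrite /vec_of; case E: entries => [v|]; last by left.
have [okv Hv] := entries_ok Ul E; right; split=> [|g Hg].
  exact: all_sortv.
by rewrite sumv_sort Hv.
Qed.

(** [v] lists the coordinates of a consequence of [S] transported by [s]; equality is asked only
    after Jordan expansion, that is, modulo commutativity. *)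
Definition is_row (v : vec) := all (fun e => okb e.1) v /\
  exists2 p, conseq S p & forall t, J p t = sumv (fun i => J (tp F (mon i)) t) v.

Lemma is_row_lcmb x y v w : is_row v -> is_row w -> is_row (lcmb x y v w).
Proof.
move=> [okv [p Sp Hp]] [okw [q Sq Hq]]; split; first exact: all_lcmb.
exists (Add (Scale (zF F x) p) (Scale (zF F y) q)).
  by apply: cq_add; apply: cq_scale.
by move=> t; rewrite sumv_lcmb -Hp -Hq.
Qed.

Lemma is_row_vec l : all (fun e => uniq (leaves e.2)) l ->
  conseq S (zp F (ren_comb s l)) -> is_row (vec_of ix l).
Proof.
move=> Ul Sl; case: (vec_of_ok Ul) => [->|[okv Hv]].
  by split=> //; exists Zero => [|t]; [apply: cq_zero|rewrite sumv_nil].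
split=> //; exists (zp F (ren_comb s l)) => // t.
rewrite (Hv (fun m => J (tp F (ren s m)) t)); first by rewrite J_zp big_map.
by move=> m; rewrite !(J_tp_sym _ t); apply: jeq_ccanon.
Qed.

Variable n : positive.

Lemma sumv_below (x : positive -> F) i v :
  (forall j, (Pos.to_nat j < Pos.to_nat i)%N -> x j = 0) -> below i v -> sumv x v = 0.
Proof.
elim: v i => [|[j c] v IHv] i Hx /=; first by rewrite sumv_nil.
case/andP=> /Pos.ltb_spec0 ji Hv; rewrite sumv_cons /= Hx ?mulr0 ?add0r; last by lia.
by apply: IHv Hv => k Hk; apply: Hx; lia.
Qed.

Definition clean f i := J f (mon i) = 0.

Definition touched t := exists2 i, okb i & J (tp F (mon i)) t != 0.

(** Pivots are removed from the largest number down: the row of pivot [i] has its other entries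
    below [i], so what was cleared above stays clear. The last clause records that only monomials of
    this block are affected. *)
Lemma kill_pivots k f :
  (forall i, (Pos.to_nat n <= Pos.to_nat i < Pos.to_nat n + k)%N ->
     exists c v, [/\ is_row ((i, c) :: v), c <> Z0 & below i v]) ->
  jnull f -> exists f', [/\ jnull f', conseq S (sub f f'),
    forall i, (Pos.to_nat n <= Pos.to_nat i < Pos.to_nat n + k)%N -> clean f' i,
    forall i, okb i -> (Pos.to_nat n + k <= Pos.to_nat i)%N -> J f' (mon i) = J f (mon i) &
    forall t, J f' t = J f t \/ touched t].
Proof.
elim: k f => [|k IHk] f Hrow Hf.
  exists f; split=> // [|i|t]; [|lia|by left].
  by apply: conseq_J0 two_neq0 commC_S commB_S _ _ => t; rewrite J_sub subrr.
pose i := Pos.of_nat (Pos.to_nat n + k).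
have Ei : Pos.to_nat i = (Pos.to_nat n + k)%N by rewrite /i; lia.
have [|c [v [[okv [p Sp Hp]] /zF_neq0 c0 Hv]]] := Hrow i; first by lia.
have /andP[/= oki {}okv] := okv.
(* At numbers from [i] on, the consequence [p] is seen only through its pivot. *)
have Jp j : okb j -> (Pos.to_nat i <= Pos.to_nat j)%N ->
    J p (mon j) = if Pos.eqb i j then zF F c else 0.
  move=> okj ij; rewrite Hp sumv_cons /= J_mon //.
  have -> : sumv (fun k => J (tp F (mon k)) (mon j)) v = 0.
    elim: v i Hv okv {Ei oki Hrow Hp} ij => [|[h d] v IH] i' /=; first by rewrite sumv_nil.
    case/andP=> /Pos.ltb_spec0 hi Hv /andP[okh okv] ij.
    rewrite sumv_cons /= J_mon // (IH h) //; last by lia.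
    by case: Pos.eqb_spec => [E|_]; [move: hi ij; rewrite E; lia|rewrite mulr0 addr0].
  by rewrite addr0; case: Pos.eqb; rewrite ?mulr1 ?mulr0.
(* The factor is chosen to cancel the coordinate of [f] at [i]. *)
pose f1 := sub f (Scale (J f (mon i) / zF F c) p).
have Jf1 t : J f1 t = J f t - J f (mon i) / zF F c * J p t by rewrite J_sub.
have Hf1 : jnull f1.
  move=> chi Hchi; have Hp0 := jnull_conseq jnull_S Sp.
  by rewrite /= Hf // Hp0 // !mulr0 addr0.
have [|f' [Hf' Sf' clean' same' touch']] := IHk f1 _ Hf1.
  by move=> j Hj; apply: Hrow; lia.
exists f'; split=> //.
- apply: (conseq_cong (q := sub f1 f')).
    apply: cq_ext (cq_scale (J f (mon i) / zF F c) Sp) _ => t /=; by ring.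
  exact: Sf'.
- move=> j Hj; case: (Pos.eq_dec j i) => [->|ne]; last by apply: clean'; lia.
  rewrite /clean same' ?Jf1 ?Jp ?Pos.eqb_refl ?Ei //.
  by rewrite divfK // subrr.
- move=> j okj Hj; rewrite same' ?Jf1 ?Jp //; try lia.
  by case: Pos.eqb_spec => [E|_]; [move: Hj; rewrite -E; lia|rewrite mulr0 subr0].
(* A monomial where [p] has a nonzero coordinate is seen by some entry of its row. *)
move=> t; case: (touch' t) => [->|]; last by right.
rewrite Jf1; have [->|H] := eqVneq (J p t) 0; first by left; rewrite mulr0 subr0.
right; have okv' : all (fun e => okb e.1) ((i, c) :: v) by rewrite /= oki.
move: H; rewrite Hp; elim: ((i, c) :: v) okv' => [|[j d] w IHw] /=.
  by rewrite sumv_nil eqxx.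
case/andP=> okj okw; rewrite sumv_cons /=.
have [->|H _] := eqVneq (J (tp F (mon j)) t) 0; first by rewrite mulr0 add0r; apply: IHw.
by exists j.
Qed.

Variables (rows : seq positive) (funs : seq positive).
Variables (row : positive -> comb) (fn : positive -> seq term).

Hypothesis row_ok : forall it, all (fun e => uniq (leaves e.2)) (row it) /\
  conseq S (zp F (ren_comb s (row it))).
Hypothesis fn_ok : forall it, all (fun t => uniq (leaves t)) (fn it) /\
  forall f, jnull f -> \sum_(t <- fn it) J f (ren s t) = 0.

(** The consequences clear the numbers from [n] on; the class equations still hold for the result
    and force the remaining coordinates to be zero. Hence every monomial of the block ends at 0, and
    the others keep their coordinates. *)
Lemma clear_component f : solved ix n (map row rows) (map fn funs) -> jnull f ->
  exists f', [/\ jnull f', conseq S (sub f f'),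
    forall i, (Pos.to_nat i < Pos.to_nat (ixN ix))%N -> clean f' i &
    forall t, J f' t = J f t \/ J f' t = 0].
Proof.
rewrite /solved -!map_comp => /andP[Hrows Hfuns] Hf.
have Prow : pivots_ok is_row (echelon [seq (vec_of ix \o row) it | it <- rows]).
  apply: (P_echelon is_row_lcmb) => it /=; by apply: is_row_vec; case: (row_ok it).
have [|f' [Hf' Sf' clean' _ touch']] :=
    @kill_pivots (Pos.to_nat (ixN ix) - Pos.to_nat n) f _ Hf.
  move=> i Hi.
  have Hi' : (Pos.to_nat n <= Pos.to_nat i < Pos.to_nat (ixN ix))%N by lia.
  have /pivot_okP[c [v [/Prow Hv c0 bv]]] := all_betweenP Hrows Hi'.
  by exists c, v.
have {}clean' i : (Pos.to_nat n <= Pos.to_nat i < Pos.to_nat (ixN ix))%N -> clean f' i.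
  by move=> Hi; apply: clean'; lia.
pose x i := J f' (mon i).
set keep := fun e : positive * Z => _ in Hfuns.
have Pfun : pivots_ok (fun v => sumv x v = 0)
    (echelon [seq (fun it => filter keep (vec_of ix (ones (fn it)))) it | it <- funs]).
  apply: P_echelon => [a b v w Hv Hw|it]; first by rewrite sumv_lcmb Hv Hw !mulr0 addr0.
  have [Ufn Hfn] := fn_ok it.
  (* The entries removed by [keep] lie at numbers where [f'] has just been cleared. *)
  have -> v : sumv x (filter keep v) = sumv x v.
    elim: v => //= -[i c] v IHv; case: ifP => Hk; rewrite !sumv_cons ?IHv //.
    move: Hk; rewrite /keep /= => /norP[/Pos.ltb_spec0 H1 /Pos.leb_spec0 H2].
    by rewrite /x clean' ?mulr0 ?add0r //; lia.
  case: (@vec_of_ok (ones (fn it))) => [|->|[_ Hv]].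
  - by rewrite all_map; apply: sub_all Ufn.
  - by rewrite sumv_nil.
  rewrite /x (Hv (fun m => J f' (ren s m))); last by move=> t; apply: jeq_ccanon.
  rewrite big_map -[RHS](Hfn _ Hf'); apply: eq_bigr => t _.
  by rewrite mul1r.
(* Strong induction on the number: besides its pivot, an equation involves only smaller numbers. *)
have {}clean' i : (Pos.to_nat i < Pos.to_nat (ixN ix))%N -> clean f' i.
  have [k] := ubnP (Pos.to_nat i); elim: k i => // k IHk i Hk Hi.
  case: (ltnP (Pos.to_nat i) (Pos.to_nat n)) => Hin; last by apply: clean'; lia.
  have Hi' : (Pos.to_nat 1 <= Pos.to_nat i < Pos.to_nat n)%N by lia.
  have /pivot_okP[c [v [/Pfun Hv /zF_neq0 c0 bv]]] := all_betweenP Hfuns Hi'.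
  move: Hv; rewrite sumv_cons (sumv_below _ bv) ?addr0 => [|j Hj]; last by apply: IHk; lia.
  by move/eqP; rewrite mulf_eq0 /= (negPf c0) => /eqP.
exists f'; split=> // t; case: (touch' t) => [|[i oki]]; first by left.
move/J_tp_neq0 => H; right; rewrite -H; apply: clean'.
by case/and4P: oki => _ /Pos.ltb_spec0 Hi _ _; lia.
Qed.

End Solve.

(** * Linearization as a sum over fillings *)

Fixpoint matches (r : nat -> nat -> bool) (m t : term) : bool :=
  match m, t with
  | TV i, TV j => r i j
  | TC u v, TC x y => matches r u x && matches r v y
  | TB u v, TB x y => matches r u x && matches r v y
  | _, _ => false
  end.

Lemma leaves_rlb t n : leaves (rlb t n).1 = iota n (size (leaves t)).
Proof.
elim: t n => //= u IHu v IHv n; rewrite size_cat iotaD;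
  move: (IHu n) (rlbE u n); case: (rlb u n) => a k /= Ha ->;
  by move: (IHv (n + size (leaves u))%N); case: (rlb v _) => b l /= Hb; rewrite Ha Hb.
Qed.

Lemma all2b_cat r s s' w w' : size s = size w ->
  all2b r (s ++ s') (w ++ w') = all2b r s w && all2b r s' w'.
Proof. by elim: s w => [|i s IHs] [|j w] //= [/IHs->]; rewrite andbA. Qed.

Lemma matches_rlb r s m n :
  matches r m (ren s (rlb m n).1) = all2b r (leaves m) (map s (iota n (size (leaves m)))).
Proof.
elim: m n => /= [i|u IHu v IHv|u IHu v IHv] n; first by rewrite andbT.
- rewrite size_cat iotaD map_cat all2b_cat ?size_map ?size_iota // -IHu.
  rewrite -IHv; move: (rlbE u n); case: (rlb u n) => a k /= ->.
  by case: (rlb v _) => b l.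
- rewrite size_cat iotaD map_cat all2b_cat ?size_map ?size_iota // -IHu.
  rewrite -IHv; move: (rlbE u n); case: (rlb u n) => a k /= ->.
  by case: (rlb v _) => b l.
Qed.

Lemma matches_shape r m t n : matches r m t -> rlb m n = rlb t n.
Proof.
elim: m t n => [i|u IHu v IHv|u IHu v IHv] [j|x y|x y] n //= /andP[/IHu Hu /IHv Hv];
  by rewrite Hu; case: (rlb x n) => a k; rewrite Hv.
Qed.

Lemma fill_leaves w m : size w = size (leaves m) -> leaves (ren (nth 0%N w) (shape m)) = w.
Proof. by move=> Sw; rewrite leaves_ren leaves_rlb map_nth_iota0 -Sw ?take_size. Qed.

(** Relates the multilinearity test of [lin], which counts occurrences, to the enumeration of
    permutations; the number of leaves excludes further variables. *)
Lemma perm_iota_occ t n : size (leaves t) = n ->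
  perm_eq (leaves t) (iota 0 n) = all (fun j => occ j t == 1%N) (iota 0 n).
Proof.
move=> St; apply/idP/allP => [H j Hj|H].
  by rewrite occ_count (permP H) count_uniq_mem ?iota_uniq // Hj.
have sub : {subset iota 0 n <= leaves t}.
  by move=> j /H; rewrite occ_count -has_pred1 has_count => /eqP->.
have Hs : (size (leaves t) <= size (iota 0 n))%N by rewrite size_iota St.
have U := leq_size_uniq (iota_uniq 0 n) sub Hs.
have [_ E] := uniq_min_size (iota_uniq 0 n) sub Hs.
by apply: (uniq_perm U (iota_uniq 0 n)) => j; rewrite E.
Qed.

Section Linearization.
Variable F : fieldType.
Implicit Types (g : Defs.poly F) (z : ident).

Lemma sum_eqb (T : eqType) (h : T -> term) (s : seq T) t : uniq (map h s) ->
  \sum_(w <- s) (h w == t)%:R = (t \in map h s)%:R :> F.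
Proof.
elim: s => [|w s IHs] /=; first by rewrite big_nil.
case/andP=> Hw /IHs Hs; rewrite big_cons Hs inE (eq_sym t).
by case: eqP Hw => [->|_ _] /=; [move/negPf->; rewrite addr0|rewrite add0r].
Qed.

(** A filling is determined by its leaves, so the only one that can produce [t] is the word
    [leaves t]. *)
Lemma sum_fill r m n t : size (leaves m) = n ->
  \sum_(w <- permutations (iota 0 n) | all2b r (leaves m) w)
     (ren (nth 0%N w) (shape m) == t)%:R =
  (matches r m t && perm_eq (leaves t) (iota 0 n))%:R :> F.
Proof.
move=> Sm; rewrite -big_filter; set s := filter _ _.
have Sw w : w \in s -> size w = size (leaves m).
  by rewrite mem_filter mem_permutations => /andP[_ /perm_size ->]; rewrite size_iota.
rewrite sum_eqb.
  congr (nat_of_bool _)%:R; apply/mapP/andP => [[w ws ->]|[Hm Hp]].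
    rewrite fill_leaves ?Sw //; move: (ws); rewrite mem_filter mem_permutations => /andP[Hr ->].
    by split=> //; rewrite /shape matches_rlb -(Sw w ws) map_nth_iota0 // take_size.
  exists (leaves t); last by rewrite /shape (matches_shape 0 Hm) -/(shape t) ren_shape.
  rewrite mem_filter mem_permutations Hp andbT.
  have := Hm; rewrite -{1}(ren_shape t) /shape -(matches_shape 0 Hm) matches_rlb.
  have <- : size (leaves t) = size (leaves m) by rewrite (perm_size Hp) size_iota Sm.
  by rewrite map_nth_iota0 // take_size.
rewrite map_inj_in_uniq ?filter_uniq ?permutations_uniq // => w w' /Sw Hw /Sw Hw' E.
by rewrite -(fill_leaves Hw) E fill_leaves.
Qed.

Lemma coef_psum (s : seq nat) t : uniq s ->
  coef (psum [seq Var k | k <- s]) t = (if t is TV j then j \in s else false)%:R :> F.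
Proof.
elim: s => [_|k s IHs] /=; first by case: t.
case/andP=> ks /IHs -> {IHs}; case: t => [j|u v|u v]; rewrite ?addr0 // inE (eq_sym j).
by case: eqP ks => [->|_ _] /=; [move/negPf->; rewrite addr0|rewrite add0r].
Qed.

Lemma mem_in_range lo d j : (j \in iota lo d) = in_range lo d j.
Proof. by rewrite mem_iota /in_range; lia. Qed.

Lemma coef_subst_zp s (l : comb) t :
  coef (subst s (zp F l)) t = \sum_(e <- l) zF F e.1 * coef (subst s (tp F e.2)) t.
Proof. by elim: l => [|e l IHl] /=; rewrite ?big_nil // big_cons IHl. Qed.

(** The first hypothesis compares [g] and [body z] under every substitution; for most identities
    both sides are convertible. *)
Lemma lin_linz g z :
    (forall s t, coef (subst s g) t = coef (subst s (zp F (body z))) t) ->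
    hdeg 0 g = dega z -> hdeg 1 g = degb z -> hdeg 2 g = degc z ->
    all (fun e => size (leaves e.2) == deg z) (body z) ->
  forall t, coef (zp F (linz z)) t = lin g t.
Proof.
move=> Hg Ha Hb Hc /allP Hdeg t; rewrite /lin Ha Hb Hc -/(deg z); set s := (X in subst X g).
set r := is_copy (dega z) (degb z) (degc z).
(* Each variable becomes a sum of distinct copies, so a monomial occurs at most once, namely when
   every leaf is a copy of the variable in its place. *)
have Hs m u : coef (subst s (tp F m)) u = (matches r m u)%:R.
  elim: m u => [i|m IHm m' IHm'|m IHm m' IHm'] [j|x y|x y] //=;
    try by case: i => [|[|[|i]]]; rewrite /= ?coef_psum ?iota_uniq.
  - case: i => [|[|[|i]]]; rewrite /= ?coef_psum ?iota_uniq ?mem_in_range //.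
    rewrite -[match j with _.+3 => _ | _ => _ end]/(Nat.eqb i.+3 j).
    by case: eqP => H; case: Nat.eqb_spec.
  - by rewrite IHm IHm' -natrM mulnb.
  - by rewrite IHm IHm' -natrM mulnb.
have -> : coef (zp F (linz z)) t = \sum_(e <- body z)
    zF F e.1 * (matches r e.2 t && perm_eq (leaves t) (iota 0 (deg z)))%:R.
  rewrite coef_zp /linz big_flatten big_map; apply: eq_big_seq => e /Hdeg/eqP He.
  by rewrite big_map big_filter /= -big_distrr /= sum_fill.
have E e : e \in body z -> (matches r e.2 t && perm_eq (leaves t) (iota 0 (deg z)))%:R =
    (if all (fun j => occ j t == 1%N) (iota 0 (deg z)) then (matches r e.2 t)%:R else 0) :> F.
  move=> /Hdeg/eqP He; case Hm: matches => /=; last by case: all.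
  rewrite perm_iota_occ; first by case: all.
  have := leaves_rlb e.2 0; rewrite (matches_shape 0 Hm) leaves_rlb => /(congr1 size).
  by rewrite !size_iota He.
rewrite (eq_big_seq _ (fun e He => congr1 (fun x => zF F e.1 * x) (E e He))).
case: all; last by rewrite big1 // => e _; rewrite mulr0.
by rewrite Hg coef_subst_zp; apply: eq_bigr => e _; rewrite Hs.
Qed.

End Linearization.

(** * Lists, completeness of the shapes, and the certificate *)

Fixpoint AllP (T : Type) (P : T -> Prop) (s : seq T) : Prop :=
  if s is x :: s' then P x /\ AllP P s' else True.

Lemma AllP_cat T (P : T -> Prop) s s' : AllP P s -> AllP P s' -> AllP P (s ++ s').
Proof. by elim: s => //= x s IHs [Px /IHs Hs] /Hs. Qed.

Lemma AllP_map T U (P : U -> Prop) (h : T -> U) s : (forall x, P (h x)) -> AllP P (map h s).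
Proof. by move=> H; elim: s. Qed.

Lemma AllP_flatten T U (P : T -> Prop) (Q : U -> Prop) (h : T -> seq U) s :
  (forall x, P x -> AllP Q (h x)) -> AllP P s -> AllP Q (flatten (map h s)).
Proof. by move=> H; elim: s => //= x s IHs [/H Hx /IHs]; apply: AllP_cat. Qed.

Lemma AllP_and T (P Q : T -> Prop) s : AllP P s -> AllP Q s -> AllP (fun x => P x /\ Q x) s.
Proof. by elim: s => //= x s IHs [Px /IHs H] [Qx /H]. Qed.

Lemma AllP_all T (p : pred T) s : all p s -> AllP p s.
Proof. by elim: s => //= x s IHs /andP[px /IHs]. Qed.

Lemma find_number T (P : T -> Prop) s j x : AllP P s -> PM.find j (number s) = Some x -> P x.
Proof.
move=> Hs; rewrite /number.
have : forall j x, PM.find j (xH, PM.empty T).2 = Some x -> P x by move=> k y /=; rewrite PM.gempty.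
elim: s (xH, PM.empty T) Hs j x => [|y s IHs] st /= Hs j x Hst; first exact: Hst.
case: Hs => Py Hs; apply: IHs => //= k z; case: (Pos.eq_dec st.1 k) => [<-|ne].
  by rewrite PM.gss => -[<-].
by rewrite PM.gso; [apply: Hst|move/esym].
Qed.

Lemma nth_pmap_ex (T U : Type) (h : T -> option U) s x0 k : (k < size (pmap h s))%N ->
  exists x, h x = Some (nth x0 (pmap h s) k).
Proof.
elim: s k => //= x s IHs k; case E: (h x) => [y|] /=; last exact: IHs.
by case: k => [|k] Hk; [exists x|apply: IHs].
Qed.

Lemma shapes_rlb t f b : (size (leaves t) <= f)%N -> (rlb t b).1 \in shapes f b (size (leaves t)).
Proof.
have S u : (0 < size (leaves u))%N by elim: u => //= u Hu v _; rewrite size_cat; lia.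
elim: t f b => [i|u IHu v IHv|u IHu v IHv] [|f] b //=; first by rewrite inE.
- by rewrite size_cat; have := S u; lia.
- have [Su Sv] := (S u, S v); rewrite size_cat => Hf.
  (* Exhibits the size as at least 2, so that the test for a single leaf in [shapes] reduces. *)
  have -> : (size (leaves u) + size (leaves v))%N = (size (leaves u) + size (leaves v)).-2.+2 by lia.
  apply/flattenP; eexists.
    by apply/mapP; exists (size (leaves u)); [|reflexivity]; rewrite mem_iota; lia.
  rewrite mem_cat; apply/orP; left.
  have := rlbE u b; have := IHu f b; case: (rlb u b) => x k /= Hu ->.
  have := IHv f (b + size (leaves u))%N; case: (rlb v _) => y l /= Hv.
  apply: allpairs_f; first by apply: Hu; lia.
  have -> : ((size (leaves u) + size (leaves v)).-2.+2 - size (leaves u))%N = size (leaves v) by lia.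
  by apply: Hv; lia.
- by rewrite size_cat; have := S u; lia.
- have [Su Sv] := (S u, S v); rewrite size_cat => Hf.
  have -> : (size (leaves u) + size (leaves v))%N = (size (leaves u) + size (leaves v)).-2.+2 by lia.
  apply/flattenP; eexists.
    by apply/mapP; exists (size (leaves u)); [|reflexivity]; rewrite mem_iota; lia.
  rewrite mem_cat; apply/orP; right.
  have := rlbE u b; have := IHu f b; case: (rlb u b) => x k /= Hu ->.
  have := IHv f (b + size (leaves u))%N; case: (rlb v _) => y l /= Hv.
  apply: allpairs_f; first by apply: Hu; lia.
  have -> : ((size (leaves u) + size (leaves v)).-2.+2 - size (leaves u))%N = size (leaves v) by lia.
  by apply: Hv; lia.
Qed.

(** Outside the word, [i] goes to [sumn w + i], beyond all entries of [w]. Unlike [nth 0], this is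
    injective for a duplicate-free nonempty word, as needed to transport a block. *)
Definition extend (w : seq nat) (i : nat) := nth (sumn w + i)%N w i.

Lemma extend_inj w : uniq w -> (0 < size w)%N -> injective (extend w).
Proof.
move=> Uw Sw; rewrite /extend => i j.
have small k d : (k < size w)%N -> (nth d w k <= sumn w)%N.
  elim: (w) k => //= x u IHu [|k] Hk /=; first by lia.
  by have := IHu k Hk; lia.
case: (ltnP i (size w)) => Hi; case: (ltnP j (size w)) => Hj.
- by rewrite (set_nth_default (sumn w + j)%N) // => /eqP; rewrite nth_uniq // => /eqP.
- by rewrite [RHS]nth_default // => E; have := small i (sumn w + i)%N Hi; rewrite E; lia.
- by rewrite [LHS]nth_default // => E; have := small j (sumn w + j)%N Hj; rewrite -E; lia.
- by rewrite !nth_default //; lia.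
Qed.

Lemma ren_extend t : ren (extend (leaves t)) (shape t) = t.
Proof. by apply: ren_rlb => k Hk; rewrite /extend add0n; apply: set_nth_default. Qed.

(* [vanishes] shows that the identities hold in the free algebra; [solved], inside [solve], shows that
   consequences and functionals have complementary ranks on each block; [covered] shows that every
   monomial of degree 6 is a renaming of a monomial of some block. *)
Definition certificate tab cls b4 b5 b6 : bool :=
  let T := templates b4 b5 b6 in
  let tm := number T in
  let cl := number cls in
  let ixs := pmap (solve tm cl) data in
  let cov := (foldl add_cover (PM.empty _, 0%N) ixs).1 in
  [&& all (vanishes tab) (b4 ++ b5 ++ b6),
      all (all (fun e : Z * term => uniq (leaves e.2))) T,
      all (fun L => [&& closedA L, uniq L & all (fun t => uniq (leaves t)) L]) cls
    & all (covered cov ixs) (shapes 6 0 6)].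

Definition classes456 := classes (classes (classes (PM.empty _) 4).1 5).1 6.

(** [classes] conses the classes as they are found; [rev] restores the order of discovery, to which
    the class numbers in [data] refer. The evaluation takes place when the kernel checks the
    cast. *)
Lemma certificate_true : certificate classes456.1 (rev classes456.2)
  (map template ids4) (map template ids5) (map template ids6).
Proof. by vm_cast_no_check (erefl true). Qed.

(** * From the certificate to all multilinear identities of degree 6 *)

Section Reduction.
Variables (F : fieldType) (S : Defs.poly F -> Prop).
Hypothesis charF0 : [pchar F] =i pred0.
Hypothesis commC_S : conseq S (sub (MulC (Var 0) (Var 1)) (MulC (Var 1) (Var 0))).
Hypothesis commB_S : conseq S (sub (MulB (Var 0) (Var 1)) (MulB (Var 1) (Var 0))).
Hypothesis jnull_S : forall p, S p -> jnull p.
Implicit Types (p q f : Defs.poly F).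

Let CS (l : comb) := conseq S (zp F l).

Lemma CS_ren s l : CS l -> CS (ren_comb s l).
Proof.
move=> /(cq_subst (fun i => Var (s i))); rewrite /CS.
have <- : subst (fun i => Var (s i)) (zp F l) = zp F (ren_comb s l).
  have E t : subst (fun i => Var (s i)) (tp F t) = tp F (ren s t).
    by elim: t => //= u -> v ->.
  by elim: l => //= e l ->; rewrite E.
by [].
Qed.

(** The lifts are a substitution instance and a product, so two rules of [conseq] cover them. *)
Lemma CS_lifts n l : CS l -> AllP CS (lifts n l).
Proof.
move=> Sl; apply: AllP_cat; apply: AllP_cat => //=.
- apply: AllP_map => i.
  have := cq_subst (fun j => if Nat.eqb i j then MulC (Var i) (Var n) else Var j) Sl.
  have E t : subst (fun j => if Nat.eqb i j then MulC (Var i) (Var n) else Var j) (tp F t) =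
      tp F (tsub i (TC (TV i) (TV n)) t).
    by elim: t => [j|u /= -> v ->|u /= -> v ->] //=; case: Nat.eqb.
  by congr conseq; elim: (l) => //= e l' ->; rewrite E.
- split=> //; apply: cq_ext (cq_mulCr (Var n) Sl) _ => t.
  by rewrite !coef_pr /= !pr_zp big_map.
- apply: AllP_map => i.
  have := cq_subst (fun j => if Nat.eqb i j then MulB (Var i) (Var n) else Var j) Sl.
  have E t : subst (fun j => if Nat.eqb i j then MulB (Var i) (Var n) else Var j) (tp F t) =
      tp F (tsub i (TB (TV i) (TV n)) t).
    by elim: t => [j|u /= -> v ->|u /= -> v ->] //=; case: Nat.eqb.
  by congr conseq; elim: (l) => //= e l' ->; rewrite E.
- split=> //; apply: cq_ext (cq_mulBr (Var n) Sl) _ => t.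
  by rewrite !coef_pr /= !pr_zp big_map.
Qed.

Variables (tab : PM.t term) (cls : seq (seq term)) (b4 b5 b6 : seq comb).
Hypothesis cert : certificate tab cls b4 b5 b6.
Hypotheses (S4 : AllP CS b4) (S5 : AllP CS b5) (S6 : AllP CS b6).

Lemma CS_templates : AllP CS (templates b4 b5 b6).
Proof.
apply: AllP_cat => //; apply: AllP_flatten (CS_lifts 5) _.
by apply: AllP_cat => //; apply: AllP_flatten (CS_lifts 4) _.
Qed.

Lemma row_of_ok s it :
  all (fun e => uniq (leaves e.2)) (row_of (number (templates b4 b5 b6)) it) /\
  CS (ren_comb s (row_of (number (templates b4 b5 b6)) it)).
Proof.
have Z : CS [::] by apply: cq_zero.
rewrite /row_of; case: (item it) => w j; case: ifP => // Hw.
case E: PM.find => [l|] //.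
have [_ /AllP_all HT _ _] := and4P cert.
have [Sl Ul] := find_number (AllP_and CS_templates HT) E.
split; last by do 2!apply: CS_ren.
rewrite all_map; apply: sub_all Ul => e /=; rewrite leaves_ren map_inj_uniq //.
exact: word_fun_inj.
Qed.

Lemma fun_of_ok s it : injective s -> all (fun t => uniq (leaves t)) (fun_of (number cls) it) /\
  forall f, jnull f -> \sum_(t <- fun_of (number cls) it) J f (ren s t) = 0.
Proof.
have Z : all (fun t => uniq (leaves t)) [::] /\
    forall f, jnull f -> \sum_(t <- [::]) J f (ren s t) = 0.
  by split=> // f _; rewrite big_nil.
move=> s_inj; rewrite /fun_of; case: (item it) => w j; case: ifP => // Hw.
case E: PM.find => [L|] //.
have [_ _ /AllP_all HL _] := and4P cert.
have /and3P[CL UL LL] := find_number HL E.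
have w_inj := word_fun_inj Hw; split.
  by rewrite all_map; apply: sub_all LL => t /=; rewrite leaves_ren map_inj_uniq.
move=> f Hf; rewrite big_map -[RHS](class_sum (inj_comp s_inj w_inj) CL UL Hf).
by apply: eq_bigr => t _; rewrite ren_comp.
Qed.

(** The shape of [t] is, up to commutativity, a renaming by [q] of a monomial in a solved block, and
    [t] is a renaming of its shape; the composite carries that block onto the block of [t]. *)
Lemma clear_term f t : jnull f -> uniq (leaves t) -> size (leaves t) = 6%N ->
  exists f', [/\ jnull f', conseq S (sub f f'), J f' t = 0 &
    forall t', J f' t' = J f t' \/ J f' t' = 0].
Proof.
move=> Hf Ut St; have [_ _ _ /allP Hcov] := and4P cert.
have := Hcov (shape t); rewrite -St => /(_ (shapes_rlb _ _)); rewrite St leqnn => /(_ isT).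
rewrite /covered; case: PM.find => // -[k i] /and4P[].
set ixs := pmap _ _; set ix := nth _ _ _; set q := map _ _.
move=> /Nat.ltb_spec0 Hk /Pos.ltb_spec0 Hi Hq /term_eqP Eq.
have {}Hk : (k < size ixs)%N by lia.
have [d] := nth_pmap_ex numbering0 Hk; rewrite -/ixs -/ix /solve.
case: arrange => ix' n; case: ifP => // Hs [Eix]; rewrite {}Eix in Hs.
have w_inj : injective (extend (leaves t)) by apply: extend_inj; rewrite ?St.
have s_inj := inj_comp w_inj (word_fun_inj Hq).
have [f' [Hf' Sf' Cf' Tf']] := clear_component charF0 commC_S commB_S jnull_S s_inj
  (row_of_ok _) (fun it => fun_of_ok it s_inj) Hs Hf.
exists f'; split=> //.
(* Replaces [t] by the image of the stored block monomial, passing through both normal forms. *)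
rewrite -(ren_extend t) -(@jeq_ccanon F) -Eq jeq_ccanon ren_comp.
by apply: Cf'; lia.
Qed.

(** The last clause carries the induction: a later block never makes a vanished coordinate
    reappear. *)
Lemma clear_terms f (ts : seq term) : jnull f ->
  {in ts, forall t, uniq (leaves t) /\ size (leaves t) = 6%N} ->
  exists f', [/\ jnull f', conseq S (sub f f'), {in ts, forall t, J f' t = 0} &
    forall t, J f' t = J f t \/ J f' t = 0].
Proof.
move=> Hf; elim: ts => [|t ts IHts] Hts.
  exists f; split=> // [|t]; last by left.
  by apply: (conseq_J0 (two_neq0 charF0) commC_S commB_S) => t; rewrite J_sub subrr.
have [|f1 [Hf1 Sf1 Zf1 Tf1]] := IHts; first by move=> u uts; apply: Hts; rewrite inE uts orbT.
have [Ut St] := Hts t (mem_head _ _).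
have [f2 [Hf2 Sf2 Zf2 Tf2]] := clear_term Hf1 Ut St.
exists f2; split=> //.
- apply: cong_trans Sf1 Sf2.
- move=> u; rewrite inE => /predU1P[->//|/Zf1 E]; by case: (Tf2 u) => ->.
- by move=> u; case: (Tf2 u) => ->; [apply: Tf1|right].
Qed.

Lemma multilinear_J f t : multilinear6 f -> J f t != 0 ->
  uniq (leaves t) /\ size (leaves t) = 6%N.
Proof.
move=> [vs [Uvs Svs Hvs]]; rewrite J_pr (pr_supp _ (undup_uniq (supp f))); last first.
  by move=> u; rewrite mem_undup.
move=> H; have : has (fun u => coef f u * J (tp F u) t != 0) (undup (supp f)).
  apply: contraNT H => /hasPn H; rewrite big1_seq // => u /= /H.
  by rewrite negbK => /eqP.
case/hasP=> u _; rewrite mulf_eq0 negb_or => /andP[/Hvs Hu /J_tp_leaves ut].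
have uv : perm_eq (leaves u) vs.
  by apply/allP => i _ /=; rewrite -occ_count Hu count_uniq_mem.
rewrite perm_sym in ut; have tv := perm_trans ut uv.
by rewrite (perm_uniq tv) (perm_size tv).
Qed.

(** Only finitely many monomials occur in the Jordan expansion; clearing these leaves a polynomial
    all of whose coordinates vanish. *)
Lemma conseq_multilinear6 f : multilinear6 f -> jnull f -> conseq S f.
Proof.
move=> Mf Hf; pose ts := [seq t <- supp (jordan f) | J f t != 0].
have [|f' [_ Sf' Zf' Tf']] := @clear_terms f ts Hf.
  by move=> t; rewrite mem_filter => /andP[Jt _]; apply: multilinear_J Jt.
apply: conseq_cong Sf' _; apply: (conseq_J0 (two_neq0 charF0) commC_S commB_S) => t.
have [E|ne] := eqVneq (J f t) 0; first by case: (Tf' t) => ->.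
by apply: Zf'; rewrite mem_filter ne; apply: coef_supp.
Qed.

End Reduction.

(** * The integer identities are consequences of the generators *)

Section Generators.
Variable F : fieldType.
Hypothesis charF0 : [pchar F] =i pred0.
Let gensF := @gens F.

Lemma ren_id t : ren id t = t.
Proof. by elim: t => //= u -> v ->. Qed.

Lemma sumv_nrm (l : comb) t :
  sumv (fun k => J (tp F (decode k)) t) (nrm l) = J (zp F l) t.
Proof.
rewrite sumv_sort /sumv big_map J_zp; apply: eq_bigr => e _ /=.
by rewrite codeK !(J_tp_sym F _ t) -(ren_id (ccanon _)) jeq_ccanon ren_id.
Qed.

Lemma J_denrm v t : J (zp F (denrm v)) t = sumv (fun k => J (tp F (decode k)) t) v.
Proof. by rewrite J_zp big_map. Qed.

Lemma sumv_div (h : positive -> F) d v : d <> Z0 -> Z.divide d (content v) ->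
  sumv h v = zF F d * sumv h [seq (e.1, Z.div e.2 d) | e <- v].
Proof.
move=> d0; elim: v => [|[k c] v IHv] /= Hd; first by rewrite !sumv_nil mulr0.
have [q Eq] := Z.divide_trans _ _ _ Hd (Z.gcd_divide_l _ _).
rewrite !sumv_cons IHv /=; last exact: Z.divide_trans Hd (Z.gcd_divide_r _ _).
by rewrite Eq Z.div_mul // zFM; ring.
Qed.

Lemma conseq_linz (g : Defs.poly F) z : List.In g (identities F) ->
    (forall s t, coef (subst s g) t = coef (subst s (zp F (body z))) t) ->
    hdeg 0 g = dega z -> hdeg 1 g = degb z -> hdeg 2 g = degc z ->
    all (fun e => size (leaves e.2) == deg z) (body z) ->
  conseq gensF (zp F (linz z)).
Proof. by move=> Hg H Ha Hb Hc Hd; apply: cq_gen; exists g => //; apply: lin_linz. Qed.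

Ltac in_identities := rewrite /=; repeat (first [by left | right]).

Lemma conseq_commC : conseq gensF (sub (MulC (Var 0) (Var 1)) (MulC (Var 1) (Var 0))).
Proof.
have H : conseq gensF (zp F (linz z_commC)).
  by apply: (conseq_linz (g := commC F)) => //; in_identities.
(* Commutativity is already multilinear, so linearizing returns it unchanged. *)
apply: cq_ext H _ => t; have -> : linz z_commC = body z_commC by vm_compute.
by rewrite coef_sub /= -!/(zF F _) -[zF F (Zneg 1)]/(-1 : F) mul1r mulN1r addr0.
Qed.

Lemma conseq_commB : conseq gensF (sub (MulB (Var 0) (Var 1)) (MulB (Var 1) (Var 0))).
Proof.
have H : conseq gensF (zp F (linz z_commB)).
  by apply: (conseq_linz (g := commB F)) => //; in_identities.
apply: cq_ext H _ => t; have -> : linz z_commB = body z_commB by vm_compute.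
by rewrite coef_sub /= -!/(zF F _) -[zF F (Zneg 1)]/(-1 : F) mul1r mulN1r addr0.
Qed.

(** Normalizing changes a combination only modulo commutativity, and the content divided out is
    invertible in characteristic 0. *)
Lemma conseq_template z : conseq gensF (zp F (linz z)) -> conseq gensF (zp F (template z)).
Proof.
rewrite /template /primitive; case: Z.eqb_spec => [_ _|c0]; first exact: cq_zero.
set c := content _ in c0 *; move/(cq_scale (zF F c)^-1).
apply: (conseq_J (two_neq0 charF0) conseq_commC conseq_commB) => t.
rewrite J_denrm -[J (Scale _ _) t]/(_ * J (zp F (linz z)) t) -sumv_nrm.
by rewrite (sumv_div _ c0 (Z.divide_refl _)) mulrA mulVf ?mul1r ?zF_neq0.
Qed.

Lemma conseq_ids4 : AllP (fun l => conseq gensF (zp F l)) (map template ids4).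
Proof.
do !split; apply: conseq_template.
- by apply: (conseq_linz (g := jordanC F)) => //; in_identities.
- by apply: (conseq_linz (g := jordanB F)) => //; in_identities.
- by apply: (conseq_linz (g := id_ii F)) => //; in_identities.
Qed.

Lemma conseq_ids5 : AllP (fun l => conseq gensF (zp F l)) (map template ids5).
Proof.
do !split; apply: conseq_template.
- by apply: (conseq_linz (g := id_iii1 F)) => //; in_identities.
- by apply: (conseq_linz (g := id_iii2 F)) => //; in_identities.
Qed.

(** [g12] is a difference of two sums, while [z_g12] is one flat list with the second half negated,
    so this comparison is not mere conversion. *)
Lemma coef_subst_g12 s t : coef (subst s (g12 F)) t = coef (subst s (zp F (body z_g12))) t.
Proof.
have zFN x : zF F (Z.opp x) = - zF F x.
  by apply/eqP; rewrite -addr_eq0 -zFD Z.add_opp_diag_l.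
transitivity (1 * coef (subst s (zp F (z_E12 (TV 1) (TV 2)))) t +
    (-1 * coef (subst s (zp F (z_E12 (TV 2) (TV 1)))) t + 0)); first by [].
rewrite !coef_subst_zp [RHS]big_cat big_map mul1r mulN1r addr0 -sumrN; congr (_ + _).
by apply: eq_bigr => e _; rewrite zFN mulNr.
Qed.

Lemma conseq_ids6 : AllP (fun l => conseq gensF (zp F l)) (map template ids6).
Proof.
do !split; apply: conseq_template.
- by apply: (conseq_linz (g := g3 F)) => //; in_identities.
- by apply: (conseq_linz (g := g4 F)) => //; in_identities.
- by apply: (conseq_linz (g := g5 F)) => //; in_identities.
- by apply: (conseq_linz (g := g6 F)) => //; in_identities.
- by apply: (conseq_linz (g := g7 F)) => //; in_identities.
- by apply: (conseq_linz (g := g8 F)) => //; in_identities.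
- by apply: (conseq_linz (g := g9 F)) => //; in_identities.
- by apply: (conseq_linz (g := g10 F)) => //; in_identities.
- by apply: (conseq_linz (g := g11 F)) => //; in_identities.
- by apply: (conseq_linz (g := g12 F)) => //; [in_identities|apply: coef_subst_g12].
- by apply: (conseq_linz (g := g13 F)) => //; in_identities.
- by apply: (conseq_linz (g := g14 F)) => //; in_identities.
Qed.

End Generators.

(** * Assembling the theorem *)

Lemma conseq_idem (F : fieldType) (S S' : Defs.poly F -> Prop) p :
  (forall q, S' q -> conseq S q) -> conseq S' p -> conseq S p.
Proof.
move=> H; elim=> {p}.
- exact: H.
- exact: cq_zero.
- by move=> *; apply: cq_add.
- by move=> *; apply: cq_scale.
- by move=> *; apply: cq_subst.
- by move=> *; apply: cq_mulCl.
- by move=> *; apply: cq_mulCr.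
- by move=> *; apply: cq_mulBl.
- by move=> *; apply: cq_mulBr.
- by move=> p q _ Hp e; apply: cq_ext Hp e.
Qed.

Lemma conseq_of_certificate (F : fieldType) tab cls b4 b5 b6 (f : Defs.poly F) :
    [pchar F] =i pred0 -> table_ok F tab -> certificate tab cls b4 b5 b6 ->
    AllP (fun l => conseq (@gens F) (zp F l)) b4 ->
    AllP (fun l => conseq (@gens F) (zp F l)) b5 ->
    AllP (fun l => conseq (@gens F) (zp F l)) b6 ->
  multilinear6 f -> jnull f -> conseq (@gens F) f.
Proof.
move=> charF0 tab_ok cert C4 C5 C6 Mf Hf.
(* The reduction needs generators that vanish in the free algebra. Passing to the consequences for
   which this has been verified supplies them, and idempotence of [conseq] leads back to [gens]. *)
pose S p := conseq (@gens F) p /\ jnull p.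
apply: (@conseq_idem _ _ S) => [q []//|].
have in_S bs : AllP (fun l => conseq (@gens F) (zp F l)) bs -> all (vanishes tab) bs ->
    AllP (fun l => conseq S (zp F l)) bs.
  elim: bs => //= l bs IHbs [Hl /IHbs Hbs] /andP[Vl /Hbs]; split=> //.
  by apply: cq_gen; split=> //; apply: jnull_vanishes Vl.
have [+ _ _ _] := and4P cert; rewrite !all_cat => /and3P[V4 V5 V6].
apply: (conseq_multilinear6 charF0 _ _ _ cert) => //.
- apply: cq_gen; split; first exact: conseq_commC.
  (* Both sides of commutativity have the same Jordan expansion up to the order of the summands. *)
  by move=> chi _; rewrite /sub /= mulN1r [X in _ - X]addrC subrr.
- apply: cq_gen; split; first exact: conseq_commB.
  by move=> chi _; rewrite /sub /= mulN1r [X in _ - X]addrC subrr.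
- by move=> p [].
- exact: in_S V4.
- exact: in_S V5.
- exact: in_S V6.
Qed.

Theorem theorem5p4 (F : fieldType) (charF0 : [pchar F]%R =i pred0) (f : Defs.poly F) :
  multilinear6 f -> satisfied_jordan_AIA f -> conseq (@gens F) f.
Proof.
move=> Mf /jnull_satisfied Hf.
have tab_ok : table_ok F classes456.1.
  rewrite /classes456; do 3 apply: table_ok_classes.
  exact: table_ok0.
exact: (conseq_of_certificate charF0 tab_ok certificate_true (conseq_ids4 charF0)
          (conseq_ids5 charF0) (conseq_ids6 charF0) Mf Hf).
Qed.
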